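(* Let $(u_n)_{n\in\mathbb{N}}$ be a sequence in $\mathcal{X}^1$ such that $[p](u_n)\to\frac{\pi}{2}$ in $\mathbb{R}/\pi\mathbb{Z}$ and $E(u_n)\to\mathfrak{E}_{\min}(\frac{\pi}{2})$ as $n\to+\infty$. Then there exist a subsequence $(u_{\sigma(n)})$, a sequence of real numbers $(a_n)$ and a real number $\theta$ such that, as $n\to+\infty$: $u_{\sigma(n)}(\cdot+a_{\sigma(n)})\to e^{i\theta}\mathfrak{v}_0$ uniformly on every compact subset of $\mathbb{R}$; $1-|u_{\sigma(n)}(\cdot+a_{\sigma(n)})|^2\to 1-|\mathfrak{v}_0|^2$ in $L^2(\mathbb{R})$; and $u_{\sigma(n)}'(\cdot+a_{\sigma(n)})\to e^{i\theta}\mathfrak{v}_0'$ in $L^2(\mathbb{R})$.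
   Context: $\mathcal{X}^1=\{w\in L^\infty(\mathbb{R};\mathbb{C}):\ w'\in L^2,\ 1-|w|^2\in L^2\}$. Energy: $E(v)=\frac12\int_\mathbb{R}|v'|^2+\frac14\int_\mathbb{R}(1-|v|^2)^2$. Notation $\langle a,b\rangle=\mathrm{Re}(a\bar b)$. Every $v\in\mathcal{X}^1$ satisfies $|v(x)|\to1$ as $|x|\to\infty$, so $v(\pm R)\neq0$ for $R$ large and $\arg v(\pm R)\in\mathbb{R}/2\pi\mathbb{Z}$ is defined. The untwisted momentum of $v\in\mathcal{X}^1$ is $[p](v)=\lim_{R\to+\infty}\Big(\frac12\int_{-R}^R\langle iv,v'\rangle-\frac12(\arg v(R)-\arg v(-R))\Big)\in\mathbb{R}/\pi\mathbb{Z}$ (this limit exists). Define $\mathfrak{E}_{\min}(\frac{\pi}{2})=\inf\{E(v):\ v\in\mathcal{X}^1,\ [p](v)=\frac{\pi}{2}\bmod\pi\}$. The kink is $\mathfrak{v}_0(x)=\tanh(x/\sqrt2)$. *)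

(* Defs.v *)
(* R : realType, Lebesgue measure on R.
   A complex-valued function v : R -> C is represented by its real and
   imaginary parts (a, b); its derivative by (a', b'). *)
From HB Require Import structures.
From mathcomp Require Import all_boot all_order all_algebra.
From mathcomp Require Import all_classical all_reals all_analysis.
Set Implicit Arguments. Unset Strict Implicit. Unset Printing Implicit Defensive.
Import Order.TTheory GRing.Theory Num.Theory.
Import numFieldNormedType.Exports.
Local Open Scope classical_set_scope.
Local Open Scope ring_scope.

Section Defs.
Variable R : realType.
Notation mu := (@lebesgue_measure R).

(* f' is a (locally integrable) derivative of f in the sense of H^1_loc:
   f is the absolutely continuous function with f y - f x = int_x^y f'. *)
Definition is_prim (f f' : R -> R) : Prop :=
  forall x y : R, x <= y ->
    mu.-integrable `[x, y] (EFin \o f') /\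
    f y - f x = Rintegral mu `[x, y] f'.

Definition L2 (f : R -> R) : Prop :=
  measurable_fun setT f /\ (\int[mu]_x ((f x) ^+ 2)%:E < +oo)%E.

Definition X1 (a b a' b' : R -> R) : Prop :=
  is_prim a a' /\ is_prim b b' /\
  (exists M : R, forall x, a x ^+ 2 + b x ^+ 2 <= M) /\
  L2 a' /\ L2 b' /\ L2 (fun x => 1 - (a x ^+ 2 + b x ^+ 2)).

Definition energy (a b a' b' : R -> R) : \bar R :=
  ((2^-1)%:E * \int[mu]_x ((a' x ^+ 2 + b' x ^+ 2)%:E)
   + (4^-1)%:E * \int[mu]_x (((1 - (a x ^+ 2 + b x ^+ 2)) ^+ 2)%:E))%E.

(* phi is a representative of arg v(r) - arg v(-r) in R/2piZ, i.e.
   with z := v(r) * conj (v(-r)) (nonzero), e^{i phi} = z / |z|.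
   Here Re z = a r a(-r) + b r b(-r), Im z = b r a(-r) - a r b(-r). *)
Definition arg_diff (a b : R -> R) (r phi : R) : Prop :=
  let re := a r * a (- r) + b r * b (- r) in
  let im := b r * a (- r) - a r * b (- r) in
  let m := Num.sqrt (re ^+ 2 + im ^+ 2) in
  0 < m /\ cos phi * m = re /\ sin phi * m = im.

(* <iv, v'> = Re (i v conj v') = a b' - b a' *)
Definition momentum_density (a b a' b' : R -> R) (x : R) : R :=
  a x * b' x - b x * a' x.

(* [p](v) = c mod pi :  the quantity
     1/2 int_{-r}^{r} <iv,v'> - 1/2 (arg v(r) - arg v(-r))   (in R/piZ)
   converges to c in R/piZ as r -> +oo. *)
Definition momentum_is (a b a' b' : R -> R) (c : R) : Prop :=
  forall eps : R, 0 < eps -> exists R0 : R, forall r phi : R,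
    R0 <= r -> arg_diff a b r phi ->
    exists k : int,
      `| 2^-1 * Rintegral mu `[- r, r] (momentum_density a b a' b')
         - 2^-1 * phi - c - k%:~R * pi | < eps.

Definition Emin_pi2 : \bar R :=
  ereal_inf [set e | exists a b a' b' : R -> R,
    [/\ X1 a b a' b', momentum_is a b a' b' (pi / 2) & e = energy a b a' b']].

Definition tanh (x : R) : R := (expR x - expR (- x)) / (expR x + expR (- x)).

Definition kink (x : R) : R := tanh (x / Num.sqrt 2).
End Defs.

(* Main.v *)
(* Two calibrations of Bogomolny type drive the proof.

   Write [n = |v|^2] and [w = <iv,v'>].  If [n > m^2 > 0] everywhere, then with
   [q = sqrt (n - m^2)] the energy density minus [+-(m / sqrt 2) w (1-n)/n] minus
   [+-(1 / sqrt 2) (Phi o q)'], where [Phi s = s - m atan (s/m) - s^3/3], is a sum of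
   two squares.  Since the momentum of a nowhere vanishing [v] is
   [-1/2 int w (1-n)/n] mod [pi], a momentum close to [pi/2] forces
   [E(v) >= 2 sqrt 2 / 3 + c m^2 - o(1)].  The kink has energy [2 sqrt 2 / 3] and
   momentum [pi/2]; hence [inf |u_n|] tends to 0 along a minimizing sequence.

   Centre [u_n] where [|u_n|] is almost minimal.  The identity
   [1/2|v'|^2 + 1/4(1-n)^2 = 1/2|v' -+ (1-n)/sqrt 2 v/|v||^2 +- (g o |v|)'],
   [g s = (s - s^3/3) / sqrt 2], integrated over both half lines shows that
   [v' -+ (1-n)/sqrt 2 v/|v|] tends to 0 in L^2.  Hence [|v|] almost solves the
   equation of the kink and the phase is almost constant on each half line, while the
   momentum forces the two phases to be opposite.  This gives locally uniform
   convergence, and the convergence of the energies upgrades it to L^2. *)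
Require Import Defs.
From HB Require Import structures.
From mathcomp Require Import all_boot all_order all_algebra.
From mathcomp Require Import all_classical all_reals all_analysis.
From mathcomp Require Import measurable_realfun ring lra.
Import Order.TTheory GRing.Theory Num.Theory.
Import numFieldNormedType.Exports.
Local Open Scope classical_set_scope.
Local Open Scope ring_scope.

Set Implicit Arguments.
Unset Strict Implicit.
Unset Printing Implicit Defensive.

(** Every estimate concerns a single field and carries explicit errors; sequences enter only in the
    theorem, where the one compactness argument extracts a convergent sequence of phases. The
    infimum enters through the upper bound given by the kink. Derivatives are merely locally
    integrable, so the product and chain rules are proved for [is_prim] from a local estimate
    instead of differentiation almost everywhere. Integrals over the line are traded for bounds
    uniform over segments. The first calibration is saturated by the grey solitons i m + k tanh (k x
    / sqrt 2), k^2 = 1 - m^2, whose modulus has minimum m. It needs m > 0, since it uses a phase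
    defined everywhere. The second one takes over once the modulus is nearly zero somewhere. There
    |v| may fail to be differentiable, so it is replaced by [rho = sqrt (n + kp^2)], and the phase
    is used only where the modulus has a positive lower bound. The price is an error of order [kp],
    which is fixed before the energy excess. *)

Notation Int x y f := (Rintegral (@lebesgue_measure _) `[x, y] f).

(** * Integrals over segments *)

Section segment_integrals.
Context {R : realType}.
Notation mu := (@lebesgue_measure R).
Implicit Types (f g : R -> R) (x y z c : R).

(** No order of the bounds is required, the set being empty when they are reversed; the calculus
    lemmas below thus need no case distinction. *)
Definition locint f := forall x y, mu.-integrable `[x, y] (EFin \o f).

Lemma continuous_locint f : continuous f -> locint f.
Proof.
move=> cf x y; apply: continuous_compact_integrable; first exact: segment_compact.
exact: continuous_subspaceT.
Qed.

Lemma locint_cst c : locint (fun=> c).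
Proof. by apply: continuous_locint => x; exact: cvg_cst. Qed.

Lemma locintD f g : locint f -> locint g -> locint (fun t => f t + g t).
Proof.
move=> lf lg x y; have -> : EFin \o (fun t => f t + g t) = ((EFin \o f) \+ (EFin \o g))%E.
  by apply/funext => t; rewrite /= EFinD.
exact: integrableD.
Qed.

Lemma locintZ c f : locint f -> locint (fun t => c * f t).
Proof.
move=> lf x y; have -> : EFin \o (fun t => c * f t) = (fun t => c%:E * (EFin \o f) t)%E.
  by apply/funext => t; rewrite /= EFinM.
exact: integrableZl.
Qed.

Lemma locintN f : locint f -> locint (fun t => - f t).
Proof.
move=> lf; have -> : (fun t => - f t) = (fun t => -1 * f t).
  by apply/funext => t; rewrite mulN1r.
exact: locintZ.
Qed.

Lemma locintB f g : locint f -> locint g -> locint (fun t => f t - g t).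
Proof. by move=> lf lg; apply: locintD => //; exact: locintN. Qed.

Lemma locintM f g : continuous f -> locint g -> locint (fun t => f t * g t).
Proof.
move=> cf lg x y.
have -> : EFin \o (fun t => f t * g t) = ((EFin \o f) \* (EFin \o g))%E.
  by apply/funext => t; rewrite /= EFinM.
apply: integrableMr => //.
  by apply: subspace_continuous_measurable_fun => //; exact: continuous_subspaceT.
have cK : compact (f @` `[x, y]).
  apply: continuous_compact; last exact: segment_compact.
  exact: continuous_subspaceT.
have [M [Mr mrt]] := compact_bounded cK.
by exists M; split => // e Me t xy; apply: mrt => //; exists t.
Qed.

Lemma locint_norm f : locint f -> locint (fun t => `|f t|).
Proof. by move=> lf x y; exact: integrable_norm. Qed.

Lemma IntD x y f g : locint f -> locint g ->
  Int x y (fun t => f t + g t) = Int x y f + Int x y g.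
Proof. by move=> lf lg; exact: RintegralD. Qed.

Lemma IntZ x y c f : locint f -> Int x y (fun t => c * f t) = c * Int x y f.
Proof. by move=> lf; exact: RintegralZl. Qed.

Lemma IntB x y f g : locint f -> locint g ->
  Int x y (fun t => f t - g t) = Int x y f - Int x y g.
Proof. by move=> lf lg; exact: RintegralB. Qed.

Lemma Int_le x y f g : locint f -> locint g ->
  (forall t, x <= t <= y -> f t <= g t) -> Int x y f <= Int x y g.
Proof.
move=> lf lg fg; apply: le_Rintegral => // t /=; rewrite in_itv/=; exact: fg.
Qed.

Lemma Int_eq x y f g : (forall t, x <= t <= y -> f t = g t) -> Int x y f = Int x y g.
Proof. by move=> fg; apply: eq_Rintegral => t; rewrite inE/= in_itv/=; exact: fg. Qed.

Lemma Int_ge0 x y f : (forall t, x <= t <= y -> 0 <= f t) -> 0 <= Int x y f.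
Proof. by move=> f0; apply: Rintegral_ge0 => t /=; rewrite in_itv/=; exact: f0. Qed.

Lemma Int_cst x y c : x <= y -> Int x y (fun=> c) = c * (y - x).
Proof.
move=> xy; rewrite Rintegral_cst//= lebesgue_measure_itv/= lte_fin.
by case: ltgtP xy => //= -> _; rewrite subrr.
Qed.

Lemma Int_xx x f : Int x x f = 0.
Proof. by rewrite set_itv1 Rintegral_set1. Qed.

Lemma Int_gt x y f : y < x -> Int x y f = 0.
Proof. by move=> yx; rewrite set_itv_ge ?Rintegral_set0// bnd_simp -ltNge. Qed.

Lemma Int_cat x y z f : locint f -> x <= y -> y <= z ->
  Int x z f = Int x y f + Int y z f.
Proof.
move=> lf xy yz; have := @Rintegral_itvB R f (BLeft x) (BRight z) y (lf _ _).
rewrite !bnd_simp => /(_ xy yz) E.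
rewrite Rintegral_itv_obnd_cbnd in E; first by rewrite -E addrC subrK.
by apply: integrableS (lf y z) => //; apply: subset_itv => //; rewrite bnd_simp.
Qed.

Lemma Int_norm x y f : locint f -> `|Int x y f| <= Int x y (fun t => `|f t|).
Proof. by move=> lf; exact: le_normr_Rintegral. Qed.

Lemma Int_norm_le x y f g : locint f -> locint g ->
  (forall t, x <= t <= y -> `|f t| <= g t) -> `|Int x y f| <= Int x y g.
Proof.
move=> lf lg fg; apply: (le_trans (Int_norm _ _ lf)); apply: Int_le => //.
exact: locint_norm.
Qed.

Lemma Int_sub x y s t f : locint f -> (forall r, 0 <= f r) ->
  s <= x -> x <= y -> y <= t -> Int x y f <= Int s t f.
Proof.
move=> lf f0 sx xy yt.
rewrite (Int_cat lf sx (le_trans xy yt)) (Int_cat lf xy yt).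
have A : 0 <= Int s x f by apply: Int_ge0.
have B : 0 <= Int y t f by apply: Int_ge0.
by lra.
Qed.

End segment_integrals.

(** * Absolutely continuous functions: product and chain rules *)

Section primitives.
Context {R : realType}.
Notation mu := (@lebesgue_measure R).
Implicit Types (f g : R -> R) (x y z c : R).

Lemma prim_locint f f' : is_prim f f' -> locint f'.
Proof.
move=> ff x y; have [xy|yx] := leP x y; first by have [] := ff x y xy.
by rewrite set_itv_ge ?bnd_simp -?ltNge//; exact: integrable_set0.
Qed.

Lemma primP f f' : locint f' ->
  (forall x y, x <= y -> f y - f x = Int x y f') -> is_prim f f'.
Proof. by move=> lf H x y xy; split => //; exact: H. Qed.

Lemma primE f f' x y : is_prim f f' -> x <= y -> Int x y f' = f y - f x.
Proof. by move=> ff xy; have [_ ->] := ff x y xy. Qed.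

Lemma prim_continuous f f' : is_prim f f' -> continuous f.
Proof.
move=> ff z.
have zz : z - 1 < z + 1 by lra.
have := @parameterized_integral_continuous R (z - 1) (z + 1) f' (ltW zz) (prim_locint ff _ _).
move=> /(continuous_within_itvP _ zz)[/(_ z)].
rewrite in_itv/= => /(_ _)/cvgrPdist_lt => H _ _.
apply/cvgrPdist_lt => e e0; have /H : z - 1 < z < z + 1 by lra.
move=> /(_ e e0) Hn; near=> t.
have zt : z - 1 < t by near: t; apply: lt_nbhsr; lra.
have -> : f z - f t = Int (z - 1) z f' - Int (z - 1) t f'.
  by rewrite !(primE ff) ?(ltW zt)//; lra.
by near: t; exact: Hn.
Unshelve. all: by end_near. Qed.

Lemma continuous_ex f z e : {for z, continuous f} -> 0 < e ->
  exists2 d, 0 < d & forall t, `|t - z| < d -> `|f t - f z| < e.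
Proof.
move=> /cvgrPdist_lt /(_ _) H e0; have [d d0 D] := H _ e0.
by exists d => // t td; rewrite distrC; apply: D; rewrite /= distrC.
Qed.

(* Continuous induction along the segment turns the local bound into a global one. *)
Lemma interval_additive_le (D W : R -> R -> R) x y : x <= y ->
  (forall s t r, s <= t -> t <= r -> D s r = D s t + D t r) ->
  (forall s t r, s <= t -> t <= r -> W s r = W s t + W t r) ->
  (forall z, x <= z <= y -> exists2 d, 0 < d & forall s t, z - d < s -> s <= z ->
    z <= t -> t < z + d -> `|D s t| <= W s t) ->
  `|D x y| <= W x y.
Proof.
move=> xy addD addW loc.
pose S := [set t | x <= t <= y /\ `|D x t| <= W x t].
have step s t : x <= s -> s <= t -> `|D x s| <= W x s -> `|D s t| <= W s t ->
    `|D x t| <= W x t.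
  move=> xs st A B; rewrite (addD x s t)// (addW x s t)//.
  by apply: le_trans (ler_normD _ _) _; exact: lerD.
have Sx : S x.
  split; first lra.
  have [|d d0 H] := loc x; first by lra.
  by apply: H; lra.
have hS : has_sup S by split; [exists x|exists y => t [/andP[]]].
pose z := sup S.
have xz : x <= z by apply: ub_le_sup => //; case: hS.
have zy : z <= y by apply: ge_sup; [exists x|move=> t [/andP[]]].
have [|d d0 H] := loc z; first by lra.
have [s Ss zs] := sup_adherent d0 hS.
have sz : s <= z by apply: ub_le_sup => //; case: hS.
have [/andP[xs sy] Ds] := Ss.
pose t := Num.min y (z + d / 2).
have tE : t = y \/ (t = z + d/2) by rewrite /t minElt; case: ifP; [left|right].
have ty : t <= y by rewrite /t ge_min lexx.
have zt : z <= t by rewrite /t le_min zy/=; lra.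
have td : t < z + d by case: tE => [E|->]; [rewrite /t gt_min; apply/orP; right; lra|lra].
have St : S t.
  split; first lra.
  by apply: (step s) => //; [lra|apply: H].
have tz : t <= z by apply: ub_le_sup => //; case: hS.
case: tE => E; last by move: tz d0; rewrite E; lra.
by case: St; rewrite E.
Qed.

(** Stands in for differentiation almost everywhere: near each point the increment of [f] need only
    match the integral of [f'] up to [e] times the integral of a fixed weight [W]. Error and weight
    are additive over adjacent segments, so the local bound spreads to [[x, y]]; then [e] tends to
    0. *)
Lemma prim_local f f' (W : R -> R) : locint f' -> locint W ->
  (forall z e, 0 < e -> exists2 d, 0 < d & forall s t, z - d < s -> s <= z ->
    z <= t -> t < z + d -> `|f t - f s - Int s t f'| <= e * Int s t W) ->
  is_prim f f'.
Proof.
move=> lf lW loc; apply: primP => // x y xy; apply/eqP; rewrite -subr_eq0 -normr_le0.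
have key e : 0 < e -> `|f y - f x - Int x y f'| <= e * Int x y W.
  move=> e0; apply: (@interval_additive_le (fun s t => f t - f s - Int s t f')
    (fun s t => e * Int s t W) x y xy).
  - by move=> s t r st tr; rewrite (Int_cat lf st tr); ring.
  - by move=> s t r st tr; rewrite (Int_cat lW st tr); ring.
  - by move=> z _; exact: loc.
apply/ler_addgt0Pl => e e0; rewrite addr0.
have n0 : 0 < `|Int x y W| + 1 by rewrite ltr_wpDl.
apply: (le_trans (key (e / (`|Int x y W| + 1)) _)); first by rewrite divr_gt0.
rewrite -mulrA ler_piMr ?(ltW e0)// mulrC ler_pdivrMr// mul1r.
by apply: (le_trans (ler_norm _)); rewrite lerDl.
Qed.

Lemma primD f f' g g' : is_prim f f' -> is_prim g g' ->
  is_prim (fun t => f t + g t) (fun t => f' t + g' t).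
Proof.
move=> pf pg; have [lf lg] := (prim_locint pf, prim_locint pg).
apply: primP; first exact: locintD.
by move=> x y xy; rewrite IntD// !(primE pf)// !(primE pg)//; ring.
Qed.

Lemma primZ c f f' : is_prim f f' -> is_prim (fun t => c * f t) (fun t => c * f' t).
Proof.
move=> pf; have lf := prim_locint pf.
apply: primP; first exact: locintZ.
by move=> x y xy; rewrite IntZ// (primE pf)//; ring.
Qed.

Lemma prim_cst c : is_prim (fun=> c : R) (fun=> 0).
Proof.
apply: primP => [|x y xy]; first exact: locint_cst.
by rewrite Int_cst// mul0r subrr.
Qed.

Lemma prim_eq f f' h h' : is_prim f f' -> f =1 h -> f' =1 h' -> is_prim h h'.
Proof. by move=> pf /funext <- /funext <-. Qed.

Lemma primM f f' g g' : is_prim f f' -> is_prim g g' ->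
  is_prim (fun t => f t * g t) (fun t => g t * f' t + f t * g' t).
Proof.
move=> pf pg; have [lf lg] := (prim_locint pf, prim_locint pg).
have [cf cg] := (prim_continuous pf, prim_continuous pg).
have lh : locint (fun t => g t * f' t + f t * g' t) by apply: locintD; exact: locintM.
apply: (@prim_local _ _ (fun t => `|f' t| + `|g' t|)) => //.
  by apply: locintD; exact: locint_norm.
move=> z e e0; have e2 : 0 < e / 2 by lra.
have [d1 d10 H1] := continuous_ex (cf z) e2.
have [d2 d20 H2] := continuous_ex (cg z) e2.
exists (Num.min d1 d2); first by rewrite lt_min d10.
move=> s t zs sz zt tz.
have st : s <= t by lra.
have bnd r : s <= r <= t -> `|r - z| < d1 /\ `|r - z| < d2.
  move=> rst; apply/andP; rewrite -lt_min ltr_norml; lra.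
(* Each factor is frozen at one endpoint, [f t g t - f s g s = g t (f t - f s) + f s (g t - g s)],
   so that only the oscillation of [f] and [g] near [z] remains. *)
have -> : f t * g t - f s * g s - Int s t (fun r => g r * f' r + f r * g' r) =
  Int s t (fun r => (g t * f' r + f s * g' r) - (g r * f' r + f r * g' r)).
  rewrite IntB//; last by apply: locintD; exact: locintZ.
  have -> : Int s t (fun r => g t * f' r + f s * g' r) =
      Int s t (fun r => g t * f' r) + Int s t (fun r => f s * g' r).
    by apply: IntD; exact: locintZ.
  by rewrite !IntZ// !(primE pf)// !(primE pg)//; ring.
have lW : locint (fun r => `|f' r| + `|g' r|) by apply: locintD; exact: locint_norm.
rewrite -IntZ//; apply: Int_norm_le.
- by apply: locintB => //; apply: locintD; exact: locintZ.
- by apply: locintZ; apply: locintD; exact: locint_norm.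
move=> r rst.
have -> : g t * f' r + f s * g' r - (g r * f' r + f r * g' r) =
  (g t - g r) * f' r + (f s - f r) * g' r by ring.
rewrite mulrDr; apply: (le_trans (ler_normD _ _)); rewrite !normrM.
have tst : s <= t <= t by lra.
have sst : s <= s <= t by lra.
have [A1 A2] := bnd r rst; have [B1 B2] := bnd t tst; have [C1 C2] := bnd s sst.
apply: lerD; apply: ler_wpM2r => //.
  have := H2 _ A2; have := H2 _ B2; rewrite !ltr_norml => K1 K2.
  by rewrite ler_norml; lra.
have := H1 _ A1; have := H1 _ C1; rewrite !ltr_norml => K1 K2.
by rewrite ler_norml; lra.
Qed.

Lemma is_derive1_continuous F (dF t : R) : is_derive t 1 F dF -> {for t, continuous (F : R -> R)}.
Proof. by move=> [dFt _]; apply: differentiable_continuous; exact/derivable1_diffP. Qed.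

(** By the mean value theorem the increment is [F' c] times that of [f], and [F'] oscillates little
    near [f z]. Differentiability of [F] is asked only near the values of [f], which admits the
    square root of a positive function. *)
Lemma prim_comp F F' f f' : is_prim f f' ->
  (forall z, \forall t \near f z, is_derive (t : R) 1 (F : R -> R) (F' t)) ->
  (forall z, {for f z, continuous F'}) ->
  is_prim (fun t => F (f t)) (fun t => F' (f t) * f' t).
Proof.
move=> pf dF cF; have lf := prim_locint pf; have cf := prim_continuous pf.
have cFf : continuous (fun t => F' (f t)).
  by move=> z; apply: continuous_comp; [exact: cf|exact: cF].
have lh : locint (fun t => F' (f t) * f' t) by exact: locintM.
apply: (@prim_local _ _ (fun t => `|f' t|)) => //; first exact: locint_norm.
move=> z e e0; have e2 : 0 < e / 2 by lra.
have [d1 d10 H1] := continuous_ex (cF z) e2.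
have [d2 /= d20 H2] := dF z.
have d3 : 0 < Num.min d1 d2 by rewrite lt_min d10.
have [d d0 H] := continuous_ex (cf z) d3.
exists d => // s t zs sz zt tz.
have st : s <= t by lra.
have bnd r : s <= r <= t -> `|f r - f z| < Num.min d1 d2.
  by move=> rst; apply: H; rewrite ltr_norml; lra.
have [c cc cE] : exists2 c, `|c - f z| < d1 & F (f t) - F (f s) = F' c * (f t - f s).
  have mvt u v : u <= v -> `|u - f z| < Num.min d1 d2 -> `|v - f z| < Num.min d1 d2 ->
      exists2 c, `|c - f z| < d1 & F v - F u = F' c * (v - u).
    move=> uv; rewrite !lt_min => /andP[u1 u2] /andP[v1 v2].
    have ders r : u <= r <= v -> is_derive r 1 F (F' r).
      move=> ruv; apply: H2 => /=; move: u2 v2; rewrite !ltr_norml; lra.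
    have [||c] := @MVT_segment R F F' u v uv.
    - by move=> r; rewrite in_itv/= => ?; apply: ders; lra.
    - apply: continuous_in_subspaceT => r; rewrite inE/= in_itv/= => ?.
      by apply: is_derive1_continuous; apply: ders.
    rewrite in_itv/= => cuv E; exists c => //.
    by move: u1 v1; rewrite !ltr_norml; lra.
  have [/mvt|/ltW/mvt] := leP (f s) (f t).
    by apply; apply: bnd; lra.
  move=> /(_ _ _)[]; try (by apply: bnd; lra).
  move=> c c1 cE; exists c => //.
  by rewrite -[LHS]opprB cE; ring.
have -> : F (f t) - F (f s) - Int s t (fun r => F' (f r) * f' r) =
  Int s t (fun r => F' c * f' r - F' (f r) * f' r).
  by rewrite IntB// ?IntZ// ?(primE pf)// ?cE//; exact: locintZ.
rewrite -IntZ; last exact: locint_norm.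
apply: Int_norm_le.
- by apply: locintB => //; exact: locintZ.
- by apply: locintZ; exact: locint_norm.
move=> r rst; rewrite -mulrBl normrM; apply: ler_wpM2r => //.
have := H1 _ cc; have := bnd r rst; rewrite lt_min => /andP[/H1 K1 _] K2.
by move: K1 K2; rewrite !ltr_norml ler_norml; lra.
Qed.

Lemma prim_derive F F' : (forall t : R, is_derive t 1 (F : R -> R) (F' t)) ->
  continuous F' -> is_prim F F'.
Proof.
move=> dF cF.
have pid : is_prim (fun t : R => t) (fun=> 1).
  apply: primP => [|x y xy]; first exact: locint_cst.
  by rewrite Int_cst// mul1r.
apply: (prim_eq (prim_comp (F := F) (F' := F') pid _ _)) => //.
  by move=> z; near=> t; exact: dF.
by move=> t; rewrite mulr1.
Unshelve. all: by end_near. Qed.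

(** [Int] vanishes on reversed bounds instead of changing sign; the difference is the oriented
    integral from [x0] to [t]. *)
Lemma prim_int f x0 : locint f -> is_prim (fun t => Int x0 t f - Int t x0 f) f.
Proof.
move=> lf; apply: primP => // x y xy.
have [xx|xx] := ltP x x0; have [yy|yy] := ltP y x0.
- by rewrite !(@Int_gt _ x0)// (Int_cat lf xy (ltW yy)); ring.
- rewrite (@Int_gt _ x0 x)// (Int_cat lf (ltW xx) yy).
  have -> : Int y x0 f = 0.
    by move: yy; rewrite le_eqVlt => /orP[/eqP ->|/Int_gt//]; exact: Int_xx.
  by ring.
- by lra.
- have E u : x0 <= u -> Int u x0 f = 0.
    by rewrite le_eqVlt => /orP[/eqP ->|/Int_gt//]; exact: Int_xx.
  by rewrite !E// (Int_cat lf xx xy); ring.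
Qed.

End primitives.

(** * Continuity of algebraic expressions *)

Section continuity.
Context {R : realType}.
Implicit Types (f g : R -> R).

Lemma cts_cst (c : R) : continuous (fun _ : R => c).
Proof. by move=> x; exact: cvg_cst. Qed.

Lemma cts_id : continuous (fun t : R => t).
Proof. by move=> x; exact: cvg_id. Qed.

Lemma ctsD f g : continuous f -> continuous g -> continuous (fun t => f t + g t).
Proof. by move=> cf cg x; apply: cvgD; [exact: cf|exact: cg]. Qed.

Lemma ctsN f : continuous f -> continuous (fun t => - f t).
Proof. by move=> cf x; apply: cvgN; exact: cf. Qed.

Lemma ctsM f g : continuous f -> continuous g -> continuous (fun t => f t * g t).
Proof. by move=> cf cg x; apply: cvgM; [exact: cf|exact: cg]. Qed.

Lemma ctsX f n : continuous f -> continuous (fun t => f t ^+ n).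
Proof.
move=> cf; elim: n => [|n IH]; first exact: cts_cst.
by under eq_fun do rewrite exprS; exact: ctsM.
Qed.

Lemma cts_comp f g : continuous g -> continuous f -> continuous (fun t => g (f t)).
Proof. by move=> cg cf x; apply: continuous_comp; [exact: cf|exact: cg]. Qed.

Lemma cts_sqrt f : continuous f -> continuous (fun t => Num.sqrt (f t)).
Proof. by apply: cts_comp; exact: sqrt_continuous. Qed.

Lemma ctsV f : (forall t, f t != 0) -> continuous f -> continuous (fun t => (f t)^-1).
Proof. by move=> f0 cf x; apply: cvgV => //; exact: cf. Qed.

Lemma cts_max f c : continuous f -> continuous (fun t => Num.max c (f t)).
Proof.
move=> cf; have -> : (fun t => Num.max c (f t)) = (fun t => (c + f t + `|c - f t|) / 2).
  by apply/funext => t; rewrite maxr_absE.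
apply: ctsM; last exact: cts_cst.
apply: ctsD; first by apply: ctsD => //; exact: cts_cst.
apply: (@cts_comp (fun t => c - f t) (fun t => `|t|)); first exact: norm_continuous.
by apply: ctsD; [exact: cts_cst|exact: ctsN].
Qed.

End continuity.

Ltac cts := repeat lazymatch goal with
  | |- continuous (fun t => @?f t + @?g t) => apply: (@ctsD _ f g)
  | |- continuous (fun t => - @?f t) => apply: (@ctsN _ f)
  | |- continuous (fun t => @?f t * @?g t) => apply: (@ctsM _ f g)
  | |- continuous (fun t => @?f t ^+ _) => apply: (@ctsX _ f)
  | |- continuous (fun t => Num.sqrt (@?f t)) => apply: (@cts_sqrt _ f)
  | |- _ => first [assumption | exact: cts_cst | exact: cts_id |
      exact: continuous_sin | exact: continuous_cos]
  end.

(** * Trigonometric facts *)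

Section trigonometry.
Context {R : realType}.
Implicit Types (x y c s : R).

Lemma cos_lipschitz x y : `|cos x - cos y| <= `|x - y|.
Proof.
wlog xy : x y / x <= y.
  move=> H; have [/H//|/ltW/H] := leP x y.
  by rewrite distrC (distrC y).
have [|c _] := @MVT_segment R cos (fun t => - sin t) x y xy.
  by apply: continuous_subspaceT; exact: continuous_cos.
rewrite distrC (distrC x) => ->; rewrite normrM normrN ler_piMl//; exact: sin_max.
Qed.

Lemma sin_lipschitz x y : `|sin x - sin y| <= `|x - y|.
Proof.
by rewrite -!cosBpihalf; apply: (le_trans (cos_lipschitz _ _)); rewrite opprB addrA subrK.
Qed.

(** The bound on [t] is what later allows a convergent subsequence of phases to be extracted. *)
Lemma cos_sin_surj c s : c ^+ 2 + s ^+ 2 = 1 ->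
  exists2 t : R, `|t| <= pi & cos t = c /\ sin t = s.
Proof.
move=> cs.
have cb : -1 <= c <= 1 by have := sqr_ge0 s; nra.
have ss : Num.sqrt (1 - c ^+ 2) = `|s| by rewrite -sqrtr_sqr; congr Num.sqrt; lra.
have cK : cos (acos c) = c by apply: acosK; rewrite in_itv.
have [p0 pp] := (acos_ge0 cb, acos_lepi cb).
have [s0|s0] := leP 0 s.
  exists (acos c); first by rewrite ger0_norm.
  by rewrite sin_acos// ss ger0_norm.
exists (- acos c); first by rewrite normrN ger0_norm.
by rewrite cosN sinN sin_acos// ss ltr0_norm// opprK.
Qed.

Lemma cosD2kpi x (k : int) : cos (x + 2 * (k%:~R * pi)) = cos x.
Proof.
have P n y : cos (y + 2 * (n%:R * pi)) = cos y.
  have -> : 2 * (n%:R * pi) = pi *+ 2 *+ n :> R by rewrite -[RHS]mulr_natr -[pi *+ 2]mulr_natr; ring.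
  exact: (periodicn (@cosD2pi R)).
case: k => n; first exact: P.
by rewrite NegzE mulrNz -[LHS](P n.+1); congr cos; rewrite pmulrn; ring.
Qed.

Lemma cos_eqN1 x : cos x = -1 -> exists k : int, x = pi + 2 * (k%:~R * pi).
Proof.
move=> cx.
pose k := Num.floor (x / (2 * pi)).
have pi0 := pi_gt0 R.
pose y := x - 2 * (k%:~R * pi).
have yE : cos y = -1.
  by rewrite -cx /y -(cosD2kpi (x - _) k) subrK.
have /andP[k1 k2] : k%:~R <= x / (2 * pi) < k%:~R + 1.
  by rewrite Num.Theory.floor_le// -intrD1 Num.Theory.lt_succ_floor.
have p2 : 0 < 2 * pi :> R by lra.
rewrite ler_pdivlMr// in k1; rewrite ltr_pdivrMr// in k2.
have y0 : 0 <= y by rewrite /y; lra.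
have y2 : y <= 2 * pi by rewrite /y; lra.
exists k; suff : y = pi by rewrite /y; lra.
have [yp|yp] := leP y pi.
  by apply: cos_inj; rewrite ?in_itv/= ?yE ?cospi//; lra.
suff : 2 * pi - y = pi by lra.
apply: cos_inj; rewrite ?in_itv/= ?cospi; try lra.
by rewrite -yE -(cosN y); have := cosD2kpi (- y) 1; rewrite mul1r addrC.
Qed.

End trigonometry.

(** * Lifting of the phase *)

Section lifting.
Context {R : realType}.
Variables (a b a' b' : R -> R).
Hypotheses (pa : is_prim a a') (pb : is_prim b b').

(** [v(y) conj(v(x)) = m exp(i phi)]: the relation [arg_diff] for two arbitrary points, with the
    positive factor left abstract. Unlike [arg_diff] it is compatible with translations. *)
Definition arg_rel x y phi := exists2 m : R, 0 < m &
  a y * a x + b y * b x = m * cos phi /\ b y * a x - a y * b x = m * sin phi.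

(* With [th' = <iv,v'>/|v|^2] and [l' = <v,v'>/|v|^2] the function
   [v exp (- l - i th)] is constant; the truncation by [eta] only serves to
   define [th] and [l] on the whole line. *)
Lemma polar_lift eta x y : 0 < eta -> x <= y ->
  (forall t, x <= t <= y -> eta <= a t ^+ 2 + b t ^+ 2) ->
  exists2 m : R, 0 < m &
    let th := Int x y (fun t => momentum_density a b a' b' t / (a t ^+ 2 + b t ^+ 2)) in
    a y = m * (cos th * a x - sin th * b x) /\ b y = m * (sin th * a x + cos th * b x).
Proof.
move=> eta0 xy en.
have [ca cb] := (prim_continuous pa, prim_continuous pb).
have [la lb] := (prim_locint pa, prim_locint pb).
pose G t := (Num.max eta (a t ^+ 2 + b t ^+ 2))^-1.
have cG : continuous G.
  by apply: ctsV => [t|]; [rewrite gt_eqF// lt_max eta0|apply: cts_max; cts].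
have GE t : x <= t <= y -> G t = (a t ^+ 2 + b t ^+ 2)^-1.
  by move=> /en E; rewrite /G max_r.
pose th' t := G t * (a t * b' t - b t * a' t).
pose l' t := - (G t * (a t * a' t + b t * b' t)).
have lth : locint th' by apply: locintM => //; apply: locintB; exact: locintM.
have ll : locint l' by apply/locintN/locintM => //; apply: locintD; exact: locintM.
have pth := prim_int x lth; have pl := prim_int x ll.
set th := (fun t => _) in pth; set l := (fun t => _) in pl.
have thx : th x = 0 by rewrite /th !Int_xx subrr.
have lx : l x = 0 by rewrite /l !Int_xx subrr.
have pc : is_prim (fun t => cos (th t)) (fun t => - sin (th t) * th' t).
  apply: (prim_comp (F := cos) (F' := fun t => - sin t)) => // z.
    by near=> t; exact: is_derive_cos.
  exact: (ctsN (@continuous_sin R)).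
have ps : is_prim (fun t => sin (th t)) (fun t => cos (th t) * th' t).
  apply: (prim_comp (F := sin) (F' := cos)) => // z.
    by near=> t; exact: is_derive_sin.
  exact: continuous_cos.
have pe : is_prim (fun t => expR (l t)) (fun t => expR (l t) * l' t).
  apply: (prim_comp (F := expR) (F' := expR)) => // z.
    by near=> t; exact: is_derive_expR.
  exact: continuous_expR.
have n0 t : x <= t <= y -> a t ^+ 2 + b t ^+ 2 != 0.
  by move=> /en; move: eta0; lra.
have A : (a y * cos (th y) + b y * sin (th y)) * expR (l y) = a x.
  have := primE (primM (primD (primM pa pc) (primM pb ps)) pe) xy.
  rewrite thx lx cos0 sin0 expR0 (@Int_eq _ _ _ _ (fun=> 0)).
    by rewrite Int_cst// mul0r; lra.
  move=> t txy; have := n0 t txy; rewrite /th' /l' GE//.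
  move: (a t) (b t) (a' t) (b' t) (th t) (l t) => ? ? ? ? ? ? ?; by field.
have B : (b y * cos (th y) - a y * sin (th y)) * expR (l y) = b x.
  have := primE (primM (primD (primM pb pc) (primZ (-1) (primM pa ps))) pe) xy.
  rewrite thx lx cos0 sin0 expR0 (@Int_eq _ _ _ _ (fun=> 0)).
    by rewrite Int_cst// mul0r; lra.
  move=> t txy; have := n0 t txy; rewrite /th' /l' GE//.
  move: (a t) (b t) (a' t) (b' t) (th t) (l t) => ? ? ? ? ? ? ?; by field.
have thE : Int x y (fun t => momentum_density a b a' b' t / (a t ^+ 2 + b t ^+ 2)) = th y.
  have E : Int y x th' = 0.
    by move: (xy); rewrite le_eqVlt => /orP[/eqP ->|/Int_gt//]; exact: Int_xx.
  rewrite /th E subr0; apply: Int_eq => t /GE tE.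
  by rewrite /th' tE mulrC.
rewrite thE; exists (expR (- l y)); first exact: expR_gt0.
have eE : expR (l y) * expR (- l y) = 1 by rewrite -expRD subrr expR0.
have cs := cos2Dsin2 (th y).
rewrite /= -A -B; split.
  transitivity ((expR (l y) * expR (- l y)) * (cos (th y) ^+ 2 + sin (th y) ^+ 2) * a y).
    by rewrite eE cs !mul1r.
  by ring.
transitivity ((expR (l y) * expR (- l y)) * (cos (th y) ^+ 2 + sin (th y) ^+ 2) * b y).
  by rewrite eE cs !mul1r.
by ring.
Unshelve. all: by end_near. Qed.

Lemma arg_rel_arg_diff r phi : arg_rel (- r) r phi -> arg_diff a b r phi.
Proof.
move=> [m m0 [E1 E2]]; rewrite /arg_diff E1 E2.
have -> : (m * cos phi) ^+ 2 + (m * sin phi) ^+ 2 = m ^+ 2.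
  by rewrite !exprMn -mulrDr cos2Dsin2 mulr1.
by rewrite sqrtr_sqr gtr0_norm//; split=> //; split; rewrite mulrC.
Qed.

End lifting.

(** * Translations, reflections and the passage to the whole line *)

Section change_of_variables.
Context {R : realType}.
Notation mu := (@lebesgue_measure R).
Implicit Types (f : R -> R) (x y c : R).

Lemma locint_measurable f : locint f -> measurable_fun setT f.
Proof.
move=> lf; have -> : [set: R] = \bigcup_n `[- n%:R, n%:R]%classic.
  apply/esym/seteqP; split => // t _; exists (Num.bound `|t|) => //=.
  by rewrite in_itv/= -ler_norml; apply: ltW; apply: archi_boundP.
apply/measurable_fun_bigcup => // n.
by have /integrableP[/measurable_EFinP] := lf (- n%:R) n%:R.
Qed.

Lemma lebesgue_measureD c (A : set R) : measurable A ->
  pushforward mu ((fun t => t + c) : _ -> measurableTypeR R) A = mu A.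
Proof.
have mc : measurable_fun setT ((fun t : R => t + c) : _ -> measurableTypeR R).
  by apply: measurable_funD.
pose phi : {mfun R >-> measurableTypeR R} :=
  HB.pack ((fun t => t + c) : R -> measurableTypeR R) (isMeasurableFun.Build _ _ _ _ _ mc).
move=> mA; apply/esym; apply: (@lebesgue_measure_unique R (pushforward mu phi)) => //= _ [[u v]] _ <-.
rewrite /pushforward.
have -> : (fun t => t + c) @^-1` [set` `]u, v]] = [set` `]u - c, v - c]].
  by apply/seteqP; split => t /=; rewrite !in_itv/= ltrBlDr lerBrDr.
rewrite !lebesgue_measure_itv/= !lte_fin ltrD2r; case: ifP => // _.
by congr EFin; ring.
Qed.

Section measure_preserving.
Variable phi : R -> R.
Hypothesis mphi : measurable_fun [set: measurableTypeR R]
  (phi : measurableTypeR R -> measurableTypeR R).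
Hypothesis pushE : forall A : set R, measurable A ->
  pushforward mu (phi : _ -> measurableTypeR R) A = mu A.

Lemma integrable_comp x y x' y' f : locint f ->
  phi @^-1` `[x, y] = `[x', y']%classic ->
  mu.-integrable `[x', y'] (EFin \o (fun t => f (phi t))).
Proof.
move=> lf pE; have mf := locint_measurable lf.
apply/integrableP; split.
  apply/measurable_EFinP; apply: measurable_funTS.
  exact: (measurableT_comp mf mphi).
have /integrableP[_] := lf x y; apply: le_lt_trans.
rewrite -pE -(@ge0_integral_pushforward _ _ _ _ R _ mphi mu `[x, y]%classic (fun t => `|(f t)%:E|%E))//; last first.
  by apply: measurable_funTS; apply: measurableT_comp => //; exact/measurable_EFinP.
rewrite le_eqVlt; apply/orP; left; apply/eqP.
by apply: eq_measure_integral => A mA _; exact: pushE.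
Qed.

Lemma Int_comp x y x' y' f : locint f ->
  phi @^-1` `[x, y] = `[x', y']%classic ->
  Int x' y' (fun t => f (phi t)) = Int x y f.
Proof.
move=> lf pE; have mf := locint_measurable lf; congr fine.
have := integrable_comp lf pE; rewrite -pE => ic.
have := @integral_pushforward _ _ _ _ R _ mphi mu `[x, y]%classic (EFin \o f) _ ic.
move=> /(_ _ _)/= <- //; last exact/measurable_EFinP.
by apply: eq_measure_integral => A mA _; exact: pushE.
Qed.

End measure_preserving.

Lemma preimageD c x y : (fun t : R => t + c) @^-1` `[x, y] = `[x - c, y - c]%classic.
Proof. by apply/seteqP; split => t /=; rewrite !in_itv/= lerBlDr lerBrDr. Qed.

Lemma preimageN x y : (fun t : R => - t) @^-1` `[x, y] = `[- y, - x]%classic.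
Proof. by apply/seteqP; split => t /=; rewrite !in_itv/= lerNl andbC lerNr. Qed.

Lemma measurable_translation c : measurable_fun setT ((fun t : R => t + c) : _ -> measurableTypeR R).
Proof. exact: measurable_funD. Qed.

Lemma measurable_reflection : measurable_fun setT ((fun t : R => - t) : _ -> measurableTypeR R).
Proof. exact: measurable_funN. Qed.

Lemma locint_shift c f : locint f -> locint (fun t => f (t + c)).
Proof.
move=> lf x y; apply: (integrable_comp (measurable_translation c) (@lebesgue_measureD c) (x := x + c) (y := y + c)) => //.
by rewrite preimageD !addrK.
Qed.

Lemma Int_shift c x y f : locint f -> Int x y (fun t => f (t + c)) = Int (x + c) (y + c) f.
Proof.
move=> lf; apply: (Int_comp (measurable_translation c) (@lebesgue_measureD c)) => //.
by rewrite preimageD !addrK.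
Qed.

Lemma locint_opp f : locint f -> locint (fun t => f (- t)).
Proof.
move=> lf x y; apply: (integrable_comp measurable_reflection (@lebesgue_measureN R) (x := - y) (y := - x)) => //.
by rewrite preimageN !opprK.
Qed.

Lemma Int_opp x y f : locint f -> Int x y (fun t => f (- t)) = Int (- y) (- x) f.
Proof.
move=> lf; apply: (Int_comp measurable_reflection (@lebesgue_measureN R)) => //.
by rewrite preimageN !opprK.
Qed.

Lemma prim_shift c f f' : is_prim f f' -> is_prim (fun t => f (t + c)) (fun t => f' (t + c)).
Proof.
move=> pf; have lf := prim_locint pf; apply: primP; first exact: locint_shift.
by move=> x y xy; rewrite Int_shift// (primE pf)// lerD2r.
Qed.

Lemma prim_opp f f' : is_prim f f' -> is_prim (fun t => f (- t)) (fun t => - f' (- t)).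
Proof.
move=> pf; have lf := prim_locint pf; have lo := locint_opp lf.
apply: primP; first exact: locintN.
move=> x y xy; have := @IntZ _ x y (-1) _ lo.
under eq_Rintegral do rewrite mulN1r.
by move=> ->; rewrite Int_opp// (primE pf) ?lerN2//; ring.
Qed.

(** Monotone convergence along [[-n, n]]. Together with [segments_le_integral] it exchanges
    integrals over the line, which live in the extended reals, for real bounds uniform over
    segments. *)
Lemma integral_le_segments f (C : R) : locint f -> (forall t, 0 <= f t) ->
  (forall x y, x <= y -> Int x y f <= C) -> (\int[mu]_t (f t)%:E <= C%:E)%E.
Proof.
move=> lf f0 fC.
have TE : [set: R] = \bigcup_n `[- n%:R, n%:R]%classic.
  apply/esym/seteqP; split => // t _; exists (Num.bound `|t|) => //=.
  by rewrite in_itv/= -ler_norml; apply: ltW; apply: archi_boundP.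
have mf := locint_measurable lf.
have := @ge0_nondecreasing_set_cvg_integral _ _ R (fun n => (`[- n%:R, n%:R]%classic : set (measurableTypeR R)))
  (EFin \o f) mu.
rewrite -TE => H; apply: cvge_le (H _ _ _ _) => //.
- near=> n; rewrite -[leLHS]fineK; last exact: integrable_fin_num.
  by rewrite lee_fin; apply: fC; have : 0 <= n%:R :> R by []; lra.
- move=> m n mn; apply/subsetPset/subset_itv; rewrite bnd_simp ?lerN2 ler_nat//.
- by move=> n; apply: measurable_funTS; exact/measurable_EFinP.
- by move=> n t _; rewrite lee_fin.
Unshelve. all: by end_near. Qed.

Lemma segments_le_integral f (C : R) : measurable_fun setT f -> (forall t, 0 <= f t) ->
  (\int[mu]_t (f t)%:E <= C%:E)%E ->
  locint f /\ (forall x y, Int x y f <= C).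
Proof.
move=> mf f0 fC.
have fi : mu.-integrable setT (EFin \o f).
  apply/integrableP; split; first exact/measurable_EFinP.
  under eq_integral do rewrite gee0_abs ?lee_fin//.
  by apply: le_lt_trans fC _; rewrite ltry.
have lf : locint f by move=> x y; apply: integrableS fi.
split=> // x y; rewrite -lee_fin fineK; last exact: integrable_fin_num.
apply: le_trans fC; apply: ge0_subset_integral => //.
  exact/measurable_EFinP.
by move=> t _; rewrite lee_fin.
Qed.

End change_of_variables.

(** * The kink *)

Section kink_facts.
Context {R : realType}.
Implicit Types (x y : R).
Notation kink := (@kink R).

Lemma sqrt2_gt0 : 0 < Num.sqrt 2 :> R.
Proof. by rewrite sqrtr_gt0. Qed.

Lemma sqrt2_sqr : Num.sqrt 2 ^+ 2 = 2 :> R.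
Proof. by rewrite sqr_sqrtr. Qed.

(** The derivative of the kink, in the form given by the first-order equation that the kink
    solves. *)
Definition kink' x : R := (1 - kink x ^+ 2) / Num.sqrt 2.

Lemma is_derive_kink x : is_derive x 1 kink (kink' x).
Proof.
have s0 := sqrt2_gt0.
have dE : is_derive x (1 : R) (fun t : R => expR (t / Num.sqrt 2)) (expR (x / Num.sqrt 2) / Num.sqrt 2).
  by apply: is_derive_eq; rewrite !scaler0 add0r /GRing.scale/= mulr1.
have dF : is_derive x (1 : R) (fun t : R => expR (- (t / Num.sqrt 2)))
    (- expR (- (x / Num.sqrt 2)) / Num.sqrt 2).
  by apply: is_derive_eq; rewrite !scaler0 add0r /GRing.scale/= mulr1 mulrN mulNr.
have e1 := expR_gt0 (x / Num.sqrt 2); have e2 := expR_gt0 (- (x / Num.sqrt 2)).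
have nz : expR (x / Num.sqrt 2) + expR (- (x / Num.sqrt 2)) != 0 by rewrite gt_eqF//; lra.
have dS := is_deriveD dE dF.
have dV := @is_deriveV R (fun t => expR (t / Num.sqrt 2) + expR (- (t / Num.sqrt 2))) x _ 1 nz dS.
have := is_deriveM (is_deriveB dE dF) dV.
move/is_derive_eq; apply.
rewrite !fctE /kink' /kink /tanh /GRing.scale/=.
move: nz; move: (expR _) (expR _) e1 e2 => E F E0 F0 nz.
by field; rewrite nz gt_eqF.
Qed.

Lemma kinkN x : kink (- x) = - kink x.
Proof. by rewrite /kink /tanh mulNr opprK -[RHS]mulNr opprB [in X in _ / X]addrC. Qed.

Lemma kink0 : kink 0 = 0.
Proof. by rewrite /kink /tanh mul0r oppr0 subrr mul0r. Qed.

Lemma kink_bound x : -1 < kink x < 1.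
Proof.
have e1 := expR_gt0 (x / Num.sqrt 2); have e2 := expR_gt0 (- (x / Num.sqrt 2)).
rewrite /kink /tanh ltr_pdivlMr ?ltr_pdivrMr; lra.
Qed.

Lemma kink_norm_le1 x : `|kink x| <= 1.
Proof. by rewrite ler_norml; have := kink_bound x; lra. Qed.

Lemma kink'_gt0 x : 0 < kink' x.
Proof. by apply: divr_gt0; [have := kink_bound x; nra|exact: sqrt2_gt0]. Qed.

Lemma kink'_le1 x : kink' x <= 1.
Proof.
have := sqrt2_gt0; have := sqrt2_sqr; have := kink_bound x => kb s2 s0.
by rewrite ler_pdivrMr// mul1r; nra.
Qed.

Lemma continuous_kink : continuous kink.
Proof. by move=> x; have := is_derive1_continuous (is_derive_kink x). Qed.

Lemma continuous_kink' : continuous kink'.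
Proof. by have := continuous_kink => ck; rewrite /kink'; cts. Qed.

Lemma prim_kink : is_prim kink kink'.
Proof. by apply: prim_derive; [exact: is_derive_kink|exact: continuous_kink']. Qed.

Lemma derive1_kink x : derive1 kink x = kink' x.
Proof. by rewrite derive1E; have [_ ->] := is_derive_kink x. Qed.

Lemma prim_kink' : is_prim kink' (fun t => - (Num.sqrt 2 * kink t * kink' t)).
Proof.
have s0 := sqrt2_gt0.
have := primZ (- (Num.sqrt 2)^-1) (primM prim_kink prim_kink).
move=> /(primD (prim_cst (Num.sqrt 2)^-1)) /prim_eq; apply.
  by move=> t; rewrite /kink'; field; rewrite gt_eqF.
move=> t; have : Num.sqrt 2 * (Num.sqrt 2)^-1 = 1 :> R by rewrite divff// gt_eqF.
have := sqrt2_sqr; move: (Num.sqrt 2) (Num.sqrt 2)^-1 => s i s2 si.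
have -> : i = s / 2 by nra.
by field.
Qed.

Lemma kink_mono x y : x <= y -> kink x <= kink y.
Proof.
move=> xy; rewrite -subr_ge0 -(primE prim_kink xy); apply: Int_ge0 => t _.
exact/ltW/kink'_gt0.
Qed.

Lemma kink_le x : 0 <= x -> kink x <= x.
Proof.
move=> x0; have := primE prim_kink x0; rewrite kink0 subr0 => <-.
rewrite -[leRHS]subr0 -[leRHS]mul1r -Int_cst//; apply: Int_le.
- exact: prim_locint prim_kink.
- exact: locint_cst.
- by move=> t _; exact: kink'_le1.
Qed.

Lemma kink_gt0 x : 0 < x -> 0 < kink x.
Proof.
move=> x0; rewrite /kink /tanh divr_gt0//.
  have : 0 < x / Num.sqrt 2 by rewrite divr_gt0// sqrt2_gt0.
  by rewrite subr_gt0 ltr_expR; lra.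
by rewrite addr_gt0 ?expR_gt0.
Qed.

Lemma kink_ge0 x : 0 <= x -> 0 <= kink x.
Proof. by move=> x0; rewrite -kink0; exact: kink_mono. Qed.

Lemma kink_ge0_le1 x : 0 <= x -> 0 <= kink x <= 1.
Proof. by move=> x0; rewrite kink_ge0//= (le_trans (ler_norm _))// kink_norm_le1. Qed.

(** [1 - tanh y = 2 exp(-y) / (exp y + exp(-y))] is at most [2 / exp y] for [y >= 0], and
    [exp y >= 1 + y]; hence the choice [y = 1 + 2 / e]. *)
Lemma kink_near1 e : 0 < e -> exists2 L, 1 <= L & 1 - kink L <= e.
Proof.
move=> e0; have s0 := sqrt2_gt0.
pose y := 1 + 2 / e; have y1 : 1 <= y by rewrite lerDl ltW// divr_gt0.
have s1 : 1 <= Num.sqrt 2 :> R by have := sqrt2_sqr; nra.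
exists (y * Num.sqrt 2); first by nra.
rewrite /kink /tanh mulfK ?gt_eqF//.
have e1 := expR_gt0 y; have e2 := expR_gt0 (- y).
have eg : 1 + y <= expR y by exact: expR_ge1Dx.
have el : expR (- y) <= 1 by rewrite -expR0 ler_expR; lra.
have -> : 1 - (expR y - expR (- y)) / (expR y + expR (- y)) = 2 * expR (- y) / (expR y + expR (- y)).
  by field; lra.
rewrite ler_pdivrMr; last lra.
have : e * y = e + 2 by rewrite /y; field; lra.
by nra.
Qed.

End kink_facts.

(** * Fields, their energy on segments and their momentum *)

Section fields.
Context {R : realType}.
Implicit Types (a b : R -> R) (x y t : R).

Definition modsq a b t := a t ^+ 2 + b t ^+ 2.

Definition energy_density (a b a' b' : R -> R) t :=
  2^-1 * (a' t ^+ 2 + b' t ^+ 2) + 4^-1 * (1 - modsq a b t) ^+ 2.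

Definition radial_density (a b a' b' : R -> R) t := a t * a' t + b t * b' t.

Definition kink_energy : R := Num.sqrt 2 * (2 / 3).

Definition H1loc (a b a' b' : R -> R) :=
  [/\ is_prim a a', is_prim b b' & locint (fun t => a' t ^+ 2 + b' t ^+ 2)].

(** For [H1loc] fields this is equivalent to [energy <= E], but it stays within real numbers and
    restricts to segments at once. *)
Definition energy_le (a b a' b' : R -> R) (E : R) :=
  forall x y, x <= y -> Int x y (energy_density a b a' b') <= E.

(* The momentum is [eps]-close to [pi/2] modulo [pi]; unlike [momentum_is], this
   formulation does not refer to symmetric intervals, hence is translation invariant. *)
Definition momentum_near_pi2 (a b a' b' : R -> R) (eps : R) := forall R1 eta : R, 0 < eta ->
  exists x y, [/\ x <= - R1, R1 <= y, `|1 - modsq a b x| < eta, `|1 - modsq a b y| < eta &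
    forall phi, arg_rel a b x y phi -> exists k : int,
      `|2^-1 * Int x y (momentum_density a b a' b') - 2^-1 * phi - pi / 2 - k%:~R * pi| < eps].

Lemma prim_sqrt f f' : is_prim f f' -> (forall t : R, 0 < f t) ->
  is_prim (fun t => Num.sqrt (f t)) (fun t => (2 * Num.sqrt (f t))^-1 * f' t).
Proof.
move=> pf f0; apply: (prim_comp (F := Num.sqrt) (F' := fun t => (2 * Num.sqrt t)^-1)) => // z.
  by near=> t; apply: is_derive1_sqrt; near: t; exact: lt_nbhsr.
have s0 : 0 < Num.sqrt (f z) by rewrite sqrtr_gt0.
apply: cvgV; first by rewrite mulf_neq0 ?gt_eqF.
by apply: cvgM; [exact: cvg_cst|exact: sqrt_continuous].
Unshelve. all: by end_near. Qed.

Lemma modsq_ge0 a b t : 0 <= modsq a b t.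
Proof. by rewrite addr_ge0 ?sqr_ge0. Qed.

Section H1loc_facts.
Variables (a b a' b' : R -> R).
Hypothesis H : H1loc a b a' b'.

Lemma modsq_continuous : continuous (modsq a b).
Proof.
case: H => pa pb _; have [ca cb] := (prim_continuous pa, prim_continuous pb).
by rewrite /modsq; cts.
Qed.

Lemma prim_modsq : is_prim (modsq a b) (fun t => 2 * radial_density a b a' b' t).
Proof.
case: H => pa pb _; apply: (prim_eq (primD (primM pa pa) (primM pb pb))) => t.
  by rewrite /modsq !expr2.
by rewrite /radial_density; ring.
Qed.

Lemma locint_radial : locint (radial_density a b a' b').
Proof.
case: H => pa pb _; apply: locintD; apply: locintM;
 [exact: prim_continuous pa|exact: prim_locint pa|exact: prim_continuous pb|exact: prim_locint pb].
Qed.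

Lemma locint_momentum : locint (momentum_density a b a' b').
Proof.
case: H => pa pb _; apply: locintB; apply: locintM;
 [exact: prim_continuous pa|exact: prim_locint pb|exact: prim_continuous pb|exact: prim_locint pa].
Qed.

Lemma locint_energy : locint (energy_density a b a' b').
Proof.
case: (H) => pa pb l2; apply: locintD; first exact: locintZ.
by apply: continuous_locint; have := modsq_continuous => cn; cts.
Qed.

Lemma energy_density_ge0 t : 0 <= energy_density a b a' b' t.
Proof. by rewrite addr_ge0// mulr_ge0// ?addr_ge0 ?sqr_ge0. Qed.

End H1loc_facts.

(** The two squares are those of the real and imaginary parts of [conj(v) v']: the kinetic energy
    splits into a radial and an angular part. *)
Lemma lagrange_modsq (a b a' b' : R -> R) t :
  modsq a b t * (a' t ^+ 2 + b' t ^+ 2) =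
  radial_density a b a' b' t ^+ 2 + momentum_density a b a' b' t ^+ 2.
Proof. by rewrite /modsq /radial_density /momentum_density; ring. Qed.

End fields.

(** * The calibration function *)

Section calibration_function.
Context {R : realType}.
Variable m : R.
Hypothesis m0 : 0 < m.

(** The antiderivative of [s^2 (1 - n) / n] with [n = m^2 + s^2] that vanishes at 0. *)
Definition calib (s : R) := s - m * atan (s / m) - s ^+ 3 / 3.

Lemma is_derive_calib (s : R) : is_derive s 1 calib (1 - m ^+ 2 / (m ^+ 2 + s ^+ 2) - s ^+ 2).
Proof.
have dA : is_derive s 1 (fun t : R => atan (t / m)) ((1 + (s / m) ^+ 2)^-1 * m^-1).
  apply: (is_derive1_comp (f := atan) (g := fun t => t / m)).
  by apply: is_derive_eq; rewrite !scaler0 add0r /GRing.scale/= mulr1.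
have dX : is_derive s (1 : R) (fun t : R => t ^+ 3 / 3) (s ^+ 2).
  apply: is_derive_eq; rewrite !scaler0 add0r /GRing.scale/= mulr1.
  by field.
have dM : is_derive s (1 : R) (fun t : R => m * atan (t / m)) (m * ((1 + (s / m) ^+ 2)^-1 * m^-1)).
  by apply: is_derive_eq.
have := is_deriveB (is_deriveB (is_derive_id s (1 : R)) dM) dX.
move/is_derive_eq; apply; congr (1 - _ - _).
have mz : m != 0 by rewrite gt_eqF.
have nz : m ^+ 2 + s ^+ 2 != 0 by rewrite gt_eqF// ltr_pwDl ?exprn_gt0 ?sqr_ge0.
by field; rewrite nz mz.
Qed.

Lemma calib_le s : 0 <= s -> calib s <= s.
Proof.
move=> s0; have A : 0 <= atan (s / m) by rewrite -atan0 le_atan// divr_ge0// ltW.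
have B : 0 <= s ^+ 3 by rewrite exprn_ge0.
have C : 0 <= m * atan (s / m) by rewrite mulr_ge0// ltW.
by rewrite /calib; lra.
Qed.

Hypothesis m1 : m < 1.

(** The term [m^2 / 6] is the gain over the kink energy. With [s = sqrt (1 - m^2)], the inequalities
    [s <= cos m] and [sin m <= m] give [atan (s / m) <= pi / 2 - m], so the two angular terms leave
    at least [m^2]. Six times the remaining difference is [(1 - s) (2 s^2 + 7 s + 1) >= 0]. *)
Lemma calib_end :
  2 / 3 + m ^+ 2 / 6 <= m * (pi / 2) + calib (Num.sqrt (1 - m ^+ 2)).
Proof.
move: (m0) (m1) => m_gt0 m_lt1; set s := Num.sqrt _.
have sE : s ^+ 2 = 1 - m ^+ 2 by rewrite sqr_sqrtr// subr_ge0 exprn_ile1 ?(ltW m0) ?(ltW m1).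
have s0 : 0 <= s by exact: sqrtr_ge0.
have p1 := pihalf_ge1 R.
have sm0 : 0 < sin m by apply: sin_gt0_pihalf; lra.
have cm0 : 0 < cos m by apply: cos_gt0_pihalf; lra.
have smm : sin m <= m.
  by have := sin_lipschitz m 0; rewrite sin0 !subr0 !gtr0_norm.
have scm : s <= cos m.
  rewrite -(@ler_pXn2r _ 2)// ?nnegrE ?(ltW cm0)//.
  by rewrite sE cos2sin2; nra.
have at_le : atan (s / m) <= pi / 2 - m.
  rewrite -[leRHS](@tanK R); last by rewrite in_itv/=; lra.
  apply: le_atan; rewrite /tan -[cos (_ - _)]cosN -[sin (_ - _)]opprK -sinN opprB.
  rewrite cosBpihalf sinBpihalf opprK ler_pdivlMr// mulrAC ler_pdivrMr//.
  by nra.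
have key : m * atan (s / m) <= m * (pi / 2 - m) by rewrite ler_pM2l.
have s1 : s <= 1 by nra.
have mE : m ^+ 2 = 1 - s ^+ 2 by lra.
rewrite /calib; have -> : s ^+ 3 = s * s ^+ 2 by rewrite exprS.
have : 0 <= (1 - s) * (s ^+ 2 + 4 * s + 1 - (1 + s) / 2) by nra.
move: key mE; rewrite !expr2; nra.
Qed.

End calibration_function.

(** Here [P] is [1 - n]. The expression is the sum of the squares of [u - tau q P / s] and
    [w - sg m P / s], the radial and angular equations of a grey soliton with minimal modulus
    [m]. *)
Lemma calibration_square (R : realFieldType) (u w q m P s sg tau : R) : s ^+ 2 = 2 ->
  sg = 1 \/ sg = -1 -> tau = 1 \/ tau = -1 ->
  0 <= u ^+ 2 + w ^+ 2 + (q ^+ 2 + m ^+ 2) * P ^+ 2 / 2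
       - sg * s * m * w * P - tau * s * q * P * u.
Proof.
move=> ss sgE tauE.
have -> : u ^+ 2 + w ^+ 2 + (q ^+ 2 + m ^+ 2) * P ^+ 2 / 2
       - sg * s * m * w * P - tau * s * q * P * u =
   (u - tau * q * P * s / 2) ^+ 2 + (w - sg * m * P * s / 2) ^+ 2
   + (q ^+ 2 + m ^+ 2) * P ^+ 2 / 4 * (2 - s ^+ 2).
  by case: sgE => ->; case: tauE => ->; field.
by rewrite ss subrr mulr0 addr0 addr_ge0 ?sqr_ge0.
Qed.

(** * The momentum calibration along a field *)

Section momentum_calibration.
Context {R : realType}.
Variables (a b a' b' : R -> R) (m : R).
Hypotheses (H : H1loc a b a' b') (m0 : 0 < m).
Hypothesis (nm : forall t, m ^+ 2 < modsq a b t).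
Notation n := (modsq a b).
Notation u := (radial_density a b a' b').
Notation w := (momentum_density a b a' b').
Notation e := (energy_density a b a' b').
Let s2 : R := Num.sqrt 2.
Let q t := Num.sqrt (n t - m ^+ 2).

Let n_gt0 t : 0 < n t. Proof. by have := nm t; have := sqr_ge0 m; lra. Qed.
Let q_gt0 t : 0 < q t. Proof. by rewrite sqrtr_gt0 subr_gt0. Qed.
Let q_sqr t : q t ^+ 2 = n t - m ^+ 2. Proof. by rewrite sqr_sqrtr// subr_ge0 ltW. Qed.

Lemma prim_calib : is_prim (fun t => calib m (q t)) (fun t => q t * (1 - n t) / n t * u t).
Proof.
have pn := primD (prim_modsq H) (prim_cst (- m ^+ 2)).
have f0 t : 0 < n t + - m ^+ 2 by rewrite subr_gt0.
have pq := prim_sqrt pn f0.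
have mm : 0 < m ^+ 2 by rewrite exprn_gt0.
apply: (prim_eq (prim_comp (F := calib m)
  (F' := fun s => 1 - m ^+ 2 / (m ^+ 2 + s ^+ 2) - s ^+ 2) pq _ _)) => //.
- by move=> z; near=> t; exact: is_derive_calib.
- have c s : m ^+ 2 + s ^+ 2 != 0 by rewrite gt_eqF// ltr_pwDl ?sqr_ge0.
  move=> z; apply: ctsD; last by cts.
  by apply: ctsD; [cts|apply: ctsN; apply: ctsM; [cts|apply: ctsV => //; cts]].
move=> t; rewrite -/(q t) q_sqr addr0.
have -> : m ^+ 2 + (n t - m ^+ 2) = n t by ring.
have qE := q_sqr t; have q0 := q_gt0 t; have n0 := n_gt0 t.
have -> : m ^+ 2 = n t - q t ^+ 2 by rewrite qE; ring.
by field; rewrite !gt_eqF.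
Unshelve. all: by end_near. Qed.

(** [w - w / n = - W]: up to sign, the momentum density minus the derivative of the phase. *)
Let W t := (1 - n t) / n t * w t.

Let cn : continuous n. Proof. exact: modsq_continuous H. Qed.

Lemma locint_W : locint W.
Proof.
have nz t : n t != 0 by rewrite gt_eqF.
apply: locintM; last exact: locint_momentum H.
by apply: ctsM; [cts|apply: ctsV].
Qed.

Lemma calibration_half sg tau x y : sg = 1 \/ sg = -1 -> tau = 1 \/ tau = -1 -> x <= y ->
  sg * (s2 * m / 2) * Int x y W + tau * (s2 / 2) * (calib m (q y) - calib m (q x))
  <= Int x y e.
Proof.
move=> sgE tauE xy; rewrite -(primE prim_calib xy).
have lc := prim_locint prim_calib; have lW := locint_W.
rewrite -IntZ// -(IntZ _ _ _ lc) -IntD; [|exact: locintZ|exact: locintZ].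
apply: Int_le.
- by apply: locintD; exact: locintZ.
- exact: locint_energy H.
move=> t _; have n0 := n_gt0 t; rewrite /W.
(* Multiplied by [2 n], the pointwise inequality is [calibration_square] with [u^2 + w^2] rewritten
   by the Lagrange identity. *)
rewrite -subr_ge0 -(pmulr_rge0 _ (_ : 0 < 2 * n t)); last lra.
have := @calibration_square R (u t) (w t) (q t) m (1 - n t) s2 sg tau sqrt2_sqr sgE tauE.
rewrite q_sqr subrK -lagrange_modsq.
set L := (X in 0 <= X -> _); set L' := (X in _ -> 0 <= X).
suff -> : L' = L by [].
rewrite /L /L' /energy_density; field; by rewrite gt_eqF.
Qed.

(** [sg] is the same on both sides of [x0] while [tau] flips there, so that both ends contribute
    with a plus sign. The loss is concentrated at [x0], where [calib] is small when the modulus is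
    almost minimal. *)
Lemma calibration sg x x0 y : sg = 1 \/ sg = -1 -> x <= x0 -> x0 <= y ->
  sg * (s2 * m / 2) * Int x y W +
  s2 / 2 * (calib m (q x) + calib m (q y) - 2 * calib m (q x0)) <= Int x y e.
Proof.
move=> sgE xx0 x0y.
have A := @calibration_half sg 1 x0 y sgE (or_introl erefl) x0y.
have B := @calibration_half sg (-1) x x0 sgE (or_intror erefl) xx0.
rewrite (Int_cat locint_W xx0 x0y) (Int_cat (locint_energy H) xx0 x0y).
by move: A B; rewrite /s2; set I1 := Int _ _ _; lra.
Qed.

End momentum_calibration.

(** * A momentum near pi/2 and a nearly minimal energy force a small modulus *)

Section vanishing_modulus.
Context {R : realType}.
Variables (a b a' b' : R -> R).
Hypothesis H : H1loc a b a' b'.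
Notation n := (modsq a b).
Notation w := (momentum_density a b a' b').

(** The momentum is known modulo [pi] only. For the class of [pi / 2] this costs nothing, since
    every representative is at least as large in absolute value. *)
Lemma half_pi_le_norm (k : int) : pi / 2 <= `|pi / 2 + k%:~R * pi| :> R.
Proof.
have p0 := pi_gt0 R; case: k => j.
  have j0 : 0 <= j%:R * pi :> R by rewrite mulr_ge0// ltW.
  by rewrite -pmulrn ger0_norm; lra.
have j0 : 0 <= j%:R * pi :> R by rewrite mulr_ge0// ltW.
have -> : (Negz j)%:~R = - (j%:R + 1) :> R by rewrite NegzE mulrNz -pmulrn -natr1.
have -> : pi / 2 + - (j%:R + 1) * pi = - (j%:R * pi + pi / 2) :> R by field.
by rewrite normrN ger0_norm; lra.
Qed.

(** Divided by [sqrt 2], the calibrated energy is at least [m (pi / 2 - eps)] from the momentum,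
    plus [calib (sqrt (1 - m^2))] from the two far ends up to [eta], minus at most [k] from [x0]. By
    [calib_end] this exceeds [2 / 3] by [m^2 / 6], up to the errors, while the energy bound allows
    only [2 / 3 + eps']. *)
Lemma momentum_modulus_le m k eps eps' x0 : 0 < m -> m < 1 -> 0 <= k -> 0 <= eps ->
  (forall t, m ^+ 2 < n t) -> n x0 <= m ^+ 2 + k ^+ 2 ->
  energy_le a b a' b' (kink_energy + Num.sqrt 2 * eps') ->
  momentum_near_pi2 a b a' b' eps ->
  m ^+ 2 / 6 <= eps + eps' + k.
Proof.
move=> m0 m1 k0 eps0 nm nx0 EH MH; apply/ler_addgt0Pr => eta eta0.
have s0 := @sqrt2_gt0 R.
have mm : 0 < m ^+ 2 by rewrite exprn_gt0.
pose C t := calib m (Num.sqrt (t - m ^+ 2)).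
have cC : {for 1, continuous C}.
  apply: (@cts_comp _ (fun t => Num.sqrt (t - m ^+ 2)) (calib m)); last by cts.
  by move=> s; exact: is_derive1_continuous (is_derive_calib m0 s).
have [d d0 Cd] := continuous_ex cC eta0.
have [x [y [xR yR nx ny Harg]]] := MH `|x0| d d0.
have x0b : - `|x0| <= x0 <= `|x0| by rewrite -ler_norml.
have [xx0 x0y] : x <= x0 /\ x0 <= y by lra.
have xy : x <= y by lra.
case: (H) => pa pb _.
have [mu mu0 /=] := polar_lift pa pb mm xy (fun t _ => ltW (nm t)).
set th := Int x y _ => -[ayE byE].
have [|j Hj] := Harg th.
  exists (mu * n x); first by rewrite mulr_gt0//; have := nm x; lra.
  by rewrite ayE byE /modsq; split; ring.
have lw := locint_momentum H.
have nz t : n t != 0 by rewrite gt_eqF//; have := nm t; lra.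
have cn := modsq_continuous H.
have lwn : locint (fun t => w t / n t).
  have : locint (fun t => (n t)^-1 * w t) by apply: locintM => //; exact: ctsV.
  by under eq_fun do rewrite mulrC.
(* With the lifted phase [th] as argument difference, the untwisted momentum over [[x, y]] equals
   [- W / 2]. *)
have WE : Int x y (fun t => (1 - n t) / n t * w t) = th - Int x y w.
  rewrite -IntB//; apply: Int_eq => t _.
  by rewrite -/(modsq a b t); field.
set W := Int x y _ in WE.
have Wge : pi / 2 - eps <= `|W| / 2.
  have := half_pi_le_norm j; have := ler_normB (- (W / 2) - (pi / 2 + j%:~R * pi)) (- (W / 2)).
  have -> : - (W / 2) - (pi / 2 + j%:~R * pi) - - (W / 2) = - (pi / 2 + j%:~R * pi) by ring.
  have -> : - (W / 2) - (pi / 2 + j%:~R * pi) =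
      2^-1 * Int x y w - 2^-1 * th - pi / 2 - j%:~R * pi by rewrite WE; field.
  by rewrite !normrN normrM (gtr0_norm (_ : 0 < 2^-1))// => A B; move: Hj A B; lra.
pose sg : R := if 0 <= W then 1 else -1.
have sgE : sg = 1 \/ sg = -1 by rewrite /sg; case: ifP; [left|right].
have sgW : sg * W = `|W|.
  rewrite /sg; case: ifPn => W0; first by rewrite mul1r ger0_norm.
  by rewrite mulN1r ltr0_norm// ltNge.
have := calibration H m0 nm sgE xx0 x0y; rewrite -/W.
move/le_trans => /(_ _ (EH x y xy)).
have Cx : calib m (Num.sqrt (1 - m ^+ 2)) - eta <= calib m (Num.sqrt (n x - m ^+ 2)).
  by have := Cd (n x); rewrite distrC => /(_ nx); rewrite /C ltr_norml; lra.
have Cy : calib m (Num.sqrt (1 - m ^+ 2)) - eta <= calib m (Num.sqrt (n y - m ^+ 2)).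
  by have := Cd (n y); rewrite distrC => /(_ ny); rewrite /C ltr_norml; lra.
have Cx0 : calib m (Num.sqrt (n x0 - m ^+ 2)) <= k.
  apply: (le_trans (calib_le m0 (sqrtr_ge0 _))).
  by rewrite -(ger0_norm k0) -sqrtr_sqr; apply: ler_wsqrtr; lra.
have Cend := calib_end m0 m1.
rewrite /kink_energy.
have -> : sg * (Num.sqrt 2 * m / 2) * W = Num.sqrt 2 * (m * (`|W| / 2)) by rewrite -sgW; field.
move=> K.
have {K} : m * (`|W| / 2) + (calib m (Num.sqrt (n x - m ^+ 2)) + calib m (Num.sqrt (n y - m ^+ 2))
    - 2 * calib m (Num.sqrt (n x0 - m ^+ 2))) / 2 <= 2 / 3 + eps'.
  rewrite -(ler_pM2l s0); move: K.
  by set q1 := calib m _; set q2 := calib m _; set q3 := calib m _; lra.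
have mW : m * (pi / 2 - eps) <= m * (`|W| / 2) by rewrite ler_pM2l.
have me : m * eps <= eps by rewrite ler_piMl// ltW.
by move: Cx Cy Cx0 Cend mW me; lra.
Qed.

(* Applied with [m^2] just below the infimum of [|v|^2], the calibration forces
   this infimum to be small. *)
Lemma exists_small_modulus eps : 0 < eps ->
  energy_le a b a' b' (kink_energy + Num.sqrt 2 * eps) ->
  momentum_near_pi2 a b a' b' eps ->
  exists x0, n x0 <= 14 * eps.
Proof.
move=> eps0 EH MH; apply: contrapT => nex.
have big t : 14 * eps < n t by rewrite ltNge; apply/negP => nt; apply: nex; exists t.
have hi : has_inf (range n).
  by split; [exists (n 0), 0|exists 0 => _ [t _ <-]; exact: modsq_ge0].
pose N0 := inf (range n).
have N0le t : N0 <= n t by apply: ge_inf; [case: hi|exists t].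
have N0ge : 14 * eps <= N0.
  by apply: lb_le_inf; [exists (n 0), 0|move=> _ [t _ <-]; exact: ltW].
have N01 : N0 <= 1.
  apply/ler_addgt0Pr => d d0; have [x [y [_ _ nx _ _]]] := MH 0 d d0.
  by apply: (le_trans (N0le x)); move: nx; rewrite ltr_norml; lra.
(* With [m^2 = N0 - k^2], strictly below the infimum, and [n x0 < N0 + k^2], the modulus bound
   yields [N0 <= 12 eps + 12 k + k^2 < 13 eps], against [14 eps <= N0]. *)
pose k := Num.min (1 / 2) (eps / 13).
have k0 : 0 < k by rewrite lt_min; apply/andP; split; lra.
have k1 : k <= 1 / 2 by rewrite ge_min lexx.
have k2 : k <= eps / 13 by rewrite ge_min lexx orbT.
have kk0 : 0 < k ^+ 2 by rewrite exprn_gt0.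
have kk1 : k ^+ 2 <= k / 2 by rewrite expr2 mulrC; nra.
have Nk : 0 < N0 - k ^+ 2 by lra.
pose m := Num.sqrt (N0 - k ^+ 2).
have mE : m ^+ 2 = N0 - k ^+ 2 by rewrite sqr_sqrtr// ltW.
have m0 : 0 < m by rewrite sqrtr_gt0.
have m1 : m < 1 by rewrite -(@ltr_pXn2r _ 2)// ?nnegrE ?(ltW m0)// mE expr1n; lra.
have [_ [x0 _ <-] nx0] := inf_adherent kk0 hi.
have nm t : m ^+ 2 < n t by rewrite mE; have := N0le t; lra.
have := @momentum_modulus_le m (2 * k) eps eps x0 m0 m1 _ (ltW eps0) nm _ EH MH.
move=> /(_ _ _); rewrite mE => K.
have : (N0 - k ^+ 2) / 6 <= eps + eps + 2 * k.
  by apply: K; [lra|rewrite exprMn; move: nx0; rewrite -/N0; lra].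
by lra.
Qed.

End vanishing_modulus.

(** * The regularized first-order equation and its defect *)

Section bogomolny.
Context {R : realType}.
Variables (a b a' b' : R -> R) (kp : R).
Hypotheses (H : H1loc a b a' b') (kp0 : 0 < kp).
Notation n := (modsq a b).
Notation u := (radial_density a b a' b').
Notation w := (momentum_density a b a' b').
Notation e := (energy_density a b a' b').
Notation s2 := (Num.sqrt 2 : R).

(* A smooth substitute for [|v|] near the zeros of [v]. *)
Definition rho t := Num.sqrt (n t + kp ^+ 2).

(** Coefficient of the regularized equation [v' = speed v]; for [kp = 0] the kink solves it on the
    right half line. *)
Definition speed t := (1 - n t) / (s2 * rho t).

(** An antiderivative of [1 + kp^2 - s^2], which at [s = rho] is [1 - n]; thus [profile (rho)] has
    derivative [sqrt 2 speed u]. *)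
Definition profile (s : R) := (1 + kp ^+ 2) * s - s ^+ 3 / 3.

(** The energy density minus an exact derivative. It dominates [|v' - speed v|^2 / 2], so a small
    integral means that the first-order equation almost holds. *)
Definition defect t := e t - speed t * u t.

Let kk0 : 0 < kp ^+ 2. Proof. by rewrite exprn_gt0. Qed.

Lemma rho_gt0 t : 0 < rho t.
Proof. by rewrite sqrtr_gt0; have := modsq_ge0 a b t; have := kk0; lra. Qed.

Lemma rho_sqr t : rho t ^+ 2 = n t + kp ^+ 2.
Proof. by rewrite sqr_sqrtr// addr_ge0 ?modsq_ge0 ?sqr_ge0. Qed.

Lemma prim_rho : is_prim rho (fun t => u t / rho t).
Proof.
have pn := primD (prim_modsq H) (prim_cst (kp ^+ 2)).
have f0 t : 0 < n t + kp ^+ 2 by have := modsq_ge0 a b t; have := kk0; lra.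
apply: (prim_eq (prim_sqrt pn f0)) => // t.
rewrite -/(rho t) addr0; have r0 := rho_gt0 t.
by field; rewrite gt_eqF.
Qed.

Lemma speed_rho t : speed t * rho t * s2 = 1 - n t.
Proof.
have r0 := rho_gt0 t; have s0 := @sqrt2_gt0 R.
by rewrite /speed; field; rewrite !gt_eqF.
Qed.

Lemma speed_continuous : continuous speed.
Proof.
have cn := modsq_continuous H; have cr := prim_continuous prim_rho.
apply: ctsM; first by cts.
apply: ctsV; last by cts.
by move=> t; rewrite mulf_neq0// gt_eqF ?sqrt2_gt0 ?rho_gt0.
Qed.

Lemma locint_speed : locint (fun t => speed t * u t).
Proof. by apply: locintM; [exact: speed_continuous|exact: locint_radial H]. Qed.

Lemma locint_defect : locint defect.
Proof. by apply: locintB; [exact: locint_energy H|exact: locint_speed]. Qed.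

Lemma prim_profile : is_prim (fun t => profile (rho t)) (fun t => s2 * (speed t * u t)).
Proof.
have pr := prim_rho.
have := primD (primZ (1 + kp ^+ 2) pr) (primZ (- (1/3)) (primM (primM pr pr) pr)).
move=> /prim_eq; apply => t; first by rewrite /profile; field.
have r0 := rho_gt0 t; have sr := speed_rho t; have rr := rho_sqr t.
have -> : s2 * (speed t * u t) = (speed t * rho t * s2) * (u t / rho t).
  by field; rewrite gt_eqF.
rewrite sr; have -> : n t = rho t ^+ 2 - kp ^+ 2 by rewrite rr; ring.
by field; rewrite gt_eqF.
Qed.

Lemma energy_speed_split t sg : sg = 1 \/ sg = -1 ->
  e t - sg * (speed t * u t) = 2^-1 * ((a' t - sg * speed t * a t) ^+ 2 + (b' t - sg * speed t * b t) ^+ 2)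
    + 2^-1 * speed t ^+ 2 * kp ^+ 2.
Proof.
move=> sgE; have sr := speed_rho t; have rr := rho_sqr t.
have E : 4^-1 * (1 - n t) ^+ 2 = 2^-1 * speed t ^+ 2 * (n t + kp ^+ 2).
  have s22 := @sqrt2_sqr R; rewrite -sr -rr !exprMn s22; lra.
rewrite /energy_density E /modsq /radial_density.
by case: sgE => ->; field.
Qed.

Lemma defectE t : defect t =
  2^-1 * ((a' t - speed t * a t) ^+ 2 + (b' t - speed t * b t) ^+ 2) + 2^-1 * speed t ^+ 2 * kp ^+ 2.
Proof. by have := energy_speed_split t (or_introl (erefl 1)); rewrite !mul1r. Qed.

Lemma defect_ge0 t : 0 <= defect t.
Proof.
have := sqr_ge0 (a' t - speed t * a t); have := sqr_ge0 (b' t - speed t * b t).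
have := mulr_ge0 (sqr_ge0 (speed t)) (sqr_ge0 kp).
by rewrite defectE; lra.
Qed.

Lemma energy_speed_ge t : - (speed t * u t) <= e t.
Proof.
have := energy_speed_split t (or_intror (erefl (-1))).
have := sqr_ge0 (a' t - -1 * speed t * a t); have := sqr_ge0 (b' t - -1 * speed t * b t).
have := mulr_ge0 (sqr_ge0 (speed t)) (sqr_ge0 kp).
by lra.
Qed.

(** Subtracting a real multiple of [v] from [v'] does not change [w]; Cauchy-Schwarz is then applied
    to [v] and [v' - speed v]. *)
Lemma momentum_defect t : w t ^+ 2 <= 2 * n t * defect t.
Proof.
pose p := speed t; rewrite defectE -/p.
have -> : w t = a t * (b' t - p * b t) - b t * (a' t - p * a t).
  by rewrite /momentum_density; ring.
rewrite /modsq; set x := a' t - _; set y := b' t - _.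
have := mulr_ge0 (modsq_ge0 a b t) (mulr_ge0 (sqr_ge0 p) (sqr_ge0 kp)).
have := sqr_ge0 (a t * x + b t * y); rewrite /modsq.
by move: (a t) (b t) x y => A B x y; nra.
Qed.

Lemma Int_defect x y : x <= y ->
  Int x y defect = Int x y e - (profile (rho y) - profile (rho x)) / s2.
Proof.
move=> xy; have s0 := @sqrt2_gt0 R; have lS := locint_speed.
rewrite /defect IntB//; last exact: locint_energy H.
rewrite -(primE prim_profile xy) IntZ//; congr (_ - _).
by field; rewrite gt_eqF.
Qed.

Lemma profile_le s : 0 <= s -> kp <= 1 -> profile s <= 2 * s.
Proof.
move=> s0 k1; have := exprn_ge0 3 s0; have : kp ^+ 2 <= 1 by rewrite exprn_ile1// ltW.
by move=> k2 s3; rewrite /profile; nra.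
Qed.

Lemma rho_0_le : n 0 <= kp ^+ 2 -> rho 0 <= 2 * kp.
Proof.
move=> n0; have r0 := rho_gt0 0; have rr := rho_sqr 0; have k0 := kp0.
have k2 : 0 <= 2 * kp by lra.
rewrite -(@ler_pXn2r _ 2)// ?nnegrE ?(ltW r0) ?k2//.
by rewrite rr exprMn; have := kk0; lra.
Qed.

Definition modulus_tails (c d : R -> R) := forall R1 eta : R, 0 < eta -> exists x y,
  [/\ x <= - R1, R1 <= y, `|1 - modsq c d x| < eta & `|1 - modsq c d y| < eta].

(** Rests on [profile s = 2/3 - (s - 1)^2 (s + 2) / 3 + kp^2 s] at [s = rho t], with
    [(s - 1)^2 <= 4 kp] and [s + 2 <= 4]. *)
Lemma profile_far t : kp <= 1 -> `|1 - n t| < kp ^+ 2 -> 2 / 3 - 16 / 3 * kp <= profile (rho t).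
Proof.
move=> k1; have r0 := rho_gt0 t; have rr := rho_sqr t; have k0 := kp0.
have k2 := kk0; have k2k : kp ^+ 2 <= kp by rewrite expr2 ger_pMl.
rewrite ltr_norml => nt.
have rr1 : - kp <= rho t ^+ 2 - 1 <= 2 * kp by lra.
have r2 : rho t <= 2.
  by rewrite -(@ler_pXn2r _ 2)// ?nnegrE ?(ltW r0)//; rewrite rr; lra.
have q : (rho t - 1) ^+ 2 <= 4 * kp.
  have -> : (rho t - 1) ^+ 2 = (rho t ^+ 2 - 1) ^+ 2 / (rho t + 1) ^+ 2.
    by field; rewrite gt_eqF//; lra.
  rewrite ler_pdivrMr; last by rewrite exprn_gt0//; lra.
  have : (rho t ^+ 2 - 1) ^+ 2 <= 4 * kp ^+ 2 by nra.
  have : 1 <= (rho t + 1) ^+ 2 by rewrite exprn_ege1//; lra.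
  by nra.
have -> : profile (rho t) = 2 / 3 - (rho t - 1) ^+ 2 * (rho t + 2) / 3 + kp ^+ 2 * rho t.
  by rewrite /profile; field.
by have := mulr_gt0 k2 r0; have := sqr_ge0 (rho t - 1); nra.
Qed.

(** Going from a nearly vanishing modulus to a modulus near 1 costs about [(2/3) / sqrt 2] on each
    side, which uses up the whole kink energy; what is left bounds the defect on the right. The
    constant 19 rounds up [2 (16/3) + 2 (4)], from the values of [profile] at the far ends and at
    0. *)
Lemma Int_defect_le eps y : kp <= 1 -> n 0 <= kp ^+ 2 -> modulus_tails a b ->
  energy_le a b a' b' (kink_energy + eps) -> 0 <= y ->
  Int 0 y defect <= eps + 19 * kp.
Proof.
move=> k1 n0 tl EH y0; have s0 := @sqrt2_gt0 R.
have [x1 [y1 [xy1 yy1 nx1 ny1]]] := tl y _ kk0.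
apply: (le_trans (Int_sub locint_defect defect_ge0 (lexx 0) y0 yy1)).
have x10 : x1 <= 0 by lra.
have y10 : 0 <= y1 by lra.
rewrite Int_defect//.
have A : (profile (rho x1) - profile (rho 0)) / s2 <= Int x1 0 e.
  have := @Int_le _ x1 0 (fun t => - (speed t * u t)) e (locintN locint_speed) (locint_energy H)
    (fun t _ => energy_speed_ge t).
  have -> : Int x1 0 (fun t => - (speed t * u t)) = (profile (rho x1) - profile (rho 0)) / s2.
    have -> : profile (rho x1) - profile (rho 0) = - Int x1 0 (fun t => s2 * (speed t * u t)).
      by rewrite (primE prim_profile)//; ring.
    rewrite IntZ; last exact: locint_speed.
    have := @IntZ _ x1 0 (-1) _ locint_speed; under eq_Rintegral do rewrite mulN1r.
    by move=> ->; field; rewrite gt_eqF.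
  by [].
have B := EH x1 y1 (le_trans x10 y10).
rewrite (Int_cat (locint_energy H) x10 y10) in B.
have C1 := profile_far k1 nx1; have C2 := profile_far k1 ny1.
have D : profile (rho 0) <= 4 * kp.
  by apply: (le_trans (profile_le (ltW (rho_gt0 0)) k1)); have := rho_0_le n0; lra.
have KE : kink_energy = 4 / 3 / s2 :> R.
  apply: (mulIf (lt0r_neq0 s0)); rewrite divfK ?gt_eqF// /kink_energy.
  by have := @sqrt2_sqr R; rewrite expr2; lra.
have s1 : s2^-1 <= 1 by rewrite invf_le1//; have := @sqrt2_sqr R; nra.
have si : 0 < s2^-1 by rewrite invr_gt0.
rewrite KE in B.
set P1 := profile (rho x1) in A C1 *; set P2 := profile (rho y1) in C2 *.
set P0 := profile (rho 0) in A D *.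
have F : (4 / 3 - (P1 + P2 - 2 * P0)) / s2 <= 19 * kp.
  apply: (@le_trans _ _ (19 * kp / s2)); first by rewrite ler_pM2r//; have := kp0; lra.
  by rewrite ler_piMr// mulr_ge0// ltW.
by move: A B F; lra.
Qed.

End bogomolny.

(** Young's inequality plays the role of Cauchy-Schwarz for integrals: bounds become linear in the
    integral of the defect, and [beta] is chosen at the end. *)
Lemma norm_le_amgm {R : realFieldType} (beta x : R) : 0 < beta ->
  `|x| <= beta / 2 + x ^+ 2 / (2 * beta).
Proof.
move=> b0; have -> : beta / 2 + x ^+ 2 / (2 * beta) = (beta ^+ 2 + `|x| ^+ 2) / (2 * beta).
  by rewrite real_normK ?num_real//; field; rewrite gt_eqF.
rewrite ler_pdivlMr; last by rewrite mulr_gt0.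
by have := sqr_ge0 (beta - `|x|); lra.
Qed.

Lemma norm_mul_amgm {R : realFieldType} (beta z y : R) : 0 < beta ->
  `|z * y| <= beta * z ^+ 2 / 2 + y ^+ 2 / (2 * beta).
Proof.
move=> b0; have -> : beta * z ^+ 2 / 2 + y ^+ 2 / (2 * beta) =
    ((beta * `|z|) ^+ 2 + `|y| ^+ 2) / (2 * beta).
  by rewrite exprMn (real_normK (num_real z)) (real_normK (num_real y)); field; rewrite gt_eqF.
by rewrite ler_pdivlMr ?mulr_gt0// normrM; have := sqr_ge0 (beta * `|z| - `|y|); lra.
Qed.

Lemma sqr_dot_le {R : realFieldType} (x y z t : R) :
  (x * z + y * t) ^+ 2 <= (x ^+ 2 + y ^+ 2) * (z ^+ 2 + t ^+ 2).
Proof. by have := sqr_ge0 (x * t - y * z); lra. Qed.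

(** * Modulus, phase and momentum on the right half line *)

Section right_half_line.
Context {R : realType}.
Variables (a b a' b' : R -> R) (kp d : R).
Hypotheses (H : H1loc a b a' b') (kp0 : 0 < kp) (kp1 : kp <= 1).
Notation n := (modsq a b).
Notation u := (radial_density a b a' b').
Notation w := (momentum_density a b a' b').
Notation e := (energy_density a b a' b').
Notation s2 := (Num.sqrt 2 : R).
Notation r := (rho a b kp).
Notation p := (speed a b kp).
Notation def := (defect a b a' b' kp).
Notation K := (@kink R).
Hypothesis n0 : n 0 <= kp ^+ 2.
Hypothesis D : forall y, 0 <= y -> Int 0 y def <= d.

Let r0 t : 0 < r t. Proof. exact: rho_gt0. Qed.
Let rr t : r t ^+ 2 = n t + kp ^+ 2. Proof. exact: rho_sqr. Qed.
Let ldef : locint def. Proof. exact: locint_defect. Qed.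
Let def0 t : 0 <= def t. Proof. exact: defect_ge0. Qed.

(** [rho] almost solves the kink equation. The error consists of the component [X] of [v' - speed v]
    along [v], and of [Y] and [kp^2 / sqrt 2], due to the regularization; [X^2 + Y^2] is at most
    twice the defect. *)
Lemma rho_ode_error t beta : 0 < beta ->
  `|u t / r t - (1 - r t ^+ 2) / s2| <= kp ^+ 2 + beta + def t / beta.
Proof.
move=> b0; have s0 := @sqrt2_gt0 R; have rt := r0 t.
pose h1 := a' t - p t * a t; pose h2 := b' t - p t * b t.
pose X := (a t * h1 + b t * h2) / r t; pose Y := p t * kp ^+ 2 / r t.
have -> : u t / r t - (1 - r t ^+ 2) / s2 = X - Y + kp ^+ 2 / s2.
  have pE : p t * r t = (1 - n t) / s2 by rewrite -(speed_rho _ _ kp0) mulfK// gt_eqF.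
  have -> : (1 - r t ^+ 2) / s2 = p t * r t - kp ^+ 2 / s2.
    by rewrite pE rr; field; rewrite gt_eqF.
  rewrite /X /Y /h1 /h2 /radial_density.
  have -> : kp ^+ 2 = r t ^+ 2 - (a t ^+ 2 + b t ^+ 2) by rewrite rr /modsq; ring.
  by field; rewrite !gt_eqF.
have X2 : X ^+ 2 <= h1 ^+ 2 + h2 ^+ 2.
  rewrite /X expr_div_n ler_pdivrMr ?exprn_gt0// rr /modsq.
  apply: (le_trans (sqr_dot_le _ _ _ _)).
  by rewrite mulrC ler_wpM2l ?addr_ge0 ?sqr_ge0// lerDl sqr_ge0.
have Y2 : Y ^+ 2 <= p t ^+ 2 * kp ^+ 2.
  rewrite /Y expr_div_n ler_pdivrMr ?exprn_gt0// exprMn.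
  rewrite rr.
  have := mulr_ge0 (sqr_ge0 (p t)) (mulr_ge0 (sqr_ge0 kp) (modsq_ge0 a b t)).
  by lra.
have dE : def t = 2^-1 * (h1 ^+ 2 + h2 ^+ 2) + 2^-1 * p t ^+ 2 * kp ^+ 2 by exact: defectE.
have A1 := norm_le_amgm X b0; have A2 := norm_le_amgm Y b0.
have A3 : X ^+ 2 / (2 * beta) + Y ^+ 2 / (2 * beta) <= def t / beta.
  rewrite -mulrDl; have -> : def t / beta = (2 * def t) / (2 * beta) by field; rewrite gt_eqF.
  by rewrite ler_pM2r ?invr_gt0 ?mulr_gt0//; lra.
have A4 : `|kp ^+ 2 / s2| <= kp ^+ 2.
  rewrite ger0_norm ?divr_ge0 ?sqr_ge0 ?(ltW s0)//.
  rewrite ler_piMr ?sqr_ge0// invf_le1//; have := @sqrt2_sqr R; nra.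
apply: (le_trans (ler_normD _ _)); have := ler_normB X Y; lra.
Qed.

(** For the difference [Df] of [rho] and the kink, [Df' = j - (rho + K) Df / sqrt 2] with
    [rho + K >= 0] for positive times, so the last term only decreases [Df^2] and no exponential
    factor appears. Evaluation at the maximum [c] of [|Df|] gives
    [Df(c)^2 <= Df(0)^2 + 2 |Df(c)| J]. *)
Lemma rho_close_kink L beta x : 0 < beta -> 0 <= x <= L ->
  `|r x - K x| <= 2 * kp + 2 * (L * (kp ^+ 2 + beta) + d / beta).
Proof.
move=> b0 /andP[x0 xL]; have L0 := le_trans x0 xL; have s0 := @sqrt2_gt0 R.
have pr := prim_rho H kp0; have pk := @prim_kink R.
have pD := primD pr (primZ (-1) pk).
set Df := (fun t => r t + -1 * K t) in pD.
have cD := prim_continuous pD.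
have cN : continuous (fun t => `|Df t|).
  by apply: (@cts_comp _ Df (fun t => `|t|)) => //; exact: norm_continuous.
have [c /[!in_itv]/= /andP[c0 cL] cmax] := EVT_max L0 (continuous_subspaceT cN).
pose J := L * (kp ^+ 2 + beta) + d / beta.
have d0 : 0 <= d by have := D (lexx 0); rewrite Int_xx.
have J0 : 0 <= J.
  by rewrite addr_ge0 ?divr_ge0 ?mulr_ge0 ?addr_ge0 ?sqr_ge0 ?(ltW b0).
have key : Df c ^+ 2 <= Df 0 ^+ 2 + 2 * `|Df c| * J.
  have := primE (primM pD pD) c0; rewrite -!expr2 => E.
  have -> : Df c ^+ 2 = Df 0 ^+ 2 + (Df c ^+ 2 - Df 0 ^+ 2) by ring.
  rewrite -E lerD2l.
  apply: (@le_trans _ _ (Int 0 c (fun t => 2 * `|Df c| * (kp ^+ 2 + beta + beta^-1 * def t)))).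
    apply: Int_le.
    - exact: prim_locint (primM pD pD).
    - by apply: locintZ; apply: locintD; [exact: locint_cst|exact: locintZ].
    move=> t /andP[t0 tc].
    set j := u t / r t - (1 - r t ^+ 2) / s2.
    have jb : `|j| <= kp ^+ 2 + beta + beta^-1 * def t by rewrite [beta^-1 * _]mulrC; exact: rho_ode_error.
    have DE : u t / r t + -1 * kink' t = j - (r t + K t) * Df t / s2.
      by rewrite /j /kink' /Df; field; rewrite !gt_eqF.
    rewrite DE.
    have K0 := kink_ge0 t0; have rt := r0 t.
    have Dm : `|Df t| <= `|Df c| by apply: cmax; rewrite in_itv/= t0 (le_trans tc cL).
    have Dj : Df t * j <= `|Df c| * (kp ^+ 2 + beta + beta^-1 * def t).
      by apply: (le_trans (ler_norm _)); rewrite normrM; exact: ler_pM.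
    have : 0 <= (r t + K t) * (Df t * Df t) / s2.
      by rewrite divr_ge0 ?(ltW s0)// mulr_ge0 -?expr2 ?sqr_ge0// addr_ge0// ltW.
    by move: Dj; lra.
  rewrite IntZ; last by apply: locintD; [exact: locint_cst|exact: locintZ].
  have -> : Int 0 c (fun t => kp ^+ 2 + beta + beta^-1 * def t) =
      (kp ^+ 2 + beta) * c + beta^-1 * Int 0 c def.
    by rewrite IntD; [|exact: locint_cst|exact: locintZ]; rewrite Int_cst// IntZ// subr0.
  apply: ler_wpM2l; first by rewrite mulr_ge0.
  rewrite /J mulrC [d / _]mulrC; apply: lerD.
    by apply: ler_wpM2r => //; rewrite addr_ge0 ?sqr_ge0 ?(ltW b0).
  by rewrite ler_pM2l ?invr_gt0//; exact: D.
have D00 : `|Df 0| <= 2 * kp.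
  rewrite /Df kink0 mulr0 addr0 gtr0_norm//; exact: rho_0_le.
have Df0 : Df 0 ^+ 2 <= (2 * kp) ^+ 2.
  by rewrite -(real_normK (num_real (Df 0))) ler_pXn2r// nnegrE// mulr_ge0// ltW.
have M : `|Df c| <= 2 * kp + 2 * J.
  rewrite leNgt; apply/negP => lt; move: key.
  rewrite -(real_normK (num_real (Df c))); set M := `|Df c| in lt *.
  by have := kp0; nra.
have -> : r x - K x = Df x by rewrite /Df mulN1r.
by apply: le_trans M; apply: cmax; rewrite in_itv/= x0.
Qed.

(** Replacing [n] by [max c n] leaves the integrand unchanged on [[s, t]] and makes its coefficient
    continuous on the line. *)
Lemma Int_momentum_le (F g : R -> R) c s t : 0 < c -> continuous F -> locint g ->
  (forall x, s <= x <= t -> c <= n x) ->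
  (forall x, s <= x <= t -> `|F x / n x * w x| <= g x) ->
  `|Int s t (fun x => F x / n x * w x)| <= Int s t g.
Proof.
move=> c0 cF lg cn Fg; have cm := modsq_continuous H; have lw := locint_momentum H.
have GE x : s <= x <= t -> (Num.max c (n x))^-1 = (n x)^-1.
  by move=> /cn E; rewrite max_r.
rewrite (@Int_eq _ s t _ (fun x => F x * (Num.max c (n x))^-1 * w x)); last first.
  by move=> x /GE ->.
apply: Int_norm_le => //; last by move=> x xst; rewrite GE// Fg.
apply: locintM => //; apply: ctsM => //; apply: ctsV; last exact: cts_max.
by move=> x; rewrite gt_eqF// lt_max c0.
Qed.

Lemma momentum_ratio_le beta c t : 0 < beta -> 0 < c -> c <= n t ->
  (w t / n t) ^+ 2 / (2 * beta) <= (beta * c)^-1 * def t.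
Proof.
move=> b0 c0 cn; have nt := lt_le_trans c0 cn.
rewrite ler_pdivrMr ?mulr_gt0// expr_div_n ler_pdivrMr ?exprn_gt0//.
apply: (le_trans (momentum_defect _ _ _ _ kp0 t)).
have -> : (beta * c)^-1 * def t * (2 * beta) * n t ^+ 2 = 2 * n t * def t * (n t / c).
  by field; rewrite !gt_eqF.
by rewrite ler_peMr ?mulr_ge0 ?(ltW nt)// ler_pdivlMr// mul1r.
Qed.

Lemma phase_le beta c s t : 0 < beta -> 0 < c -> s <= t ->
  (forall x, s <= x <= t -> c <= n x) ->
  `|Int s t (fun x => w x / n x)| <= beta / 2 * (t - s) + (beta * c)^-1 * Int s t def.
Proof.
move=> b0 c0 st cn.
rewrite (@Int_eq _ s t _ (fun x => 1 / n x * w x)); last by move=> x _; rewrite mul1r mulrC.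
apply: (le_trans (@Int_momentum_le (fun=> 1)
  (fun x => beta / 2 + (beta * c)^-1 * def x) c s t _ _ _ _ _)) => //.
- exact: cts_cst.
- by apply: locintD; [exact: locint_cst|exact: locintZ].
- move=> x xst; rewrite mul1r mulrC; apply: (le_trans (norm_le_amgm _ b0)).
  by rewrite lerD2l; apply: momentum_ratio_le => //; exact: cn.
by rewrite IntD; [rewrite Int_cst// IntZ|exact: locint_cst|exact: locintZ].
Qed.

(** The factor [1 - n] is paid for by the energy, so in contrast with [phase_le] no term grows with
    [t - s]: the bound is usable up to infinity. *)
Lemma momentum_tail_le beta c s t : 0 < beta -> 0 < c -> s <= t ->
  (forall x, s <= x <= t -> c <= n x) ->
  `|Int s t (fun x => (1 - n x) / n x * w x)| <=
    2 * beta * Int s t e + (beta * c)^-1 * Int s t def.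
Proof.
move=> b0 c0 st cn; have le_ := locint_energy H; have cm := modsq_continuous H.
apply: (le_trans (@Int_momentum_le (fun x => 1 - n x)
  (fun x => 2 * beta * e x + (beta * c)^-1 * def x) c s t _ _ _ _ _)) => //.
- by cts.
- by apply: locintD; exact: locintZ.
- move=> x xst; have := cn x xst => cx.
  have M := momentum_ratio_le b0 c0 cx.
  have -> : (1 - n x) / n x * w x = (1 - n x) * (w x / n x) by ring.
  have A : `|(1 - n x) * (w x / n x)| <= beta * (1 - n x) ^+ 2 / 2 + (w x / n x) ^+ 2 / (2 * beta).
    exact: norm_mul_amgm.
  have B : (1 - n x) ^+ 2 / 4 <= e x.
    by rewrite /energy_density; have := addr_ge0 (sqr_ge0 (a' x)) (sqr_ge0 (b' x)); lra.
  have : beta * ((1 - n x) ^+ 2 / 4) <= beta * e x by rewrite ler_pM2l.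
  by lra.
by rewrite IntD; [rewrite !IntZ|exact: locintZ|exact: locintZ].
Qed.

Lemma momentum_renormalized c s t : 0 < c -> (forall x, s <= x <= t -> c <= n x) ->
  Int s t w - Int s t (fun x => w x / n x) = - Int s t (fun x => (1 - n x) / n x * w x).
Proof.
move=> c0 cn; have cm := modsq_continuous H; have lw := locint_momentum H.
pose G x := (Num.max c (n x))^-1.
have GE x : s <= x <= t -> G x = (n x)^-1 by move=> /cn E; rewrite /G max_r.
have lG : locint (fun x => G x * w x).
  apply: locintM => //; apply: ctsV; last exact: cts_max.
  by move=> x; rewrite gt_eqF// lt_max c0.
rewrite (@Int_eq _ s t (fun x => w x / n x) (fun x => G x * w x)); last first.
  by move=> x /GE ->; rewrite mulrC.
rewrite (@Int_eq _ s t (fun x => (1 - n x) / n x * w x) (fun x => G x * w x - w x)).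
  by rewrite (@IntB _ s t (fun x => G x * w x) w)// opprB.
move=> x xst; rewrite GE//; have nx := lt_le_trans c0 (cn x xst).
by field; rewrite gt_eqF.
Qed.

(** Close to the near zero of [v] the phase gives no control; there [w] itself is bounded through
    the defect, with no division by [n]. *)
Lemma momentum_short_le beta s t : 0 < beta -> s <= t ->
  (forall x, s <= x <= t -> n x <= 2) ->
  `|Int s t w| <= beta / 2 * (t - s) + 2 / beta * Int s t def.
Proof.
move=> b0 st n2.
apply: (@le_trans _ _ (Int s t (fun x => beta / 2 + 2 / beta * def x))).
  apply: Int_norm_le.
  - exact: locint_momentum H.
  - by apply: locintD; [exact: locint_cst|exact: locintZ].
  move=> x /n2 nx; apply: (le_trans (norm_le_amgm _ b0)); rewrite lerD2l.
  rewrite ler_pdivrMr ?mulr_gt0//.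
  have -> : 2 / beta * def x * (2 * beta) = 2 * 2 * def x by field; rewrite gt_eqF.
  apply: (le_trans (momentum_defect _ _ _ _ kp0 x)).
  by rewrite ler_wpM2r// ler_pM2l.
by rewrite IntD; [rewrite Int_cst// IntZ|exact: locint_cst|exact: locintZ].
Qed.

Lemma direction_lipschitz c s t : 0 < c -> s <= t ->
  (forall x, s <= x <= t -> c <= n x) ->
  let th := Int s t (fun x => w x / n x) in
  `|a t / Num.sqrt (n t) - a s / Num.sqrt (n s)| <= 2 * `|th| /\
  `|b t / Num.sqrt (n t) - b s / Num.sqrt (n s)| <= 2 * `|th|.
Proof.
move=> c0 st cn th; case: (H) => pa pb _.
have [m m0 /=] := polar_lift pa pb c0 st cn; rewrite -/th => -[aE bE].
have ns : 0 < n s by apply: (lt_le_trans c0); apply: cn; rewrite lexx.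
pose q := Num.sqrt (n s); have q0 : 0 < q by rewrite sqrtr_gt0.
have qE : q ^+ 2 = a s ^+ 2 + b s ^+ 2 by rewrite sqr_sqrtr// ltW.
have cs := cos2Dsin2 th.
have -> : Num.sqrt (n t) = m * q.
  have -> : n t = (m * q) ^+ 2.
    transitivity (m ^+ 2 * (a s ^+ 2 + b s ^+ 2) * (cos th ^+ 2 + sin th ^+ 2)).
      by rewrite /modsq aE bE; ring.
    by rewrite cs mulr1 exprMn qE.
  by rewrite sqrtr_sqr gtr0_norm// mulr_gt0.
rewrite -/q aE bE.
have c1 : `|cos th - 1| <= `|th| by have := cos_lipschitz th 0; rewrite cos0 subr0.
have s1 : `|sin th| <= `|th| by have := sin_lipschitz th 0; rewrite sin0 !subr0.
have qn z : z ^+ 2 <= q ^+ 2 -> `|z / q| <= 1.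
  move=> zq; rewrite normrM normfV (gtr0_norm q0) ler_pdivrMr// mul1r.
  by rewrite -(@ler_pXn2r _ 2) ?nnegrE ?(ltW q0)// real_normK ?num_real.
have A : `|a s / q| <= 1 by apply: qn; rewrite qE lerDl sqr_ge0.
have B : `|b s / q| <= 1 by apply: qn; rewrite qE lerDr sqr_ge0.
have est x y : `|x| <= 1 -> `|y| <= 1 -> `|(cos th - 1) * x + sin th * y| <= 2 * `|th|.
  move=> x1 y1; apply: (le_trans (ler_normD _ _)); rewrite !normrM mulr2n mulrDl !mul1r.
  by apply: lerD; rewrite -[leRHS]mulr1; exact: ler_pM.
have mz : m != 0 by rewrite gt_eqF. 
have qz : q != 0 by rewrite gt_eqF.
split.
  have -> : m * (cos th * a s - sin th * b s) / (m * q) - a s / q =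
    (cos th - 1) * (a s / q) + sin th * (- (b s / q)) by field; rewrite qz.
  by apply: est => //; rewrite normrN.
have -> : m * (sin th * a s + cos th * b s) / (m * q) - b s / q =
    (cos th - 1) * (b s / q) + sin th * (a s / q) by field; rewrite qz.
exact: est.
Qed.

(** Closeness to the kink deteriorates as the window grows; this bound does not. The energy being
    nonnegative, [Int_defect] shows that [profile (rho)] loses at most [sqrt 2 d] after 1. *)
Lemma rho_far y : 1 <= y -> profile kp (r 1) - s2 * d <= 2 * r y.
Proof.
move=> y1; have s0 := @sqrt2_gt0 R.
apply: le_trans (profile_le kp0 (ltW (r0 y)) kp1).
have Dy : Int 1 y def <= d.
  apply: le_trans (D (_ : 0 <= y)); last lra.
  by apply: Int_sub => //; lra.
have E : 0 <= Int 1 y e by apply: Int_ge0 => t _; exact: energy_density_ge0.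
have := Int_defect H kp0 y1 => I.
have : s2 * ((profile kp (r y) - profile kp (r 1)) / s2) = profile kp (r y) - profile kp (r 1).
  by field; rewrite gt_eqF.
set P := _ / s2 in I *.
have : s2 * (- P) <= s2 * d by rewrite ler_pM2l//; lra.
by lra.
Qed.

End right_half_line.

(** * Choice of constants and the limit on the right half line *)

Section right_half_limit.
Context {R : realType}.
Notation K := (@kink R).
Notation s2 := (Num.sqrt 2 : R).

(** The value [t / (8 L)] of the Young parameter turns the term proportional to [L] into [t / 4] and
    leaves the error [16 L d / t]. *)
Lemma window_error_le (L t kp d : R) : 1 <= L -> 0 < t -> t <= 1 -> 0 < kp -> 0 <= d ->
  L * kp <= t ^+ 2 / 64 -> L * d <= t ^+ 2 / 64 ->
  2 * kp + 2 * (L * (kp ^+ 2 + t / (8 * L)) + d / (t / (8 * L))) <= t.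
Proof.
move=> L1 t0 t1 kp0 d0 Lk Ld; have L0 : 0 < L by lra.
have -> : 2 * kp + 2 * (L * (kp ^+ 2 + t / (8 * L)) + d / (t / (8 * L))) =
    2 * kp + 2 * (L * kp * kp) + t / 4 + 16 * (L * d / t).
  by field; rewrite !gt_eqF.
have tt : t ^+ 2 <= t by rewrite expr2 ger_pMl.
have k1 : kp <= L * kp by rewrite ler_peMl// ltW.
have kl : L * kp * kp <= L * kp by rewrite ger_pMr ?mulr_gt0//; lra.
have dt : L * d / t <= t / 64 by rewrite ler_pdivrMr//; lra.
by lra.
Qed.

Lemma phase_error_le (L t c d x : R) : 1 <= L -> 0 < t -> 0 < c -> x <= L ->
  L * d <= t ^+ 2 * c / 512 ->
  t / (16 * L) / 2 * x + (t / (16 * L) * c)^-1 * d <= t / 16.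
Proof.
move=> L1 t0 c0 xL Ld; have L0 : 0 < L by lra.
have A : t / (16 * L) / 2 * x <= t / 32.
  have -> : t / 32 = t / (16 * L) / 2 * L by field; rewrite !gt_eqF.
  by rewrite ler_pM2l// !divr_gt0// mulr_gt0.
have -> : (t / (16 * L) * c)^-1 * d = 16 * (L * d) / (t * c) by field; rewrite !gt_eqF.
have : 16 * (L * d) / (t * c) <= t / 32.
  by rewrite ler_pdivrMr ?mulr_gt0//; move: Ld; rewrite expr2; lra.
by lra.
Qed.

Lemma sqrt_modsq_rho (a b : R -> R) kp t : 0 < kp ->
  `|a t| <= rho a b kp t /\ `|b t| <= rho a b kp t /\
  Num.sqrt (modsq a b t) <= rho a b kp t <= Num.sqrt (modsq a b t) + kp.
Proof.
move=> kp0; have r0 := rho_gt0 a b kp0 t; have rr := rho_sqr a b kp t.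
have n0 := modsq_ge0 a b t; have q0 := sqrtr_ge0 (modsq a b t).
have qq : Num.sqrt (modsq a b t) ^+ 2 = modsq a b t by rewrite sqr_sqrtr.
have k2 : 0 < kp ^+ 2 by rewrite exprn_gt0.
have sq x : 0 <= x -> x ^+ 2 <= rho a b kp t ^+ 2 -> x <= rho a b kp t.
  by move=> x0; rewrite ler_pXn2r// nnegrE// ltW.
have a2 := sqr_ge0 (a t); have b2 := sqr_ge0 (b t).
split; first by apply: sq => //; rewrite real_normK ?num_real// rr /modsq; lra.
split; first by apply: sq => //; rewrite real_normK ?num_real// rr /modsq; lra.
apply/andP; split; first by apply: sq => //; rewrite rr qq; lra.
rewrite -(@ler_pXn2r _ 2)// ?nnegrE ?(ltW r0) ?addr_ge0 ?(ltW kp0)//.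
by rewrite rr sqrrD qq; have := mulr_ge0 q0 (ltW kp0); lra.
Qed.

Section estimates.
Variables (a b a' b' : R -> R) (kp d : R).
Notation n := (modsq a b).
Notation w := (momentum_density a b a' b').
Notation e := (energy_density a b a' b').
Notation r := (rho a b kp).
Notation def := (defect a b a' b' kp).
Hypotheses (H : H1loc a b a' b') (kp_gt0 : 0 < kp).
Hypothesis D : forall y, 0 <= y -> Int 0 y def <= d.

Lemma Int_defect_sub s t : 0 <= s -> s <= t -> Int s t def <= d.
Proof.
move=> s0 st; apply: le_trans (D (le_trans s0 st)).
by apply: Int_sub => //; [exact: locint_defect|exact: defect_ge0].
Qed.

(** At 1, [profile >= r 1 (1 - 25/48) >= K1 / 3]; the loss [sqrt 2 d <= K1 / 12] leaves
    [r y >= K1 / 8], and [kp <= K1 / 16] allows the return from [rho] to the modulus. *)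
Lemma far_modulus K1 y : kp <= 1 -> 0 < K1 -> kp <= K1 / 16 -> d <= K1 / 24 ->
  3 / 4 * K1 <= r 1 -> r 1 <= 5 / 4 -> 1 <= y -> K1 ^+ 2 / 128 <= n y.
Proof.
move=> kp1 K10 kpK dK r1a r1b y1; have kp0 := kp_gt0.
have r0 t : 0 < r t by exact: rho_gt0.
have F := rho_far H kp0 kp1 D y1.
have d0 : 0 <= d by have := D (lexx 0); rewrite Int_xx.
have P : K1 / 3 <= profile kp (r 1).
  have rc : r 1 ^+ 3 <= r 1 * (25 / 16).
    rewrite exprS ler_pM2l//.
    have : r 1 ^+ 2 <= (5 / 4) ^+ 2 by rewrite ler_pXn2r ?nnegrE ?(ltW (r0 1))//; lra.
    by lra.
  by have := mulr_ge0 (sqr_ge0 kp) (ltW (r0 1)); rewrite /profile; lra.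
have sd : s2 * d <= 2 * d.
  apply: ler_wpM2r => //; have := @sqrt2_sqr R; have := @sqrt2_gt0 R.
  by move: (Num.sqrt 2) => s s0 ss; nra.
have ry : K1 / 8 <= r y by lra.
have ry2 : (K1 / 8) ^+ 2 <= r y ^+ 2 by rewrite ler_pXn2r ?nnegrE ?(ltW (r0 y))//; lra.
have kp2 : kp ^+ 2 <= (K1 / 16) ^+ 2 by rewrite ler_pXn2r ?nnegrE ?(ltW kp0)//; lra.
by move: ry2 kp2; rewrite rho_sqr; have := sqr_ge0 K1; lra.
Qed.

Lemma tail_small tau c y : (forall y, 0 <= y -> Int 0 y e <= 2) ->
  0 < tau -> 0 < c -> d <= tau ^+ 2 * c / 16 ->
  (forall x, 1 <= x -> c <= n x) -> 1 <= y ->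
  `|Int 1 y w - Int 1 y (fun x => w x / n x)| <= tau.
Proof.
move=> E tau0 c0 dc far y1; have b0 : 0 < tau / 8 by lra.
have cy x : 1 <= x <= y -> c <= n x by move=> /andP[x_1 _]; exact: far.
rewrite (momentum_renormalized H c0 cy) normrN.
apply: (le_trans (momentum_tail_le H kp_gt0 b0 c0 y1 cy)).
have E1 : Int 1 y e <= 2.
  apply: le_trans (E y (le_trans ler01 y1)).
  by apply: Int_sub => //; [exact: locint_energy H|exact: energy_density_ge0].
have D1 := Int_defect_sub ler01 y1.
have A : 2 * (tau / 8) * Int 1 y e <= 2 * (tau / 8) * 2 by rewrite ler_pM2l//; lra.
have B : (tau / 8 * c)^-1 * Int 1 y def <= tau / 2.
  by rewrite mulrC ler_pdivrMr ?mulr_gt0//; move: D1 dc; lra.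
by move: A B; lra.
Qed.

Lemma short_small tau : 0 < tau -> d <= tau ^+ 2 / 4 ->
  (forall x, 0 <= x <= 1 -> n x <= 2) -> `|Int 0 1 w| <= tau.
Proof.
move=> tau0 dt n2; apply: (le_trans (momentum_short_le H kp_gt0 tau0 ler01 n2)).
have D1 := D ler01.
have : 2 / tau * Int 0 1 def <= tau / 2.
  by rewrite mulrAC ler_pdivrMr//; move: D1 dt; lra.
by rewrite subr0 mulr1; lra.
Qed.

Lemma direction_small L tau x1 c x : 1 <= L -> 0 < tau -> 0 < x1 -> x1 <= 1 -> 0 < c ->
  (forall x, x1 <= x <= L -> c <= n x) -> L * d <= tau ^+ 2 * c / 512 -> x1 <= x <= L ->
  `|a x / Num.sqrt (n x) - a 1 / Num.sqrt (n 1)| <= tau / 8 /\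
  `|b x / Num.sqrt (n x) - b 1 / Num.sqrt (n 1)| <= tau / 8.
Proof.
move=> L1 tau0 x10 x11 c0 low Ld /andP[xx xL].
have b0 : 0 < tau / (16 * L) by rewrite divr_gt0// mulr_gt0//; lra.
have phase s t : x1 <= s -> s <= t -> t <= L ->
    `|Int s t (fun x => w x / n x)| <= tau / 16 /\ forall x, s <= x <= t -> c <= n x.
  move=> xs st tL; have cst y : s <= y <= t -> c <= n y.
    by move=> /andP[sy yt]; apply: low; rewrite (le_trans xs sy) (le_trans yt tL).
  split=> //; apply: (le_trans (phase_le H kp_gt0 b0 c0 st cst)).
  have tsL : t - s <= L by lra.
  apply: le_trans (phase_error_le L1 tau0 c0 tsL Ld).
  rewrite lerD2l ler_pM2l; last by rewrite invr_gt0 mulr_gt0.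
  by apply: Int_defect_sub => //; lra.
have [x_1|/ltW x_1] := leP x 1.
  have [P cs] := phase x 1 xx x_1 L1.
  have [A B] := direction_lipschitz H c0 x_1 cs.
  by rewrite distrC (distrC (b x / _)); move: A B P; lra.
have [P cs] := phase 1 x x11 x_1 xL.
have [A B] := direction_lipschitz H c0 x_1 cs.
by move: A B P; lra.
Qed.

End estimates.

Lemma position_small (z ee q k r kp tau : R) : `|ee| <= 1 -> `|z| <= r -> 0 <= k <= 1 ->
  `|r - k| <= tau / 32 -> q <= r <= q + kp -> kp <= tau / 32 -> 0 < tau -> tau <= 1 ->
  k <= tau / 8 \/ (0 < q /\ `|z / q - ee| <= tau / 8) -> `|z - ee * k| <= tau.
Proof.
move=> ee1 zr k01 rk qr kpt t0 t1; have {}rk : - (tau / 32) <= r - k <= tau / 32 by rewrite -ler_norml.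
have [k0 k1] : 0 <= k /\ k <= 1 by lra.
have eK : `|ee * k| <= k by rewrite normrM (ger0_norm k0) ler_piMl.
case=> [kt|[q0 Hz]]; first by have := ler_normB z (ee * k); lra.
have -> : z - ee * k = q * (z / q - ee) + ee * (q - k) by field; rewrite gt_eqF.
apply: (le_trans (ler_normD _ _)); rewrite !normrM (gtr0_norm q0).
have A : q * `|z / q - ee| <= 2 * (tau / 8).
  by apply: ler_pM => //; [exact: ltW|lra].
have B : `|ee| * `|q - k| <= 1 * (tau / 16).
  by apply: ler_pM => //; rewrite ler_norml; lra.
by lra.
Qed.

(** All smallness conditions follow from the single choice [L dl = tau^2 Kx^2 / 2048]. In the
    application [Kx = K (tau / 8)] is the least kink value at which a direction is compared, and
    [K1 = K 1]. *)
Lemma window_constants (L tau Kx K1 dl kp d : R) :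
  1 <= L -> 0 < tau -> tau <= 1 -> 0 < Kx -> Kx <= tau / 8 -> Kx <= K1 -> K1 < 1 ->
  L * dl = tau ^+ 2 * Kx ^+ 2 / 32 / 64 -> 0 < kp -> kp <= dl -> 0 <= d -> d <= dl ->
  [/\ kp <= 1, kp <= tau / 32, kp <= K1 / 16, d <= K1 / 24 & kp ^+ 2 <= Kx ^+ 2 / 16] /\
  [/\ L * kp <= (Kx / 4) ^+ 2 / 64, L * d <= (Kx / 4) ^+ 2 / 64,
      L * d <= tau ^+ 2 * (Kx ^+ 2 / 4) / 512, d <= tau ^+ 2 * (K1 ^+ 2 / 128) / 16 &
      d <= tau ^+ 2 / 4].
Proof.
move=> L1 tau0 tau1 Kx0 Kxle KxK1 K1lt Ldl kp0 kpdl d0 ddl.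
have L0 : 0 < L by lra.
have Kx2 : 0 < Kx ^+ 2 by rewrite exprn_gt0.
have tau2 : 0 < tau ^+ 2 by rewrite exprn_gt0.
have tau21 : tau ^+ 2 <= 1 by rewrite exprn_ile1// ltW.
have Kxx : Kx ^+ 2 <= Kx / 8 by rewrite expr2 ler_pM2l//; lra.
have dlL : dl <= L * dl by rewrite ler_peMl//; lra.
have tK : tau ^+ 2 * Kx ^+ 2 <= Kx ^+ 2 by rewrite ler_piMl// ltW.
have tK' : tau ^+ 2 * Kx ^+ 2 <= tau ^+ 2.
  by rewrite ler_piMr ?(ltW tau2)// exprn_ile1 ?(ltW Kx0)//; lra.
have tK1 : tau ^+ 2 * Kx ^+ 2 <= tau ^+ 2 * K1 ^+ 2.
  by rewrite ler_pM2l// ler_pXn2r ?nnegrE ?(ltW Kx0)// (le_trans (ltW Kx0)).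
have dlK : dl <= Kx / 32 / 64 by lra.
have Lk : L * kp <= L * dl by rewrite ler_pM2l.
have Ld : L * d <= L * dl by rewrite ler_pM2l.
have kpK : kp ^+ 2 <= (Kx / 4) ^+ 2 by rewrite ler_pXn2r ?nnegrE//; lra.
by split; split; lra.
Qed.

Lemma rho_lower_le (Kx kp r k n : R) : `|r - k| <= Kx / 4 -> 0 < Kx -> Kx <= k -> 0 < r ->
  r ^+ 2 = n + kp ^+ 2 -> kp ^+ 2 <= Kx ^+ 2 / 16 -> Kx ^+ 2 / 4 <= n.
Proof.
rewrite ler_norml => rk Kx0 Kk r0 rr kpK.
have : (3 / 4 * Kx) ^+ 2 <= r ^+ 2 by rewrite ler_pXn2r ?nnegrE//; lra.
by have := sqr_ge0 Kx; lra.
Qed.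

Lemma rho_upper_le (Kx kp r k n : R) : `|r - k| <= Kx / 4 -> Kx <= 1 -> k <= 1 -> 0 < r ->
  r ^+ 2 = n + kp ^+ 2 -> r <= 5 / 4 /\ n <= 2.
Proof.
rewrite ler_norml => rk Kx1 k1 r0 rr; have r5 : r <= 5 / 4 by lra.
have : r ^+ 2 <= (5 / 4) ^+ 2 by rewrite ler_pXn2r ?nnegrE//; lra.
by have := sqr_ge0 kp; split => //; lra.
Qed.

(** Three ranges with different reasons. On [[0, tau / 8]] the kink is small, hence so is [v]. On
    [[tau / 8, L]] the modulus follows the kink and the direction stays close to that at 1. Beyond
    1, without a limit of length, the modulus keeps a lower bound and the momentum is carried by the
    phase. [dl] depends on [L] and [tau] alone. *)
Lemma right_half_limit (L tau : R) : 1 <= L -> 0 < tau -> tau <= 1 ->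
  exists2 dl : R, 0 < dl & forall (a b a' b' : R -> R) (kp d : R),
    H1loc a b a' b' -> 0 < kp -> kp <= dl -> modsq a b 0 <= kp ^+ 2 ->
    (forall y, 0 <= y -> Int 0 y (defect a b a' b' kp) <= d) -> d <= dl ->
    (forall y, 0 <= y -> Int 0 y (energy_density a b a' b') <= 2) ->
    let n := modsq a b in let w := momentum_density a b a' b' in
    [/\ forall x, 0 <= x <= L ->
          `|a x - a 1 / Num.sqrt (n 1) * K x| <= tau /\
          `|b x - b 1 / Num.sqrt (n 1) * K x| <= tau,
        exists2 c, 0 < c & forall y, 1 <= y -> c <= n y,
        forall y, 1 <= y -> `|Int 1 y w - Int 1 y (fun x => w x / n x)| <= tau &
        `|Int 0 1 w| <= tau].
Proof.
move=> L1 tau0 tau1; have L0 : 0 < L by lra.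
have [x1 x1E] : exists z, z = tau / 8 by exists (tau / 8).
have x10 : 0 < x1 by lra.
have x11 : x1 <= 1 by lra.
have [Kx KxE] : exists z, z = K x1 by exists (K x1).
have [K1 K1E] : exists z, z = K 1 by exists (K 1).
have Kx0 : 0 < Kx by rewrite KxE; exact: kink_gt0.
have Kxle : Kx <= tau / 8 by rewrite KxE -x1E; apply: kink_le; exact: ltW.
have KxK1 : Kx <= K1 by rewrite KxE K1E; exact: kink_mono.
have K1lt : K1 < 1 by have : -1 < K 1 < 1 := kink_bound 1; rewrite -K1E; lra.
have Kx1 : Kx <= 1 by lra.
have Kxt : Kx / 4 <= tau / 32 by lra.
have Kx40 : 0 < Kx / 4 by lra.
have Kx41 : Kx / 4 <= 1 by lra.
have K10 : 0 < K1 by lra.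
have b0 : 0 < Kx / 4 / (8 * L) by apply: divr_gt0; [lra|rewrite mulr_gt0].
have c10 : 0 < Kx ^+ 2 / 4 by rewrite divr_gt0// exprn_gt0.
have c20 : 0 < K1 ^+ 2 / 128 by rewrite divr_gt0// exprn_gt0.
have r1lo (r : R) : `|r - K1| <= Kx / 4 -> 3 / 4 * K1 <= r by rewrite ler_norml; lra.
have [dl dl0 Ldl] : exists2 dl, 0 < dl & L * dl = tau ^+ 2 * Kx ^+ 2 / 32 / 64.
  exists (tau ^+ 2 * Kx ^+ 2 / 32 / 64 / L); first by rewrite !divr_gt0// mulr_gt0// exprn_gt0.
  by field; rewrite gt_eqF.
exists dl => // a b a' b' kp d H kp0 kpdl n0 D ddl E n w.
have d0 : 0 <= d by have := D 0 (lexx 0); rewrite Int_xx.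
have [[kp1 kpt kpK1 dK1 kpKx] [Lk Ld Lph dtail dshort]] :=
  window_constants L1 tau0 tau1 Kx0 Kxle KxK1 K1lt Ldl kp0 kpdl d0 ddl.
pose r := rho a b kp.
have close x : 0 <= x <= L -> `|r x - K x| <= Kx / 4.
  move=> xL; apply: (le_trans (rho_close_kink H kp0 n0 D b0 xL)).
  exact: window_error_le.
have r0 t : 0 < r t by exact: rho_gt0.
have rr t : r t ^+ 2 = n t + kp ^+ 2 by exact: rho_sqr.
have low x : x1 <= x <= L -> Kx ^+ 2 / 4 <= n x.
  move=> /andP[xx xL]; have x0 := le_trans (ltW x10) xx.
  have rk : `|r x - K x| <= Kx / 4 by apply: close; rewrite x0.
  have Kxm : Kx <= K x by rewrite KxE; exact: kink_mono.
  exact: (rho_lower_le rk Kx0 Kxm (r0 x) (rr x) kpKx).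
have n1 : 0 < n 1 by apply: (lt_le_trans c10); apply: low; rewrite x11.
have q1 : 0 < Num.sqrt (n 1) by rewrite sqrtr_gt0.
have e1 z : z ^+ 2 <= n 1 -> `|z / Num.sqrt (n 1)| <= 1.
  move=> zn; rewrite normrM normfV (gtr0_norm q1) ler_pdivrMr// mul1r.
  rewrite -(@ler_pXn2r _ 2) ?nnegrE ?(ltW q1)//.
  by rewrite real_normK ?num_real// sqr_sqrtr// ltW.
have up x : 0 <= x <= 1 -> r x <= 5 / 4 /\ n x <= 2.
  move=> /andP[x0 x_1]; have [_ k1] := andP (kink_ge0_le1 x0).
  have rk : `|r x - K x| <= Kx / 4 by apply: close; rewrite x0 (le_trans x_1 L1).
  exact: (rho_upper_le rk Kx1 k1 (r0 x) (rr x)).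
have r1b : r 1 <= 5 / 4 by have [] := up 1; rewrite ?ler01 ?lexx.
have r1a : 3 / 4 * K1 <= r 1 by apply: r1lo; rewrite K1E; apply: close; rewrite ler01.
have far y : 1 <= y -> K1 ^+ 2 / 128 <= n y.
  exact: (far_modulus H kp0 D kp1 K10).
split.
- move=> x xL; have [za [zb qr]] := sqrt_modsq_rho a b x kp0.
  have [x0 xL'] := andP xL; have k01 := kink_ge0_le1 x0.
  have rk : `|rho a b kp x - K x| <= tau / 32 by apply: le_trans Kxt; exact: close.
  have alt : K x <= tau / 8 \/ x1 <= x <= L.
    have [xx|/ltW xx] := leP x x1; last by right; apply/andP.
    by left; rewrite -x1E; apply: le_trans xx; exact: kink_le.
  have dir : x1 <= x <= L -> 0 < Num.sqrt (n x) /\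
    `|a x / Num.sqrt (n x) - a 1 / Num.sqrt (n 1)| <= tau / 8 /\
    `|b x / Num.sqrt (n x) - b 1 / Num.sqrt (n 1)| <= tau / 8.
    move=> xx; split; first by rewrite sqrtr_gt0; exact: (lt_le_trans c10 (low x xx)).
    exact: (direction_small H kp0 D L1 tau0 x10 x11 c10 low).
  split.
    apply: (position_small _ za k01 rk qr kpt tau0 tau1); first by apply: e1; rewrite lerDl sqr_ge0.
    by case: alt => [?|/dir[? [? _]]]; [left|right].
  apply: (position_small _ zb k01 rk qr kpt tau0 tau1); first by apply: e1; rewrite lerDr sqr_ge0.
  by case: alt => [?|/dir[? [_ ?]]]; [left|right].
- by exists (K1 ^+ 2 / 128).
- by move=> y; exact: (tail_small H kp0 D E tau0 c20).
- by apply: (short_small H kp0 D tau0 dshort) => x /up[].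
Qed.

End right_half_limit.

(** * Gluing the two half lines *)

Section two_sided_limit.
Context {R : realType}.
Notation K := (@kink R).

Section reflection.
Variables (a b a' b' : R -> R).
Notation ra := (fun t => a (- t)).
Notation rb := (fun t => b (- t)).
Notation ra' := (fun t => - a' (- t)).
Notation rb' := (fun t => - b' (- t)).

Lemma H1loc_opp : H1loc a b a' b' -> H1loc ra rb ra' rb'.
Proof.
move=> [pa pb l]; split; [exact: prim_opp|exact: prim_opp|].
by have := locint_opp l; under eq_fun do rewrite -sqrrN -[X in _ + X]sqrrN.
Qed.

Lemma energy_density_opp t : energy_density ra rb ra' rb' t = energy_density a b a' b' (- t).
Proof. by rewrite /energy_density /modsq !sqrrN. Qed.

Lemma momentum_density_opp t : momentum_density ra rb ra' rb' t = - momentum_density a b a' b' (- t).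
Proof. by rewrite /momentum_density; ring. Qed.

Lemma energy_le_opp E : H1loc a b a' b' -> energy_le a b a' b' E -> energy_le ra rb ra' rb' E.
Proof.
move=> H EH x y xy.
rewrite (@Int_eq _ _ _ _ (fun t => energy_density a b a' b' (- t))); last first.
  by move=> t _; exact: energy_density_opp.
rewrite Int_opp; last exact: locint_energy H.
by apply: EH; rewrite lerN2.
Qed.

Lemma modulus_tails_opp : modulus_tails a b -> modulus_tails ra rb.
Proof.
move=> tl R1 eta eta0; have [x [y [xR yR nx ny]]] := tl R1 eta eta0.
by exists (- y), (- x); split; rewrite /modsq ?opprK//; lra.
Qed.

Lemma Int_momentum_opp x y : H1loc a b a' b' ->
  Int x y (momentum_density ra rb ra' rb') = - Int (- y) (- x) (momentum_density a b a' b').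
Proof.
move=> H; have lw := locint_momentum H.
rewrite -(Int_opp _ _ lw) -[RHS]mulN1r -IntZ; last exact: locint_opp.
by apply: Int_eq => t _; rewrite momentum_density_opp mulN1r.
Qed.

End reflection.

Lemma kink_energy_le1 : kink_energy <= 1 :> R.
Proof.
rewrite /kink_energy; have := @sqrt2_sqr R; have := @sqrt2_gt0 R.
by move: (Num.sqrt 2) => s s0 ss; nra.
Qed.

Lemma momentum_near_pi2_tails (a b a' b' : R -> R) eps :
  momentum_near_pi2 a b a' b' eps -> modulus_tails a b.
Proof.
move=> M R1 eta eta0; have [x [y [? ? ? ? _]]] := M R1 eta eta0.
by exists x, y; split.
Qed.

Lemma unit_vector (a b : R -> R) t : 0 < modsq a b t ->
  (a t / Num.sqrt (modsq a b t)) ^+ 2 + (b t / Num.sqrt (modsq a b t)) ^+ 2 = 1.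
Proof.
move=> n0; rewrite !expr_div_n -mulrDl sqr_sqrtr ?(ltW n0)// divff//.
by rewrite gt_eqF.
Qed.

Lemma phase_sum_le (A B C D t tr phi P k eps tau : R) :
  `|2^-1 * (A - B + C - D) - 2^-1 * (phi + t - tr) - P / 2 - k| < eps ->
  `|A - t| <= tau -> `|B - tr| <= tau -> `|C| <= tau -> `|D| <= tau ->
  `|phi + P + 2 * k| <= 2 * eps + 4 * tau.
Proof. by rewrite ltr_norml !ler_norml; lra. Qed.

(** The phase is lifted only for [|t| >= 1]; across the centre it is replaced by the angle [phi]
    from the direction at -1 to that at 1. The lifted parts cancel against the integral of [w] up to
    [tau], and [w] contributes little on [[-1, 1]], so a momentum near [pi / 2] says that [phi] is
    near [pi] modulo [2 pi]. The left-hand side equals [2 (1 + cos phi)]. *)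
Lemma opposite_directions (a b a' b' : R -> R) eps tau c cr :
  H1loc a b a' b' -> momentum_near_pi2 a b a' b' eps ->
  let n := modsq a b in let w := momentum_density a b a' b' in
  let ra := fun t => a (- t) in let rb := fun t => b (- t) in
  let rw := momentum_density ra rb (fun t => - a' (- t)) (fun t => - b' (- t)) in
  0 < c -> (forall y, 1 <= y -> c <= n y) ->
  0 < cr -> (forall y, 1 <= y -> cr <= n (- y)) ->
  (forall y, 1 <= y -> `|Int 1 y w - Int 1 y (fun x => w x / n x)| <= tau) ->
  (forall y, 1 <= y -> `|Int 1 y rw - Int 1 y (fun x => rw x / n (- x))| <= tau) ->
  `|Int 0 1 w| <= tau -> `|Int 0 1 rw| <= tau ->
  (a 1 / Num.sqrt (n 1) + a (-1) / Num.sqrt (n (-1))) ^+ 2 +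
  (b 1 / Num.sqrt (n 1) + b (-1) / Num.sqrt (n (-1))) ^+ 2 <= 4 * eps + 8 * tau.
Proof.
move=> H M n w ra rb rw c0 cn cr0 crn T Tr S Sr.
set q := Num.sqrt (n 1); set qr := Num.sqrt (n (-1)).
have n1 : 0 < n 1 by apply: (lt_le_trans c0); exact: cn.
have nr1 : 0 < n (-1) by apply: (lt_le_trans cr0); exact: crn.
have q0 : 0 < q by rewrite sqrtr_gt0.
have qr0 : 0 < qr by rewrite sqrtr_gt0.
have U : (a 1 / q) ^+ 2 + (b 1 / q) ^+ 2 = 1 by exact: unit_vector.
have Ur : (a (-1) / qr) ^+ 2 + (b (-1) / qr) ^+ 2 = 1 by exact: unit_vector.
pose re := a 1 / q * (a (-1) / qr) + b 1 / q * (b (-1) / qr).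
pose im := b 1 / q * (a (-1) / qr) - a 1 / q * (b (-1) / qr).
have reim : re ^+ 2 + im ^+ 2 = 1.
  transitivity (((a 1 / q) ^+ 2 + (b 1 / q) ^+ 2) * ((a (-1) / qr) ^+ 2 + (b (-1) / qr) ^+ 2)).
    by rewrite /re /im; ring.
  by rewrite U Ur mulr1.
have [phi _ [cphi sphi]] := cos_sin_surj reim.
have [x [y [x1 y1 _ _ Harg]]] := M 1 1 ltr01.
have N11 : -1 <= 1 :> R by exact: le_trans (lerN10 R) ler01.
have xle1 : x <= 1 by exact: le_trans x1 N11.
have z1 : 1 <= - x by rewrite lerNr.
have [pa pb _] := H; have [pra prb _] := H1loc_opp H.
have [m m0 /=] := polar_lift pa pb c0 y1 (fun t ty => cn t (proj1 (andP ty))).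
set th := Int 1 y _ => -[ayE byE].
have [mr mr0 /=] := polar_lift pra prb cr0 z1 (fun t ty => crn t (proj1 (andP ty))).
rewrite !opprK; set thr := Int 1 (- x) _ => -[axE bxE].
have [|k Hk] := Harg (phi + th - thr).
  exists (m * mr * (q * qr)); first by rewrite !mulr_gt0.
  rewrite [cos (_ - _)]cosB [sin (_ - _)]sinB cosD sinD cphi sphi ayE byE axE bxE /re /im.
  by split; field; rewrite !gt_eqF.
have lw := locint_momentum H.
have wE : Int x y w = Int 1 y w - Int 1 (- x) rw + Int 0 1 w - Int 0 1 rw.
  have E1 : Int 1 (- x) rw = - Int x (-1) w by rewrite /rw Int_momentum_opp// opprK.
  have E2 : Int 0 1 rw = - Int (-1) 0 w by rewrite /rw Int_momentum_opp// oppr0.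
  rewrite E1 E2 (Int_cat lw xle1 y1) (Int_cat lw x1 N11).
  by rewrite (Int_cat lw (lerN10 R) ler01); ring.
have close : `|phi + pi + 2 * (k%:~R * pi)| <= 2 * eps + 4 * tau.
  have Ty := T y y1; have Tx := Tr (- x) z1; rewrite -/th in Ty.
  have {}Tx : `|Int 1 (- x) rw - thr| <= tau by exact: Tx.
  by rewrite wE in Hk; exact: (phase_sum_le Hk Ty Tx S Sr).
have cle : cos phi <= -1 + (2 * eps + 4 * tau).
  have := cos_lipschitz phi (- (pi + 2 * (k%:~R * pi))).
  have -> : phi - - (pi + 2 * (k%:~R * pi)) = phi + pi + 2 * (k%:~R * pi) by ring.
  rewrite cosN cosD2kpi cospi opprK => h.
  by rewrite addrC -lerBlDr opprK; exact: (le_trans (ler_norm _) (le_trans h close)).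
have -> : (a 1 / q + a (-1) / qr) ^+ 2 + (b 1 / q + b (-1) / qr) ^+ 2 =
  ((a 1 / q) ^+ 2 + (b 1 / q) ^+ 2) + ((a (-1) / qr) ^+ 2 + (b (-1) / qr) ^+ 2) + 2 * re.
  by rewrite /re; ring.
rewrite U Ur -cphi; have -> : 1 + 1 + 2 * cos phi = 2 * (cos phi + 1) by ring.
have -> : 4 * eps + 8 * tau = 2 * (2 * eps + 4 * tau) by ring.
by rewrite ler_pM2l// -lerBrDr addrC.
Qed.

(** The left half line is the right half line of the reflected field. Since the two directions are
    nearly opposite and the kink is odd, the direction at 1 serves on both sides. *)
Lemma kink_close (L tau : R) : 1 <= L -> 0 < tau -> tau <= 1 ->
  exists2 dl : R, 0 < dl & forall (a b a' b' : R -> R),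
    H1loc a b a' b' -> modsq a b 0 <= dl ->
    energy_le a b a' b' (kink_energy + dl) -> momentum_near_pi2 a b a' b' dl ->
    0 < modsq a b 1 /\ forall x, - L <= x <= L ->
      `|a x - a 1 / Num.sqrt (modsq a b 1) * K x| <= tau /\
      `|b x - b 1 / Num.sqrt (modsq a b 1) * K x| <= tau.
Proof.
move=> L1 tau0 tau1.
(* Quadratic in [tau], because the sum of the two directions is controlled through its square:
   [4 dl + 8 t1 <= 12 t1 <= (tau / 2)^2]. *)
have [t1 t1E] : exists z, z = tau ^+ 2 / 64 by exists (tau ^+ 2 / 64).
have tt : 0 < tau ^+ 2 <= tau by rewrite exprn_gt0//= expr2 ger_pMl.
have t10 : 0 < t1 by lra.
have t11 : t1 <= 1 by lra.
have [dl' dl'0 RH] := right_half_limit L1 t10 t11.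
(* [kp] is fixed before [dl]: the modulus at 0 must lie below [kp^2], and the defect bound
   [dl + 19 kp <= 20 kp] must lie below [dl']. *)
have [kp [kp0 kp1 kpd]] : exists kp, [/\ 0 < kp, kp <= 1 & 40 * kp <= dl'].
  exists (Num.min 1 (dl' / 40)); rewrite ge_min lexx lt_min; split => //.
    by rewrite ltr01/= divr_gt0.
  have : Num.min 1 (dl' / 40) <= dl' / 40 by rewrite ge_min lexx orbT.
  by lra.
have kk0 : 0 < kp ^+ 2 by rewrite exprn_gt0.
have [dl [dl0 dlk dlt dlk1]] : exists dl, [/\ 0 < dl, dl <= kp ^+ 2, dl <= t1 & dl <= kp].
  exists (Num.min (kp ^+ 2) (Num.min t1 kp)).
  by rewrite !lt_min !ge_min !lexx kk0 t10 kp0 /= !orbT.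
have kpdl : kp <= dl' by lra.
have ddl : dl + 19 * kp <= dl' by lra.
have t1t : t1 <= tau by lra.
have t12 : t1 <= tau / 2 by lra.
have sq (z y : R) : z ^+ 2 + y ^+ 2 <= 4 * dl + 8 * t1 -> `|z| <= tau / 2.
  move=> zy; rewrite -(@ler_pXn2r _ 2) ?nnegrE ?divr_ge0 ?(ltW tau0)//.
  by rewrite real_normK ?num_real// expr_div_n; have := sqr_ge0 y; lra.
have ke : kink_energy + dl <= 2 by have := kink_energy_le1; lra.
exists dl => // a b a' b' H n0 EH MH.
have tl := momentum_near_pi2_tails MH.
have n0k := le_trans n0 dlk.
have D y : 0 <= y -> Int 0 y (defect a b a' b' kp) <= dl + 19 * kp.
  exact: (Int_defect_le H kp0 kp1 n0k tl EH).
have E2 y : 0 <= y -> Int 0 y (energy_density a b a' b') <= 2.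
  by move=> /EH/le_trans; exact.
have Hr := H1loc_opp H; have EHr := energy_le_opp H EH; have tlr := modulus_tails_opp tl.
have n0kr : modsq (fun t => a (- t)) (fun t => b (- t)) 0 <= kp ^+ 2 by rewrite /modsq oppr0.
have Dr y : 0 <= y -> Int 0 y (defect (fun t => a (- t)) (fun t => b (- t))
    (fun t => - a' (- t)) (fun t => - b' (- t)) kp) <= dl + 19 * kp.
  exact: (Int_defect_le Hr kp0 kp1 n0kr tlr EHr).
have E2r y : 0 <= y -> Int 0 y (energy_density (fun t => a (- t)) (fun t => b (- t))
    (fun t => - a' (- t)) (fun t => - b' (- t))) <= 2.
  by move=> /EHr/le_trans; exact.
have [A [c c0 cn] T S] := RH _ _ _ _ _ _ H kp0 kpdl n0k D ddl E2.
have [Ar [cr cr0 crn] Tr Sr] := RH _ _ _ _ _ _ Hr kp0 kpdl n0kr Dr ddl E2r.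
have := opposite_directions H MH c0 cn cr0 crn T Tr S Sr.
have n1 : 0 < modsq a b 1 by apply: (lt_le_trans c0); exact: cn.
move: Ar; rewrite /modsq /= -!/(modsq _ _ _) => Ar.
set ea := a 1 / _; set era := a (-1) / _; set eb := b 1 / _; set erb := b (-1) / _ => opp.
have [oa ob] : `|ea + era| <= tau / 2 /\ `|eb + erb| <= tau / 2.
  by split; [exact: sq opp|apply: sq; rewrite addrC; exact: opp].
split=> // x xL; have [x0|x0] := leP 0 x.
  have [|h1 h2] := A x; first by rewrite x0; have [_ ->] := andP xL.
  by split; [exact: le_trans h1 t1t|exact: le_trans h2 t1t].
have Kb := kink_norm_le1 x.
have fin (z u v : R) : `|z - v * K (- x)| <= t1 -> `|u + v| <= tau / 2 -> `|z - u * K x| <= tau.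
  move=> h1 h2; have -> : z - u * K x = (z - v * K (- x)) - (u + v) * K x by rewrite kinkN; ring.
  apply: (le_trans (ler_normB _ _)); rewrite normrM.
  rewrite [leRHS]splitr; apply: lerD; first exact: (le_trans h1 t12).
  by rewrite -[leRHS]mulr1; exact: ler_pM.
have [|h1 h2] := Ar (- x).
  by rewrite oppr_ge0 (ltW x0)/= lerNl; have [->] := andP xL.
by rewrite opprK in h1 h2; split; [exact: fin h1 oa|exact: fin h2 ob].
Qed.

End two_sided_limit.

(** * From locally uniform closeness to closeness in L^2 *)

Section L2_convergence.
Context {R : realType}.
Notation K := (@kink R).
Notation K' := (@kink' R).
Notation s2 := (Num.sqrt 2 : R).

Definition kink_density := energy_density K (fun=> 0) K' (fun=> 0).

Lemma H1loc_kink : H1loc K (fun=> 0) K' (fun=> 0).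
Proof.
split; [exact: prim_kink|exact: prim_cst|].
by apply: continuous_locint; have := @continuous_kink' R => ck; cts.
Qed.

Lemma kink'_sqr t : K' t ^+ 2 = (1 - K t ^+ 2) ^+ 2 / 2.
Proof. by rewrite /kink' expr_div_n sqrt2_sqr. Qed.

Lemma kink_densityE t : kink_density t = (1 - K t ^+ 2) ^+ 2 / 2.
Proof.
rewrite /kink_density /energy_density /modsq kink'_sqr expr0n/= !addr0.
by field.
Qed.

Lemma Int_kink_density x y : x <= y ->
  Int x y kink_density = ((K y - K y ^+ 3 / 3) - (K x - K x ^+ 3 / 3)) / s2.
Proof.
move=> xy; have s0 := @sqrt2_gt0 R; have pk := @prim_kink R.
have := primZ s2^-1 (primD pk (primZ (- (1/3)) (primM (primM pk pk) pk))).
move=> /primE/(_ xy) E.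
transitivity (s2^-1 * (K y + - (1 / 3) * (K y * K y * K y))
  - s2^-1 * (K x + - (1 / 3) * (K x * K x * K x))); last by field; rewrite gt_eqF.
rewrite -E; apply: Int_eq => t _; rewrite kink_densityE /kink'.
have -> : (1 - K t ^+ 2) ^+ 2 / 2 = (1 - K t ^+ 2) ^+ 2 / s2 ^+ 2 by rewrite sqrt2_sqr.
by field; rewrite gt_eqF.
Qed.

Lemma kink_potential_bound x : - (2 / 3) <= K x - K x ^+ 3 / 3 <= 2 / 3.
Proof.
have : -1 < K x < 1 := kink_bound x.
have A : 2 / 3 - (K x - K x ^+ 3 / 3) = (1 - K x) ^+ 2 * (K x + 2) / 3 by field.
have B : 2 / 3 + (K x - K x ^+ 3 / 3) = (1 + K x) ^+ 2 * (2 - K x) / 3 by field.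
move=> kb.
have : 0 <= (1 - K x) ^+ 2 * (K x + 2) / 3.
  by rewrite divr_ge0// mulr_ge0 ?sqr_ge0//; lra.
have : 0 <= (1 + K x) ^+ 2 * (2 - K x) / 3.
  by rewrite divr_ge0// mulr_ge0 ?sqr_ge0//; lra.
by rewrite -A -B; lra.
Qed.

Lemma kink_energy_sqrt : kink_energy = (4 / 3) / s2.
Proof.
have s0 := @sqrt2_gt0 R; apply: (mulIf (lt0r_neq0 s0)); rewrite divfK ?gt_eqF// /kink_energy.
by have := @sqrt2_sqr R; rewrite expr2; lra.
Qed.

Lemma energy_le_kink : energy_le K (fun=> 0) K' (fun=> 0) kink_energy.
Proof.
move=> x y xy; rewrite Int_kink_density// kink_energy_sqrt.
rewrite ler_pM2r ?invr_gt0 ?sqrt2_gt0//.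
by have := kink_potential_bound x; have := kink_potential_bound y; lra.
Qed.

(** The missing energy contains the factor [(1 - K L)^2 (K L + 2) / 3]; one [1 - K L] is kept and
    the rest is at most 1. *)
Lemma Int_kink_window L : 0 <= L ->
  kink_energy - 2 * (1 - K L) <= Int (- L) L kink_density.
Proof.
move=> L0; have s0 := @sqrt2_gt0 R; rewrite Int_kink_density; last lra.
have : -1 < K L < 1 := kink_bound L; have : 0 <= K L by exact: kink_ge0.
rewrite kinkN kink_energy_sqrt => k0 kb.
have -> : (K L - K L ^+ 3 / 3 - (- K L - (- K L) ^+ 3 / 3)) / s2 =
  4 / 3 / s2 - 2 * ((1 - K L) * ((1 - K L) * (K L + 2) / 3)) / s2.
  by field; rewrite gt_eqF.
rewrite lerD2l lerN2 ler_pdivrMr//.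
have s1 : 1 <= s2 by have := @sqrt2_sqr R; move: (s2) s0 => s s0 ss; nra.
have A : (1 - K L) * ((1 - K L) * (K L + 2) / 3) <= (1 - K L) * 1.
  by apply: ler_wpM2l; [lra|nra].
have : 2 * (1 - K L) * 1 <= 2 * (1 - K L) * s2 by apply: ler_wpM2l => //; lra.
by lra.
Qed.

Lemma locint_square_diff (a b a' b' : R -> R) ea eb : H1loc a b a' b' ->
  locint (fun t => (a' t - ea * K' t) ^+ 2 + (b' t - eb * K' t) ^+ 2).
Proof.
move=> [pa pb l2]; have ck' := @continuous_kink' R.
have la := prim_locint pa; have lb := prim_locint pb.
have : locint (fun t => (a' t ^+ 2 + b' t ^+ 2) + (K' t * (- 2 * ea * a' t - 2 * eb * b' t) +
    (ea ^+ 2 + eb ^+ 2) * K' t ^+ 2)).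
  apply: locintD => //; apply: locintD; last by apply: continuous_locint; cts.
  by apply: locintM => //; apply: locintB; exact: locintZ.
by congr locint; apply/funext => t; ring.
Qed.

(** Bookkeeping over three pieces: index 1 is the left tail, 2 the window [[-L, L]], 3 the right
    tail. The letters [e] and [k] are tail energies of the field and of the kink, [g] is the energy
    excess and [d] is [1 - K L]. *)
Lemma square_diff_sum (q1 q2 q3 e1 e3 k1 k3 g d L t : R) :
  q1 <= 4 * e1 + 4 * k1 -> q3 <= 4 * e3 + 4 * k3 ->
  q2 / 2 + e1 + e3 <= g + 2 * d + 18 * L * t -> k1 + k3 <= 2 * d ->
  0 <= q2 -> 0 <= e1 -> 0 <= e3 -> 0 <= d -> 0 <= L * t ->
  q1 + (q2 + q3) <= 8 * g + 32 * d + 216 * L * t.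
Proof. by lra. Qed.

Lemma potential_diff_sum (v1 v2 v3 q2 e1 e3 k1 k3 g d L t : R) :
  v1 <= 8 * e1 + 8 * k1 -> v3 <= 8 * e3 + 8 * k3 -> v2 <= 72 * L * t ->
  q2 / 2 + e1 + e3 <= g + 2 * d + 18 * L * t -> k1 + k3 <= 2 * d ->
  0 <= q2 -> 0 <= d -> v1 + (v2 + v3) <= 8 * g + 32 * d + 216 * L * t.
Proof. by lra. Qed.

Section fixed_field.
Variables (a b a' b' : R -> R) (ea eb L tau eps : R).
Hypotheses (H : H1loc a b a' b') (L1 : 1 <= L) (tau01 : 0 <= tau <= 1).
Hypothesis unit_e : ea ^+ 2 + eb ^+ 2 = 1.
Hypothesis EH : energy_le a b a' b' (kink_energy + eps).
Hypothesis close : forall x, - L <= x <= L ->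
  `|a x - ea * K x| <= tau /\ `|b x - eb * K x| <= tau.
Notation n := (modsq a b).
Notation e := (energy_density a b a' b').

Let Q t := (a' t - ea * K' t) ^+ 2 + (b' t - eb * K' t) ^+ 2.
Let V t := ((1 - n t) - (1 - K t ^+ 2)) ^+ 2.

Let e1 : `|ea| <= 1.
Proof.
have := unit_e; have := sqr_ge0 eb => e2 u.
by rewrite -(@ler_pXn2r _ 2) ?nnegrE// real_normK ?num_real// expr1n; lra.
Qed.

Let e2 : `|eb| <= 1.
Proof.
have := unit_e; have := sqr_ge0 ea => e2 u.
by rewrite -(@ler_pXn2r _ 2) ?nnegrE// real_normK ?num_real// expr1n; lra.
Qed.

Lemma modsq_close x : - L <= x <= L -> `|n x - K x ^+ 2| <= 6 * tau.
Proof.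
move=> /close[ha hb].
have -> : n x - K x ^+ 2 = (a x - ea * K x) * (a x - ea * K x + 2 * (ea * K x)) +
    (b x - eb * K x) * (b x - eb * K x + 2 * (eb * K x)).
  transitivity (n x - (ea ^+ 2 + eb ^+ 2) * K x ^+ 2); first by rewrite unit_e mul1r.
  by rewrite /modsq; ring.
have Kb := kink_norm_le1 x.
have t01 := tau01.
have bnd (z c : R) : `|z| <= tau -> `|c| <= 1 -> `|z * (z + 2 * (c * K x))| <= tau * 3.
  move=> hz hc; rewrite normrM; apply: ler_pM => //.
  apply: (le_trans (ler_normD _ _)).
  have : `|2 * (c * K x)| <= 2.
    by rewrite normrM gtr0_norm// ler_piMr// normrM mulr_ile1.
  by lra.
apply: (le_trans (ler_normD _ _)).
by have := bnd _ _ ha e1; have := bnd _ _ hb e2; lra.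
Qed.

Let dlt t := ea * a t + eb * b t - K t.
Let dlt' t := ea * a' t + eb * b' t - K' t.

Let pdlt : is_prim dlt dlt'.
Proof.
have [pa pb _] := H.
apply: (prim_eq (primD (primD (primZ ea pa) (primZ eb pb)) (primZ (-1) (@prim_kink R)))) => t.
  by rewrite /dlt mulN1r.
by rewrite /dlt' mulN1r.
Qed.

Lemma dlt_small x : - L <= x <= L -> `|dlt x| <= 2 * tau.
Proof.
move=> /close[ha hb].
have -> : dlt x = ea * (a x - ea * K x) + eb * (b x - eb * K x).
  by rewrite /dlt -{1}[K x]mul1r -unit_e; ring.
apply: (le_trans (ler_normD _ _)); rewrite !normrM.
have : `|ea| * `|a x - ea * K x| <= 1 * tau by apply: ler_pM.
have : `|eb| * `|b x - eb * K x| <= 1 * tau by apply: ler_pM.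
by lra.
Qed.

(* Integration by parts moves the derivative onto the smooth factor [K']. *)
Lemma Int_cross_small : `|Int (- L) L (fun t => K' t * dlt' t)| <= 4 * tau + 8 * L * tau.
Proof.
have l1 := L1; have t01 := tau01.
have LL : - L <= L by lra.
have pk' := @prim_kink' R; have s0 := @sqrt2_gt0 R.
have ck' := @continuous_kink' R; have ck := @continuous_kink R.
have cd := prim_continuous pdlt.
have lA : locint (fun t => K' t * dlt' t) by apply: locintM => //; exact: prim_locint pdlt.
have lB : locint (fun t => dlt t * - (s2 * K t * K' t)).
  by apply: continuous_locint; cts.
have := primE (primM pdlt pk') LL; rewrite IntD// => E.
have -> : Int (- L) L (fun t => K' t * dlt' t) =
    (dlt L * K' L - dlt (- L) * K' (- L)) - Int (- L) L (fun t => dlt t * - (s2 * K t * K' t)).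
  by rewrite -E; ring.
have k'1 t : `|K' t| <= 1 by rewrite gtr0_norm ?kink'_gt0// kink'_le1.
have k1 t := kink_norm_le1 (t : R).
have dK t : - L <= t <= L -> `|dlt t * K' t| <= 2 * tau.
  by move=> /dlt_small h; rewrite normrM -[leRHS]mulr1; exact: ler_pM.
have s22 : s2 <= 2 by have := @sqrt2_sqr R; move: (s2) s0 => s s0 ss; nra.
have I : `|Int (- L) L (fun t => dlt t * - (s2 * K t * K' t))| <= 8 * L * tau.
  apply: (@le_trans _ _ (Int (- L) L (fun=> 4 * tau))).
    apply: Int_norm_le => //; first exact: locint_cst.
    move=> t /dlt_small h; rewrite normrM normrN.
    have : `|dlt t| * `|s2 * K t * K' t| <= 2 * tau * 2.
      apply: ler_pM => //; rewrite -mulrA normrM (gtr0_norm s0) -[leRHS]mulr1.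
      by apply: ler_pM => //; rewrite normrM mulr_ile1.
    by lra.
  by rewrite Int_cst//; lra.
have d1 : `|dlt L * K' L| <= 2 * tau by apply: dK; lra.
have d2 : `|dlt (- L) * K' (- L)| <= 2 * tau by apply: dK; lra.
apply: (le_trans (ler_normB _ _)).
by have := ler_normB (dlt L * K' L) (dlt (- L) * K' (- L)); lra.
Qed.

Let lQ : locint Q. Proof. exact: locint_square_diff H. Qed.

Let lV : locint V.
Proof.
apply: continuous_locint; have cn := modsq_continuous H; have ck := @continuous_kink R.
by rewrite /V; cts.
Qed.

Let le_ : locint e. Proof. exact: locint_energy H. Qed.
Let lk : locint kink_density. Proof. exact: locint_energy H1loc_kink. Qed.
Let e_ge0 t : 0 <= e t. Proof. exact: energy_density_ge0. Qed.

(** Since [(ea, eb)] is a unit vector and [K'^2 = (1 - K^2)^2 / 2], expanding the square gives [Q /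
    2 <= e - kink_density + 3 tau - K' dlt'] in the window. Thus the energy excess bounds [Q] there
    and, at the same time, the energy of the field outside. The constant is [18 = 6 + 4 + 8], with
    [tau <= L tau]. *)
Lemma Int_window x y : x <= - L -> L <= y ->
  Int (- L) L Q / 2 + Int x (- L) e + Int L y e <= eps + 2 * (1 - K L) + 18 * L * tau.
Proof.
move=> xL Ly; have l1 := L1; have t01 := tau01; have LL : - L <= L by lra.
have ld : locint (fun t => K' t * dlt' t).
  by apply: locintM; [exact: continuous_kink'|exact: prim_locint pdlt].
have lF : locint (fun t => e t - kink_density t + 3 * tau).
  exact: (locintD (locintB le_ lk) (locint_cst _)).
have A : Int (- L) L Q / 2 <= Int (- L) L e - Int (- L) L kink_density + 6 * L * tau
    - Int (- L) L (fun t => K' t * dlt' t).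
  have -> : Int (- L) L Q / 2 = Int (- L) L (fun t => 2^-1 * Q t) by rewrite (@IntZ _ _ _ 2^-1 Q lQ) mulrC.
  have -> : Int (- L) L e - Int (- L) L kink_density + 6 * L * tau
      - Int (- L) L (fun t => K' t * dlt' t) =
      Int (- L) L (fun t => e t - kink_density t + 3 * tau - K' t * dlt' t).
    rewrite (IntB _ _ lF ld) (IntD _ _ (locintB le_ lk) (locint_cst _)) (IntB _ _ le_ lk).
    by rewrite Int_cst//; ring.
  apply: Int_le; [exact: locintZ|exact: (locintB lF ld)|].
  move=> t /modsq_close; rewrite ler_norml => nk.
  rewrite kink_densityE /Q /energy_density /dlt'.
  have -> : 2^-1 * ((a' t - ea * K' t) ^+ 2 + (b' t - eb * K' t) ^+ 2) =
    2^-1 * (a' t ^+ 2 + b' t ^+ 2) - K' t * (ea * a' t + eb * b' t)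
    + 2^-1 * ((ea ^+ 2 + eb ^+ 2) * K' t ^+ 2) by field.
  rewrite unit_e mul1r.
  rewrite kink'_sqr.
  have B : (1 - K t ^+ 2) ^+ 2 - 12 * tau <= (1 - n t) ^+ 2.
    have -> : (1 - n t) ^+ 2 = (1 - K t ^+ 2) ^+ 2
       - 2 * (1 - K t ^+ 2) * (n t - K t ^+ 2) + (n t - K t ^+ 2) ^+ 2 by ring.
    have k01 : 0 <= 1 - K t ^+ 2 <= 1.
      by have : -1 < K t < 1 := kink_bound t; have := sqr_ge0 (K t) => ? ?; nra.
    have := sqr_ge0 (n t - K t ^+ 2); nra.
  have C : K' t * (ea * a' t + eb * b' t - K' t) =
     K' t * (ea * a' t + eb * b' t) - (1 - K t ^+ 2) ^+ 2 / 2.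
    by rewrite -kink'_sqr; ring.
  by rewrite C; lra.
have B := EH (le_trans xL (le_trans LL Ly)).
rewrite (Int_cat le_ xL (le_trans LL Ly)) (Int_cat le_ LL Ly) in B.
have L0 : 0 <= L by lra.
have C := Int_kink_window L0; have := Int_cross_small; rewrite ler_norml => D.
have Lt : tau <= L * tau by rewrite ler_peMl//; lra.
by move: A B C D; lra.
Qed.

Lemma Int_kink_tails x y : x <= - L -> L <= y ->
  Int x (- L) kink_density + Int L y kink_density <= 2 * (1 - K L).
Proof.
move=> xL Ly; have l1 := L1; have LL : - L <= L by lra.
have L0 : 0 <= L by lra.
have C := Int_kink_window L0.
have := energy_le_kink (le_trans xL (le_trans LL Ly)).
by rewrite -/kink_density (Int_cat lk xL (le_trans LL Ly)) (Int_cat lk LL Ly); lra.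
Qed.

(** In the window [Q] is bounded by [Int_window] and [V] by uniform closeness. Outside, both are
    dominated by the energy densities of the field and of the kink, whose tails are small. The
    segment may be enlarged to contain the window because [Q] and [V] are nonnegative. *)
Lemma Int_square_diff x y : x <= y ->
  Int x y Q <= 8 * eps + 32 * (1 - K L) + 216 * L * tau /\
  Int x y V <= 8 * eps + 32 * (1 - K L) + 216 * L * tau.
Proof.
move=> xy; have l1 := L1; have t01 := tau01; have LL : - L <= L by lra.
pose x' := Num.min x (- L); pose y' := Num.max y L.
have [x'x x'L] : x' <= x /\ x' <= - L by rewrite !ge_min !lexx orbT.
have [yy' Ly'] : y <= y' /\ L <= y' by rewrite !le_max !lexx orbT.
have Q0 t : 0 <= Q t by rewrite addr_ge0 ?sqr_ge0.
have V0 t : 0 <= V t by exact: sqr_ge0.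
have W := Int_window x'L Ly'; have T := Int_kink_tails x'L Ly'.
have s x0 y0 : x0 <= y0 -> Int x0 y0 Q <= 4 * Int x0 y0 e + 4 * Int x0 y0 kink_density /\
    Int x0 y0 V <= 8 * Int x0 y0 e + 8 * Int x0 y0 kink_density.
  move=> xy0; have lin c : Int x0 y0 (fun t => c * e t + c * kink_density t) =
      c * Int x0 y0 e + c * Int x0 y0 kink_density.
    by rewrite (IntD _ _ (locintZ c le_) (locintZ c lk)) (IntZ _ _ _ le_) (IntZ _ _ _ lk).
  rewrite -!lin.
  have d4 t : Q t <= 4 * e t + 4 * kink_density t.
    have h (c : R) z : (z - c * K' t) ^+ 2 <= 2 * z ^+ 2 + 2 * (c ^+ 2 * K' t ^+ 2).
      by have := sqr_ge0 (z + c * K' t); lra.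
    have := h ea (a' t); have := h eb (b' t) => h1 h2.
    have : (ea ^+ 2 + eb ^+ 2) * K' t ^+ 2 = K' t ^+ 2 by rewrite unit_e mul1r.
    rewrite /Q /kink_density /energy_density /= expr0n/= addr0.
    by have := sqr_ge0 (1 - n t); have := sqr_ge0 (1 - modsq K (fun=> 0) t); lra.
  have d8 t : V t <= 8 * e t + 8 * kink_density t.
    rewrite kink_densityE /V /energy_density.
    have := sqr_ge0 ((1 - n t) + (1 - K t ^+ 2)); have := sqr_ge0 (1 - K t ^+ 2).
    by have := addr_ge0 (sqr_ge0 (a' t)) (sqr_ge0 (b' t)); lra.
  by split; apply: Int_le => //; exact: (locintD (locintZ _ le_) (locintZ _ lk)).
have Vw : Int (- L) L V <= 72 * L * tau.
  apply: (@le_trans _ _ (Int (- L) L (fun=> 36 * tau))).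
    apply: Int_le => //; first exact: locint_cst.
    move=> t /modsq_close nk; rewrite /V.
    have -> : (1 - n t - (1 - K t ^+ 2)) ^+ 2 = `|n t - K t ^+ 2| ^+ 2.
      by rewrite real_normK ?num_real//; ring.
    have : `|n t - K t ^+ 2| ^+ 2 <= (6 * tau) ^+ 2 by rewrite ler_pXn2r ?nnegrE//; lra.
    have : tau ^+ 2 <= tau by rewrite expr2; apply: ler_piMl; lra.
    by rewrite exprMn; lra.
  by rewrite Int_cst//; lra.
have [s1 s1'] := s _ _ x'L; have [s3 s3'] := s _ _ Ly'.
have Qa : 0 <= Int (- L) L Q by exact: Int_ge0.
have Va : 0 <= 1 - K L by rewrite subr_ge0 (le_trans (ler_norm _))// kink_norm_le1.
have i1 : 0 <= Int x' (- L) e by exact: Int_ge0.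
have i2 : 0 <= Int L y' e by exact: Int_ge0.
have Lt : 0 <= L * tau by have [t0 _] := andP tau01; rewrite mulr_ge0// (le_trans ler01).
split.
  apply: (le_trans (Int_sub lQ Q0 x'x xy yy')).
  rewrite (Int_cat lQ x'L (le_trans LL Ly')) (Int_cat lQ LL Ly').
  exact: (square_diff_sum s1 s3 W T Qa i1 i2 Va Lt).
apply: (le_trans (Int_sub lV V0 x'x xy yy')).
rewrite (Int_cat lV x'L (le_trans LL Ly')) (Int_cat lV LL Ly').
exact: (potential_diff_sum s1' s3' Vw W T Qa Va).
Qed.

End fixed_field.
End L2_convergence.

(** * Translation of the hypotheses; the kink as competitor *)

Section from_the_statement.
Context {R : realType}.
Notation mu := (@lebesgue_measure R).
Notation K := (@kink R).
Notation K' := (@kink' R).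

Lemma L2_locint (f : R -> R) : L2 f -> locint (fun t => f t ^+ 2).
Proof.
move=> [mf fi]; have f0 t : 0 <= f t ^+ 2 by exact: sqr_ge0.
have i0 : (0 <= \int[mu]_x (f x ^+ 2)%:E)%E by apply: integral_ge0 => t _; rewrite lee_fin.
have mf2 : measurable_fun setT (fun t => f t ^+ 2) by exact: measurable_funX.
have b : (\int[mu]_x (f x ^+ 2)%:E <= (fine (\int[mu]_x (f x ^+ 2)%:E))%:E)%E.
  by rewrite fineK// ge0_fin_numE.
by have [] := segments_le_integral mf2 f0 b.
Qed.

Lemma X1_H1loc (a b a' b' : R -> R) : X1 a b a' b' -> H1loc a b a' b'.
Proof.
move=> [pa [pb [_ [la [lb _]]]]]; split => //.
by apply: locintD; exact: L2_locint.
Qed.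

Lemma energy_integral (a b a' b' : R -> R) : H1loc a b a' b' ->
  energy a b a' b' = (\int[mu]_t (energy_density a b a' b' t)%:E)%E.
Proof.
move=> H; have [pa pb l2] := H; have cn := modsq_continuous H.
have m1 : measurable_fun setT (fun t => a' t ^+ 2 + b' t ^+ 2) by exact: locint_measurable.
have m2 : measurable_fun setT (fun t => (1 - modsq a b t) ^+ 2).
  by apply: locint_measurable; apply: continuous_locint; cts.
rewrite /energy -!ge0_integralZl_EFin//; last 4 first.
- by move=> t _; rewrite lee_fin sqr_ge0.
- exact/measurable_EFinP.
- by move=> t _; rewrite lee_fin addr_ge0 ?sqr_ge0.
- exact/measurable_EFinP.
rewrite -ge0_integralD//.
- by move=> t _; rewrite -EFinM lee_fin mulr_ge0// addr_ge0 ?sqr_ge0.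
- by apply/measurable_EFinP; exact: measurable_funM.
- by move=> t _; rewrite -EFinM lee_fin mulr_ge0// sqr_ge0.
- by apply/measurable_EFinP; exact: measurable_funM.
Qed.

Lemma energy_energy_le (a b a' b' : R -> R) E : H1loc a b a' b' ->
  (energy a b a' b' <= E%:E)%E -> energy_le a b a' b' E.
Proof.
move=> H; rewrite energy_integral// => EE x y _.
have le_ := locint_energy H.
have [_] := segments_le_integral (locint_measurable le_) (energy_density_ge0 a b a' b') EE.
exact.
Qed.

Lemma energy_le_energy (a b a' b' : R -> R) E : H1loc a b a' b' ->
  energy_le a b a' b' E -> (energy a b a' b' <= E%:E)%E.
Proof.
move=> H EH; rewrite energy_integral//; apply: integral_le_segments => //.
  exact: locint_energy H.
exact: energy_density_ge0.
Qed.

(** Otherwise the energy densities at [r] and [- r] would sum to at least [eta^2 / 4] for every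
    [r >= R1], which contradicts the energy bound over a length [(8 |E| + 1) / eta^2]. One [r] has
    to serve both ends because [arg_diff] compares [v(r)] with [v(-r)]. *)
Lemma symmetric_tails (a b a' b' : R -> R) E R1 eta : H1loc a b a' b' ->
  energy_le a b a' b' E -> 0 < eta ->
  exists2 r, R1 <= r & `|1 - modsq a b r| < eta /\ `|1 - modsq a b (- r)| < eta.
Proof.
move=> H EH eta0; apply: contrapT => nex.
have le_ := locint_energy H; have eta2 : 0 < eta ^+ 2 by rewrite exprn_gt0.
have big r : R1 <= r ->
    eta ^+ 2 <= 4 * energy_density a b a' b' r + 4 * energy_density a b a' b' (- r).
  move=> Rr; have low t : (1 - modsq a b t) ^+ 2 <= 4 * energy_density a b a' b' t.
    by rewrite /energy_density; have := addr_ge0 (sqr_ge0 (a' t)) (sqr_ge0 (b' t)); lra.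
  have e0 := energy_density_ge0 a b a' b'.
  have sq t : ~ `|1 - modsq a b t| < eta -> eta ^+ 2 <= (1 - modsq a b t) ^+ 2.
    move=> /negP; rewrite -leNgt => h; rewrite -(real_normK (num_real (1 - _))).
    by rewrite ler_pXn2r ?nnegrE ?(ltW eta0).
  have [h1|/sq h1] := pselect (`|1 - modsq a b r| < eta); last first.
    by have := low r; have := e0 (- r); lra.
  have [h2|/sq h2] := pselect (`|1 - modsq a b (- r)| < eta); last first.
    by have := low (- r); have := e0 r; lra.
  by exfalso; apply: nex; exists r.
pose T := (8 * `|E| + 1) / eta ^+ 2.
have T0 : 0 <= T by apply: divr_ge0; [rewrite addr_ge0// mulr_ge0|exact: ltW].
have RT : R1 <= R1 + T by rewrite lerDl.
have lo := locint_opp le_.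
have : eta ^+ 2 * (R1 + T - R1) <= 4 * E + 4 * E.
  rewrite -Int_cst//; apply: (@le_trans _ _ (Int R1 (R1 + T)
    (fun r => 4 * energy_density a b a' b' r + 4 * energy_density a b a' b' (- r)))).
    apply: Int_le; [exact: locint_cst|exact: (locintD (locintZ 4 le_) (locintZ 4 lo))|].
    by move=> r /andP[/big].
  rewrite (IntD _ _ (locintZ 4 le_) (locintZ 4 lo)) (IntZ _ _ _ le_) (IntZ _ _ _ lo).
  rewrite Int_opp//; apply: lerD; rewrite ler_pM2l//; apply: EH => //.
  by rewrite lerN2.
have -> : eta ^+ 2 * (R1 + T - R1) = 8 * `|E| + 1.
  by rewrite /T; field; rewrite gt_eqF.
by have := ler_norm E; lra.
Qed.

Lemma momentum_is_near (a b a' b' : R -> R) E p eps (k0 : int) : H1loc a b a' b' ->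
  energy_le a b a' b' E -> 0 < eps ->
  momentum_is a b a' b' p -> `|p - pi / 2 - k0%:~R * pi| < eps / 2 ->
  momentum_near_pi2 a b a' b' eps.
Proof.
move=> H EH eps0 M pk R1 eta eta0.
have e2 : 0 < eps / 2 by lra.
have [R0 HR0] := M _ e2.
have [r Rr [n1 n2]] := symmetric_tails (Num.max R0 R1) H EH eta0.
move: Rr; rewrite ge_max => /andP[R0r R1r].
exists (- r), r; split => //; first by rewrite lerN2.
move=> phi /arg_rel_arg_diff ad; have [k Hk] := HR0 r phi R0r ad.
exists (k + k0); rewrite intrD.
set X := 2^-1 * _ - 2^-1 * phi in Hk *.
have -> : X - pi / 2 - (k%:~R + k0%:~R) * pi =
  (X - p - k%:~R * pi) + (p - pi / 2 - k0%:~R * pi) by ring.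
by apply: (le_lt_trans (ler_normD _ _)); rewrite [ltRHS]splitr ltrD.
Qed.

Section translation.
Variables (a b a' b' : R -> R) (c : R).
Notation ta := (fun t => a (t + c)).
Notation tb := (fun t => b (t + c)).
Notation ta' := (fun t => a' (t + c)).
Notation tb' := (fun t => b' (t + c)).
Hypothesis H : H1loc a b a' b'.

Lemma H1loc_shift : H1loc ta tb ta' tb'.
Proof.
have [pa pb l] := H; split; [exact: prim_shift|exact: prim_shift|].
exact: (locint_shift c l).
Qed.

Lemma energy_le_shift E : energy_le a b a' b' E -> energy_le ta tb ta' tb' E.
Proof.
move=> EH x y xy; have := Int_shift c x y (locint_energy H).
by move=> ->; apply: EH; rewrite lerD2r.
Qed.

Lemma momentum_near_pi2_shift eps : momentum_near_pi2 a b a' b' eps ->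
  momentum_near_pi2 ta tb ta' tb' eps.
Proof.
move=> M R1 eta eta0; have [x [y [xR yR nx ny Harg]]] := M (R1 + `|c|) eta eta0.
have cb : - `|c| <= c <= `|c| by rewrite -ler_norml.
exists (x - c), (y - c); split; [lra|lra|by rewrite /modsq subrK|by rewrite /modsq subrK|].
move=> phi; rewrite /arg_rel !subrK => /Harg[k Hk]; exists k.
have := Int_shift c (x - c) (y - c) (locint_momentum H); rewrite !subrK.
by rewrite {1}/momentum_density => ->.
Qed.

End translation.

Lemma X1_kink : X1 K (fun=> 0) K' (fun=> 0).
Proof.
have ck := @continuous_kink R; have ck' := @continuous_kink' R.
have lk := locint_energy (@H1loc_kink R).
have fin (f : R -> R) : continuous f ->
    (forall t, f t ^+ 2 <= 2 * kink_density t) -> L2 f.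
  move=> cf fk; split; first exact: (locint_measurable (continuous_locint cf)).
  apply: (@le_lt_trans _ _ (2 * kink_energy)%:E); last exact: ltry.
  apply: integral_le_segments.
  - by apply: continuous_locint; cts.
  - by move=> t; exact: sqr_ge0.
  move=> x y xy; apply: (@le_trans _ _ (Int x y (fun t => 2 * kink_density t))).
    by apply: Int_le => [|//|t _]; [apply: continuous_locint; cts|exact: locintZ|].
  by rewrite (IntZ _ _ _ lk) ler_pM2l//; exact: energy_le_kink.
split; first exact: prim_kink.
split; first exact: prim_cst.
split.
  exists 1 => x; rewrite expr0n/= addr0.
  by have : -1 < K x < 1 := kink_bound x; nra.
split.
  apply: fin => // t; rewrite kink'_sqr kink_densityE.
  by have := sqr_ge0 (1 - K t ^+ 2); lra.
split.
  apply: fin; first exact: cts_cst.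
  by move=> t; rewrite expr0n/= mulr_ge0// energy_density_ge0.
apply: fin; first by cts.
by move=> t; rewrite kink_densityE expr0n/= addr0; lra.
Qed.

(** The kink is real, so its momentum density vanishes, and it changes sign, so the argument
    difference is [pi] modulo [2 pi]. The momentum is therefore [- pi / 2], which is [pi / 2] modulo
    [pi]. *)
Lemma momentum_is_kink : momentum_is K (fun=> 0) K' (fun=> 0) (pi / 2).
Proof.
move=> eps eps0; exists 1 => r phi r1 [].
rewrite !mul0r !mulr0 !addr0 subrr expr0n/= addr0 sqrtr_sqr kinkN mulrN normrN.
have k0 : 0 < K r by apply: kink_gt0; lra.
have kk : 0 < K r * K r by rewrite mulr_gt0.
rewrite (gtr0_norm kk) => _ [cE _].
have cphi : cos phi = -1.
  by apply: (mulIf (lt0r_neq0 kk)); rewrite cE mulN1r.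
have [k ->] := cos_eqN1 cphi.
exists (- (k + 1)); rewrite (@Int_eq _ _ _ _ (fun=> 0)); last first.
  by move=> t _; rewrite /momentum_density mulr0 mul0r subrr.
rewrite Int_cst; last lra.
rewrite mul0r mulr0 mulrNz intrD.
have -> : 0 - 2^-1 * (pi + 2 * (k%:~R * pi)) - pi / 2 - - (k%:~R + 1%:~R) * pi = 0 :> R.
  by field.
by rewrite normr0.
Qed.

Lemma Emin_le : (Emin_pi2 R <= kink_energy%:E)%E.
Proof.
apply: (@le_trans _ _ (energy K (fun=> 0) K' (fun=> 0))).
  apply: ereal_inf_lbound; exists K, (fun=> 0), K', (fun=> 0).
  by split => //; [exact: X1_kink|exact: momentum_is_kink].
by apply: energy_le_energy; [exact: H1loc_kink|exact: energy_le_kink].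
Qed.

Lemma near_minimum (u : nat -> \bar R) eps : u @ \oo --> Emin_pi2 R -> 0 < eps ->
  exists N : nat, forall n, (N <= n)%N -> (u n <= (kink_energy + eps)%:E)%E.
Proof.
move=> cu eps0.
have lt : (Emin_pi2 R < (kink_energy + eps)%:E)%E.
  by apply: (le_lt_trans Emin_le); rewrite lte_fin ltrDl.
have [N _ HN] := cu _ (open_ereal_lt' lt).
by exists N => n Nn; apply: ltW; exact: HN.
Qed.

Lemma cvge0_le (u : nat -> \bar R) : (forall n, (0 <= u n)%E) ->
  (forall eps : R, 0 < eps -> exists N : nat, forall n, (N <= n)%N -> (u n <= eps%:E)%E) ->
  u @ \oo --> 0%E.
Proof.
move=> u0 ule; apply/fine_cvgP; split.
  have [N HN] := ule 1 ltr01; exists N => // n /= /HN un.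
  by rewrite ge0_fin_numE//; apply: (le_lt_trans un); exact: ltry.
apply/cvgrPdist_le => e e0; have [N HN] := ule e e0.
exists N => // n /= /HN un; rewrite sub0r normrN /=.
have fu : u n \is a fin_num.
  by rewrite ge0_fin_numE//; apply: (le_lt_trans un); exact: ltry.
by rewrite ger0_norm ?fine_ge0// -lee_fin fineK.
Qed.

End from_the_statement.

(** * Minimizing sequences: centring, extraction of the phase and the limits *)

Lemma exists_almost_min {R : realType} (f : R -> R) (e : R) : (forall x, 0 <= f x) -> 0 < e ->
  exists c, forall x, f c <= f x + e.
Proof.
move=> f0 e0; have hi : has_inf (range f).
  by split; [exists (f 0), 0|exists 0 => _ [t _ <-]].
have [_ [c _ <-] fc] := inf_adherent e0 hi.
exists c => x; apply: (le_trans (ltW fc)); rewrite lerD2r.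
by apply: ge_inf; [case: hi|exists x].
Qed.

Theorem theorem4 (R : realType) (ua ub ua' ub' : nat -> R -> R) :
  (forall n, X1 (ua n) (ub n) (ua' n) (ub' n)) ->
  (exists p : nat -> R,
     (forall n, momentum_is (ua n) (ub n) (ua' n) (ub' n) (p n)) /\
     (forall eps : R, 0 < eps -> exists N : nat, forall n, (N <= n)%N ->
        exists k : int, `| p n - pi / 2 - k%:~R * pi | < eps)) ->
  (fun n => energy (ua n) (ub n) (ua' n) (ub' n)) @ \oo --> Emin_pi2 R ->
  exists (sigma : nat -> nat) (a : nat -> R) (theta : R),
    {homo sigma : m n / (m < n)%N >-> (m < n)%N} /\
    (forall K : set R, compact K -> forall eps : R, 0 < eps ->
       exists N : nat, forall n, (N <= n)%N -> forall x, K x ->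
         Num.sqrt ((ua (sigma n) (x + a (sigma n)) - cos theta * kink x) ^+ 2
                 + (ub (sigma n) (x + a (sigma n)) - sin theta * kink x) ^+ 2)
         < eps) /\
    ((fun n => (\int[(@lebesgue_measure R)]_x
        (((1 - (ua (sigma n) (x + a (sigma n)) ^+ 2
                + ub (sigma n) (x + a (sigma n)) ^+ 2))
          - (1 - kink x ^+ 2)) ^+ 2)%:E)%E) @ \oo --> 0%E) /\
    ((fun n => (\int[(@lebesgue_measure R)]_x
        ((ua' (sigma n) (x + a (sigma n)) - cos theta * derive1 (@kink R) x) ^+ 2
       + (ub' (sigma n) (x + a (sigma n)) - sin theta * derive1 (@kink R) x) ^+ 2)%:E)%E)
      @ \oo --> 0%E).
Proof.
move=> HX [p [Mp pcv]] Ecv.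
have H n : H1loc (ua n) (ub n) (ua' n) (ub' n) by exact: X1_H1loc.
have ev eps : 0 < eps -> exists N : nat, forall n, (N <= n)%N ->
    energy_le (ua n) (ub n) (ua' n) (ub' n) (kink_energy + eps) /\
    momentum_near_pi2 (ua n) (ub n) (ua' n) (ub' n) eps.
  move=> eps0; have e2 : 0 < eps / 2 by rewrite divr_gt0.
  have [N1 H1] := near_minimum Ecv eps0; have [N2 H2] := pcv _ e2.
  exists (maxn N1 N2) => n; rewrite geq_max => /andP[/H1 h1 /H2[k hk]].
  have EH := energy_energy_le (H n) h1.
  by split => //; exact: (momentum_is_near (H n) EH eps0 (Mp n) hk).
(* The infimum of the modulus need not be attained, so the centre is chosen up to the vanishing
   slack [1 / (n + 1)]. *)
have [c Hc] : {c : nat -> R & forall n x,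
    modsq (ua n) (ub n) (c n) <= modsq (ua n) (ub n) x + n.+1%:R^-1}.
  apply: (@choice _ _ (fun n c => forall x, modsq (ua n) (ub n) c <=
    modsq (ua n) (ub n) x + n.+1%:R^-1)) => n.
  by apply: exists_almost_min => [x|]; [exact: modsq_ge0|rewrite invr_gt0].
pose va n t := ua n (t + c n); pose vb n t := ub n (t + c n).
pose va' n t := ua' n (t + c n); pose vb' n t := ub' n (t + c n).
have Hv n : H1loc (va n) (vb n) (va' n) (vb' n) by exact: H1loc_shift.
have ev' dl : 0 < dl -> exists N : nat, forall n, (N <= n)%N ->
    [/\ modsq (va n) (vb n) 0 <= dl,
        energy_le (va n) (vb n) (va' n) (vb' n) (kink_energy + dl) &
        momentum_near_pi2 (va n) (vb n) (va' n) (vb' n) dl].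
  (* At the centre [14 (dl / 32) + dl / 2 <= dl]: the small modulus obtained at level [dl / 32],
     plus the slack of the centring. *)
  move=> dl0; have e0 : 0 < dl / 32 by rewrite divr_gt0.
  have d2 : 0 < dl / 2 by rewrite divr_gt0.
  have [N1 H1] := ev _ dl0; have [N2 H2] := ev _ e0.
  have [N3 _ H3] := near_infty_natSinv_lt (PosNum d2).
  exists (maxn N1 (maxn N2 N3)) => n; rewrite !geq_max => /and3P[/H1[E1 M1] /H2[E2 M2] /H3 h3].
  split; [|exact: energy_le_shift|exact: momentum_near_pi2_shift].
  have s2 : 1 <= Num.sqrt 2 :> R.
    by have := @sqrt2_sqr R; have := @sqrt2_gt0 R; move: (Num.sqrt 2) => s s0 ss; nra.
  have E2' : energy_le (ua n) (ub n) (ua' n) (ub' n) (kink_energy + Num.sqrt 2 * (dl / 32)).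
    by move=> x y xy; apply: (le_trans (E2 x y xy)); rewrite lerD2l ler_peMl// ltW.
  have [x0 nx0] := exists_small_modulus (H n) e0 E2' M2.
  rewrite /modsq /va /vb add0r -/(modsq (ua n) (ub n) (c n)).
  apply: (le_trans (Hc n x0)).
  have h3' : n.+1%:R^-1 < dl / 2 by exact: h3.
  by apply: le_trans (lerD nx0 (ltW h3')) _; lra.
(* The phase of the centred field at 1, with default value 0 if the field vanishes there;
   [kink_close] excludes this for large indices. The bound by [pi] holds in both cases. *)
have [th Hth] : {th : nat -> R & forall n, `|th n| <= pi /\ (0 < modsq (va n) (vb n) 1 ->
    cos (th n) = va n 1 / Num.sqrt (modsq (va n) (vb n) 1) /\
    sin (th n) = vb n 1 / Num.sqrt (modsq (va n) (vb n) 1))}.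
  apply: (@choice _ _ (fun n t => `|t| <= pi /\ (0 < modsq (va n) (vb n) 1 ->
    cos t = va n 1 / Num.sqrt (modsq (va n) (vb n) 1) /\
    sin t = vb n 1 / Num.sqrt (modsq (va n) (vb n) 1)))) => n.
  have [n1|n1] := ltP 0 (modsq (va n) (vb n) 1); last first.
    by exists 0; split => //; rewrite normr0 pi_ge0.
  by have [t tp tE] := cos_sin_surj (unit_vector n1); exists t.
have [sg sgm [theta thcv]] : exists2 sg : nat -> nat, increasing_seq sg &
    exists theta : R, th \o sg @ \oo --> theta.
  have [|sg sgm /cvg_ex cv] := @bolzano_weierstrass R th; last by exists sg.
  exists pi; split; first exact: num_real.
  by move=> M piM n _; have [h _] := Hth n; apply: (le_trans h); exact: ltW.
have sgh : {homo sg : m n / (m < n)%N >-> (m < n)%N}.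
  by move=> m n mn; rewrite ltnNge; have := sgm n m; rewrite leEnat => ->; rewrite -ltnNge.
have sgge n : (n <= sg n)%N.
  by elim: n => // n IH; apply: (leq_ltn_trans IH); exact: sgh.
have close L tau : 1 <= L -> 0 < tau -> tau <= 1 -> exists N : nat, forall n, (N <= n)%N ->
    energy_le (va (sg n)) (vb (sg n)) (va' (sg n)) (vb' (sg n)) (kink_energy + tau) /\
    forall x, - L <= x <= L ->
      `|va (sg n) x - cos theta * kink x| <= tau /\ `|vb (sg n) x - sin theta * kink x| <= tau.
  move=> L1 tau0 tau1; have t20 : 0 < tau / 2 by rewrite divr_gt0.
  have t21 : tau / 2 <= 1 by lra.
  have [dl dl0 HK] := kink_close L1 t20 t21.
  have [N1 H1] := ev' _ dl0; have [N2 H2] := ev' _ tau0.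
  have /cvgrPdist_lt/(_ _ t20)[N3 _ H3] := thcv.
  exists (maxn N1 (maxn N2 N3)) => n; rewrite !geq_max => /and3P[n1 n2 /H3 h3].
  have [m1 E1 M1] := H1 (sg n) (leq_trans n1 (sgge n)).
  have [_ E2 _] := H2 (sg n) (leq_trans n2 (sgge n)).
  split => // x xL; have [nz Hx] := HK _ _ _ _ (Hv (sg n)) m1 E1 M1.
  have [_ /(_ nz)[cE sE]] := Hth (sg n); have [ha hb] := Hx x xL.
  rewrite -cE in ha; rewrite -sE in hb.
  have Kb : `|kink x| <= 1 by rewrite ler_norml; have : -1 < kink x < 1 := kink_bound x; lra.
  have h3' : `|th (sg n) - theta| <= tau / 2 by rewrite distrC ltW//; exact: h3.
  have fin (z f g : R) : `|z - f * kink x| <= tau / 2 -> `|f - g| <= tau / 2 ->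
      `|z - g * kink x| <= tau.
    move=> hz fg; have -> : z - g * kink x = (z - f * kink x) + (f - g) * kink x by ring.
    rewrite [leRHS]splitr; apply: (le_trans (ler_normD _ _)); apply: lerD => //.
    by rewrite normrM -[leRHS]mulr1; exact: ler_pM.
  split; [apply: (fin _ _ _ ha)|apply: (fin _ _ _ hb)].
    by apply: le_trans h3'; exact: cos_lipschitz.
  by apply: le_trans h3'; exact: sin_lipschitz.
have smallI eps : 0 < eps -> exists N : nat, forall n, (N <= n)%N -> forall x y, x <= y ->
    Int x y (fun t => (va' (sg n) t - cos theta * kink' t) ^+ 2 +
                      (vb' (sg n) t - sin theta * kink' t) ^+ 2) <= eps /\
    Int x y (fun t => ((1 - modsq (va (sg n)) (vb (sg n)) t) - (1 - kink t ^+ 2)) ^+ 2) <= eps.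
  (* [L] is chosen before [tau], as the bound contains [L tau]: [8 tau + 32 (1 - K L) + 216 L tau]
     is at most [eps / 3 + 224 L tau], hence at most [eps]. The energy excess is here [tau]
     itself. *)
  move=> eps0; have e1 : 0 < eps / 12 / 8 by rewrite !divr_gt0.
  have [L L1 KL] := kink_near1 e1; have L0 : 0 < L by lra.
  have [tau [tau0 tau1 tauL]] : exists tau, [/\ 0 < tau, tau <= 1 & L * tau <= eps / 12 / 60].
    exists (Num.min 1 (eps / 12 / 60 / L)); split.
    - by rewrite lt_min ltr01/= !divr_gt0.
    - by rewrite ge_min lexx.
    have : Num.min 1 (eps / 12 / 60 / L) <= eps / 12 / 60 / L by rewrite ge_min lexx orbT.
    by rewrite ler_pdivlMr// mulrC.
  have [N HN] := close L tau L1 tau0 tau1; exists N => n /HN[EH cl] x y xy.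
  have t01 : 0 <= tau <= 1 by rewrite (ltW tau0).
  have [h1 h2] := Int_square_diff (Hv (sg n)) L1 t01 (cos2Dsin2 theta) EH cl xy.
  have tL : tau <= L * tau by rewrite ler_peMl// ltW.
  by split; [apply: (le_trans h1)|apply: (le_trans h2)]; lra.
exists sg, c, theta; split => //; split; last split.
- move=> A cA eps eps0.
  have [L [L1 AL]] : exists L, 1 <= L /\ forall x, A x -> - L <= x <= L.
    have [M [_ HM]] := compact_bounded cA; exists (`|M| + 1); split; first by rewrite lerDr.
    move=> x Ax; rewrite -ler_norml; apply: HM => //.
    by apply: (le_lt_trans (ler_norm M)); rewrite ltrDl.
  have [tau [tau0 tau1 te]] : exists tau, [/\ 0 < tau, tau <= 1 & 3 * tau <= eps].
    exists (Num.min 1 (eps / 3)); split.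
    - by rewrite lt_min ltr01/= divr_gt0.
    - by rewrite ge_min lexx.
    have : Num.min 1 (eps / 3) <= eps / 3 by rewrite ge_min lexx orbT.
    by rewrite ler_pdivlMr// mulrC.
  have [N HN] := close L tau L1 tau0 tau1; exists N => n /HN[_ cl] x /AL/cl[ha hb].
  rewrite -/(va (sg n) x) -/(vb (sg n) x).
  apply: (@le_lt_trans _ _ (2 * tau)); last lra.
  have t2 : 0 <= 2 * tau by lra.
  rewrite -[leRHS](ger0_norm t2) -sqrtr_sqr; apply: ler_wsqrtr.
  have sq (z : R) : `|z| <= tau -> z ^+ 2 <= tau ^+ 2.
    by move=> h; rewrite -(real_normK (num_real z)) ler_pXn2r ?nnegrE ?(ltW tau0).
  by have := sq _ ha; have := sq _ hb; have := sqr_ge0 tau; rewrite exprMn; lra.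
- apply: cvge0_le => [n|eps eps0].
    by apply: integral_ge0 => x _; rewrite lee_fin sqr_ge0.
  have [N HN] := smallI _ eps0; exists N => n /HN h.
  have cn := modsq_continuous (Hv (sg n)); have ck := @continuous_kink R.
  apply: (@integral_le_segments R (fun t =>
    ((1 - modsq (va (sg n)) (vb (sg n)) t) - (1 - kink t ^+ 2)) ^+ 2)).
  + by apply: continuous_locint; cts.
  + by move=> t; exact: sqr_ge0.
  + by move=> x y /h[].
- apply: cvge0_le => [n|eps eps0].
    by apply: integral_ge0 => x _; rewrite lee_fin addr_ge0 ?sqr_ge0.
  have [N HN] := smallI _ eps0; exists N => n /HN h.
  under eq_integral do rewrite derive1_kink.
  apply: (@integral_le_segments R (fun t => (va' (sg n) t - cos theta * kink' t) ^+ 2 +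
                      (vb' (sg n) t - sin theta * kink' t) ^+ 2)).
  + exact: (locint_square_diff _ _ (Hv (sg n))).
  + by move=> t; rewrite addr_ge0 ?sqr_ge0.
  + by move=> x y /h[].
Qed.
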